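(* For each choice of sign $\pm$, let $$D^{>}_{\pm}:=\{(z_1,z_2,z_3,z_4)\in\mathbb{C}^4:\ \mathrm{Re}\,z_4>z_1\overline{z_2}+z_2\overline{z_1}+|z_3|^2\pm|z_1|^4\},$$ $$D^{<}_{\pm}:=\{(z_1,z_2,z_3,z_4)\in\mathbb{C}^4:\ \mathrm{Re}\,z_4<z_1\overline{z_2}+z_2\overline{z_1}+|z_3|^2\pm|z_1|^4\}.$$ Then $\mathrm{Aut}(D_{\pm}^{>})=\mathrm{Aut}(D_{\pm}^{<})=P_{\pm}$, where $P_\pm$ is the explicit group of holomorphic transformations of $\mathbb{C}^4$ defined in the context (its elements being restricted to the respective domain).
   Context: For a domain $D\subset\mathbb{C}^4$, $\mathrm{Aut}(D)$ is the group of holomorphic automorphisms (biholomorphic self-maps) of $D$. In all formulas the upper signs are taken for the $+$ case and the lower signs for the $-$ case. $P_{\pm}$ is the group of all holomorphic transformations of $\mathbb{C}^4$ of the form $$\begin{aligned} z_1&\mapsto qe^{i\phi}z_1+\rho,\\ z_2&\mapsto (\mp2|\rho|^2qe^{i\phi}+q^2b)z_1+q^3e^{i\phi}z_2+qd\,z_3\mp2\overline{\rho}q^2e^{2i\phi}z_1^2+\sigma,\\ z_3&\mapsto -\overline{d}e^{i(\phi+\psi)}z_1+q^2e^{i\psi}z_3+\tau,\\ z_4&\mapsto (2\overline{\sigma}qe^{i\phi}+2\overline{\rho}q^2b-2\overline{\tau}\,\overline{d}e^{i(\phi+\psi)})z_1+2\overline{\rho}q^3e^{i\phi}z_2+(2\overline{\rho}qd+2\overline{\tau}q^2e^{i\psi})z_3+q^4z_4\\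 &\qquad\mp2\overline{\rho}^2q^2e^{2i\phi}z_1^2+\rho\overline{\sigma}+\sigma\overline{\rho}+|\tau|^2\pm|\rho|^4+iu, \end{aligned}$$ where $q>0$, $\phi,\psi,u\in\mathbb{R}$, $\rho,\sigma,\tau,b,d\in\mathbb{C}$, $\mathrm{Re}(e^{i\phi}\overline{b})\le 0$ and $|d|^2=-2q^3\,\mathrm{Re}(e^{i\phi}\overline{b})$. *)

(* Defs.v *)
From HB Require Import structures.
From mathcomp Require Import all_boot all_order all_algebra.
From mathcomp Require Import complex.
From mathcomp Require Import all_classical all_reals all_analysis.

Set Implicit Arguments.
Unset Strict Implicit.
Unset Printing Implicit Defensive.

Import Order.TTheory GRing.Theory Num.Theory.
Import numFieldNormedType.Exports.

Local Open Scope classical_set_scope.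
Local Open Scope ring_scope.

(* R[i] seen through the numClosedFieldType interface, on which
   numFieldNormedType.Exports provides the topology and the norm. *)
Definition Cplx (R : realType) : numClosedFieldType := R[i].

(* The coordinates (z_1, z_2, z_3, z_4) of z : C4 R are z 0 0, ..., z 0 3. *)
Notation C4 R := 'rV[Cplx R]_4.

Section Aut.
Variable R : realType.
Implicit Types (D : set (C4 R)) (f : C4 R -> C4 R).

(* The scalar field of C4 R is Cplx R, so [differentiable] is complex Frechet
   differentiability.  For D open it depends only on the values of f on D. *)
Definition holomorphic_on D f := forall z, D z -> differentiable f z.

Definition biholomorphic_self_map D f :=
  exists g : C4 R -> C4 R,
    [/\ holomorphic_on D f, holomorphic_on D g &
        [/\ set_fun D D f, set_fun D D g,
            {in D, cancel f g} & {in D, cancel g f}]].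

(* Automorphisms are honest functions on the subtype D: [sigL D f] is the
   restriction of f to D, so values outside D play no role. *)
Definition Aut D : set (D -> C4 R) := sigL D @` biholomorphic_self_map D.

End Aut.

Arguments Aut {R} D _.

Section Model.
Variable R : realType.

Definition expi (t : R) : Cplx R := (cos t +i* sin t)%C.

(* [(-1) ^+ s] is the sign +- : plus for s = false, minus for s = true. *)
Definition model_fun (s : bool) (z : C4 R) : Cplx R :=
  let z1 := z 0 0 in let z2 := z 0 1 in let z3 := z 0 2 in
  z1 * z2^* + z2 * z1^* + `|z3| ^+ 2 + (-1) ^+ s * `|z1| ^+ 4.

(* Both sides of the inequalities are real elements of Cplx R, on which the
   partial order of Cplx R is the order of R. *)
Definition Dgt (s : bool) : set (C4 R) :=
  [set z : C4 R | 'Re (z 0 3) > model_fun s z].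

Definition Dlt (s : bool) : set (C4 R) :=
  [set z : C4 R | 'Re (z 0 3) < model_fun s z].

Definition P_map (s : bool) (q0 phi psi u0 : R) (rho sigma tau b d : Cplx R)
    (z : C4 R) : C4 R :=
  let pm : Cplx R := (-1) ^+ s in
  let q : Cplx R := (q0%:C)%C in
  let u : Cplx R := (u0%:C)%C in
  let z1 := z 0 0 in let z2 := z 0 1 in let z3 := z 0 2 in let z4 := z 0 3 in
  let w1 := q * expi phi * z1 + rho in
  let w2 :=
    (- pm * 2 * `|rho| ^+ 2 * q * expi phi + q ^+ 2 * b) * z1
    + q ^+ 3 * expi phi * z2 + q * d * z3
    - pm * 2 * rho^* * q ^+ 2 * expi (2 * phi) * z1 ^+ 2 + sigma in
  let w3 := - d^* * expi (phi + psi) * z1 + q ^+ 2 * expi psi * z3 + tau in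
  let w4 :=
    (2 * sigma^* * q * expi phi + 2 * rho^* * q ^+ 2 * b
     - 2 * tau^* * d^* * expi (phi + psi)) * z1
    + 2 * rho^* * q ^+ 3 * expi phi * z2
    + (2 * rho^* * q * d + 2 * tau^* * q ^+ 2 * expi psi) * z3
    + q ^+ 4 * z4
    - pm * 2 * rho^* ^+ 2 * q ^+ 2 * expi (2 * phi) * z1 ^+ 2
    + rho * sigma^* + sigma * rho^* + `|tau| ^+ 2 + pm * `|rho| ^+ 4
    + 'i * u in
  \row_j [:: w1; w2; w3; w4]`_j.

Definition P_group (s : bool) : set (C4 R -> C4 R) :=
  [set p | exists (q phi psi u : R) (rho sigma tau b d : Cplx R),
     [/\ 0 < q,
         'Re (expi phi * b^*) <= 0,
         `|d| ^+ 2 = - 2 * (q%:C)%C ^+ 3 * 'Re (expi phi * b^*) &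
         p = P_map s q phi psi u rho sigma tau b d]].

End Model.

Arguments Dgt : clear implicits.
Arguments Dlt : clear implicits.
Arguments P_group : clear implicits.

(* Main.v *)
Require Import Defs.
From mathcomp Require Import all_boot all_order all_algebra.
From mathcomp Require Import complex.
From mathcomp Require Import all_classical all_reals all_analysis.
From mathcomp Require Import ring lra.

Set Implicit Arguments.
Unset Strict Implicit.
Unset Printing Implicit Defensive.
Import Order.TTheory GRing.Theory Num.Theory.
Import numFieldNormedType.Exports.
Local Open Scope classical_set_scope.
Local Open Scope ring_scope.

(** Let [M] be the hypersurface [z_4 + z_4^* = 2 Q(z, z)] that bounds the two domains,
    where [Q(z, w) = z_1 w_2^* + z_2 w_1^* + z_3 w_3^* +- z_1^2 w_1^*^2] is the
    polarized form [pol].  The theorem is true because automorphisms extend to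
    the whole space, where they have to permute the Segre varieties of [M], and the
    few maps that do so can be computed.

    Extension.  The Levi form of [M] has eigenvalues of both signs.  On either side,
    every point [z] of the space has a direction [v] such that the contour [z + t v],
    with [t] on the boundary of the unit square, lies in the domain
    ([admissible_exists]); when [z] moves along the last axis, the contours stay in the
    domain and finally the discs that they bound do, too.  By Cauchy's formula and the
    identity principle, the contour integral then extends every holomorphic function
    ([hartogs_extension]).  So an automorphism and its inverse extend to mutually
    inverse entire maps [F] and [G], which preserve [M] ([boundary_preserved]).

    Polarization.  A pair [z], [w] with [z_4 + w_4^* = 2 Q(z, w)], a relation
    written [seg], is joined by a holomorphic curve whose real points are in [M]
    ([polarizing_curve]).  The equation that holds on [M] therefore extends:
    [F] preserves the relation [seg] ([segre_preserved]).

    Segre varieties.  The sets [seg _ w] and [seg _ w'] are disjoint exactly when [w] and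
    [w'] are distinct points on a line parallel to the last axis.  Hence [F] maps
    such lines to such lines ([fibers_preserved]).

    Computation.  A translation in the group reduces to [F 0 = 0].  Then the last
    component of [F] is [l z_4], and [l Q(z, w) = Q(F z, F w)].  Both sides are Hermitian
    forms in [(z_1, z_2, z_3, z_1^2)], so that the first three components and the square of
    the first are linear combinations of these four functions; comparing coefficients
    leaves the linear maps of the group ([linear_part]).  Conversely, the maps of
    the group multiply the defining function by [q^4] ([palg_seg]).

    Holomorphy means complex differentiability at each point, so the one-variable theory
    starts from Goursat's theorem.  Rectangles are used instead of discs,
    because their contour integrals reduce to integrals over real segments. *)

(** * The complex modulus and complex derivatives *)

Section Modulus.
Variable R : realType.
Local Notation K := (Cplx R).
Implicit Types (z w : K) (x y : R).

(** The norm of [Cplx R] takes values in the partially ordered field itself;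
    estimates are carried out with this copy in the totally ordered [R]. *)
Definition cmod z : R := complex.Re `|z|.

Lemma cmodE z : `|z| = ((cmod z)%:C)%C.
Proof. by rewrite /cmod RRe_real// normr_real. Qed.

Lemma cmod_ge0 z : 0 <= cmod z.
Proof. by have := normr_ge0 z; rewrite cmodE ler0c. Qed.

Lemma cmod0 : cmod 0 = 0.
Proof. by rewrite /cmod normr0. Qed.

Lemma cmod_eq0 z : (cmod z == 0) = (z == 0).
Proof.
apply/eqP/eqP => [h|->]; last exact: cmod0.
by apply/eqP; rewrite -normr_eq0 cmodE h.
Qed.

Lemma cmod_gt0 z : (0 < cmod z) = (z != 0).
Proof. by rewrite lt_def cmod_ge0 andbT cmod_eq0. Qed.

Lemma cmodM z w : cmod (z * w) = cmod z * cmod w.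
Proof.
by apply: complexI; rewrite rmorphM/= -!cmodE normrM.
Qed.

Lemma cmodX z n : cmod (z ^+ n) = cmod z ^+ n.
Proof. by apply: complexI; rewrite rmorphXn/= -!cmodE normrX. Qed.

Lemma cmodV z : cmod z^-1 = (cmod z)^-1.
Proof. by apply: complexI; rewrite fmorphV/= -!cmodE normfV. Qed.

Lemma cmodN z : cmod (- z) = cmod z.
Proof. by rewrite /cmod normrN. Qed.

Lemma cmod_conj z : cmod z^* = cmod z.
Proof. by rewrite /cmod norm_conjC. Qed.

Lemma le_cmodD z w : cmod (z + w) <= cmod z + cmod w.
Proof.
by rewrite -lecR rmorphD/= -!cmodE ler_normD.
Qed.

Lemma le_cmodB z w : cmod z - cmod w <= cmod (z - w).
Proof. by rewrite lerBlDr; have := le_cmodD (z - w) w; rewrite subrK. Qed.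

Lemma cmod_real x : cmod (x%:C)%C = `|x|.
Proof. by rewrite /cmod normc_def/= expr0n addr0 sqrtr_sqr. Qed.

Lemma cmod_sqr z : cmod z ^+ 2 = complex.Re z ^+ 2 + complex.Im z ^+ 2.
Proof.
rewrite /cmod normc_def [complex.Re _]/= sqr_sqrtr//.
by apply: addr_ge0; exact: sqr_ge0.
Qed.

Lemma cmod_i : cmod 'i = 1.
Proof. by rewrite /cmod normCi. Qed.

Lemma le_Re_cmod z : `|complex.Re z| <= cmod z.
Proof.
rewrite -(ler_pXn2r (ltn0Sn 1)) ?nnegrE ?cmod_ge0//.
by rewrite cmod_sqr real_normK ?num_real// lerDl sqr_ge0.
Qed.

Lemma le_Im_cmod z : `|complex.Im z| <= cmod z.
Proof.
rewrite -(ler_pXn2r (ltn0Sn 1)) ?nnegrE ?cmod_ge0//.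
by rewrite cmod_sqr real_normK ?num_real// lerDr sqr_ge0.
Qed.

Lemma le_cmod_ReIm z : cmod z <= `|complex.Re z| + `|complex.Im z|.
Proof.
rewrite -(ler_pXn2r (ltn0Sn 1)) ?nnegrE ?cmod_ge0//.
rewrite cmod_sqr sqrrD !real_normK ?num_real// lerD2r lerDl mulrn_wge0//.
Qed.

Lemma creD z w : complex.Re (z + w) = complex.Re z + complex.Re w.
Proof. by case: z w => [a b] [c d]. Qed.

Lemma cimD z w : complex.Im (z + w) = complex.Im z + complex.Im w.
Proof. by case: z w => [a b] [c d]. Qed.

Lemma creB z w : complex.Re (z - w) = complex.Re z - complex.Re w.
Proof. by case: z w => [a b] [c d]. Qed.

Lemma cimB z w : complex.Im (z - w) = complex.Im z - complex.Im w.
Proof. by case: z w => [a b] [c d]. Qed.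

Lemma creM z w : complex.Re (z * w) =
  complex.Re z * complex.Re w - complex.Im z * complex.Im w.
Proof. by case: z w => [a b] [c d]. Qed.

Lemma cimM z w : complex.Im (z * w) =
  complex.Re z * complex.Im w + complex.Im z * complex.Re w.
Proof. by case: z w => [a b] [c d]. Qed.

Lemma nbhs_cmodP z (P : set K) :
  nbhs z P <-> exists2 d : R, 0 < d & forall w, cmod (w - z) < d -> P w.
Proof.
split=> [/nbhs_ballP[e/= e0 he]|[d d0 hd]].
  exists (complex.Re e); first by move: e0; rewrite ltcE/= => /andP[].
  move=> w hw; apply: he; rewrite -ball_normE/=.
  have er : e = ((complex.Re e)%:C)%C by rewrite RRe_real// gtr0_real.
  by rewrite distrC cmodE er ltcR.
apply/nbhs_ballP; exists (d%:C)%C; first by rewrite /= ltcR.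
by move=> w; rewrite -ball_normE/= distrC cmodE ltcR; exact: hd.
Qed.

Lemma continuous_cmodP (T : topologicalType) (h : T -> K) t :
  {for t, continuous h} <->
  forall e, 0 < e -> \forall t' \near t, cmod (h t' - h t) < e.
Proof.
split=> [ch e e0|H].
  by apply: (ch (fun w => cmod (w - h t) < e)); apply/nbhs_cmodP; exists e.
move=> P /nbhs_cmodP[d d0 hd].
by apply: filterS (H _ d0) => t' /hd.
Qed.

Lemma continuous_Re z : {for z, continuous (@complex.Re R : K -> R)}.
Proof.
move=> P /nbhs_ballP[e/= e0 he]; apply/nbhs_cmodP; exists e => // w hw.
apply: he; rewrite -ball_normE/= distrC -creB.
exact: le_lt_trans (le_Re_cmod _) hw.
Qed.

Lemma continuous_Im z : {for z, continuous (@complex.Im R : K -> R)}.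
Proof.
move=> P /nbhs_ballP[e/= e0 he]; apply/nbhs_cmodP; exists e => // w hw.
apply: he; rewrite -ball_normE/= distrC -cimB.
exact: le_lt_trans (le_Im_cmod _) hw.
Qed.

(** The first-order expansion is the form of differentiability that Goursat's
    argument and differentiation under the contour integral consume. *)
Lemma derivable_cmodP (h : K -> K) z :
  derivable h z 1 <->
  exists l, forall e, 0 < e -> exists2 d, 0 < d &
    forall w, cmod (w - z) < d ->
      cmod (h w - h z - l * (w - z)) <= e * cmod (w - z).
Proof.
split=> [hz|[l hl]].
  exists ('D_1 h z) => e e0.
  have /cvgrPdist_lt := hz.
  have e0' : (0 : K) < (e%:C)%C by rewrite ltcR.
  move=> /(_ _ e0'); rewrite near_withinE => /nbhs_cmodP[d d0 hd].
  exists d => // w hw.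
  have [->|wz] := eqVneq w z; first by rewrite !subrr mulr0 subrr cmod0 mulr0.
  have wz0 : w - z != 0 by rewrite subr_eq0.
  have := hd (w - z); rewrite subr0 => /(_ hw wz0).
  rewrite /GRing.scale/= mulr1 subrK cmodE ltcR => /ltW.
  rewrite -(ler_pM2r (x := cmod (w - z))) ?cmod_gt0// -cmodM -cmodN.
  apply: le_trans; rewrite le_eqVlt; apply/orP; left; apply/eqP; congr cmod.
  by rewrite mulrBl opprB mulrAC mulVf ?subr_eq0// mul1r.
apply/cvg_ex; exists l; apply/cvgrPdist_lt => e e0.
have [er e0'] : e = ((complex.Re e)%:C)%C /\ 0 < complex.Re e.
  split; first by rewrite RRe_real// gtr0_real.
  by move: e0; rewrite ltcE => /andP[].
have [|d d0 hd] := hl (complex.Re e / 2); first by rewrite divr_gt0.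
rewrite near_withinE; apply/nbhs_cmodP; exists d => // t.
rewrite subr0 => td t0; rewrite er cmodE ltcR.
have := hd (t + z); rewrite addrK => /(_ td) hd'.
rewrite -(ltr_pM2r (x := cmod t)) ?cmod_gt0// -cmodM -cmodN.
rewrite /GRing.scale/= mulr1 mulrBl opprB mulrAC mulVf// mul1r.
apply: (le_lt_trans hd'); rewrite ltr_pM2r ?cmod_gt0//; lra.
Qed.

Lemma derivable_continuous (h : K -> K) z :
  derivable h z 1 -> {for z, continuous h}.
Proof. by move=> /derivable1_diffP/differentiable_continuous. Qed.

Lemma derivable_comp (g h : K -> K) z :
  derivable h z 1 -> derivable g (h z) 1 -> derivable (fun w => g (h w)) z 1.
Proof.
move=> /derivable1_diffP dh /derivable1_diffP dg; apply/derivable1_diffP.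
exact: (differentiable_comp dh dg).
Qed.

Lemma derivable_mul (f g : K -> K) z : derivable f z 1 -> derivable g z 1 ->
  derivable (fun w => f w * g w) z 1.
Proof. by move=> df dg; exact: (@derivableM _ _ f g z 1 df dg). Qed.

Lemma derivable_add (f g : K -> K) z : derivable f z 1 -> derivable g z 1 ->
  derivable (fun w => f w + g w) z 1.
Proof. by move=> df dg; exact: (@derivableD _ _ _ f g z 1 df dg). Qed.

Lemma derivable_sub (f g : K -> K) z : derivable f z 1 -> derivable g z 1 ->
  derivable (fun w => f w - g w) z 1.
Proof. by move=> df dg; exact: (@derivableB _ _ _ f g z 1 df dg). Qed.

Lemma derivable_inv (f : K -> K) z : f z != 0 -> derivable f z 1 ->
  derivable (fun w => (f w)^-1) z 1.
Proof. by move=> f0 df; exact: (@derivableV _ _ f z 1 f0 df). Qed.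

Lemma derivable_const (k z : K) : derivable (fun=> k) z 1.
Proof. exact: derivable_cst. Qed.

Lemma derivable_var (z : K) : derivable (fun w => w) z 1.
Proof. exact: derivable_id. Qed.

(** Schwarz reflection: conjugating on both sides turns the derivative [l] into [l^*].
    It makes the conjugate factors of polarized identities holomorphic. *)
Lemma derivable_reflect (h : K -> K) z :
  derivable h z^* 1 -> derivable (fun w => (h w^*)^*) z 1.
Proof.
move=> /derivable_cmodP[l hl]; apply/derivable_cmodP; exists l^* => e /hl.
move=> [d d0 hd]; exists d => // w wz; rewrite -cmod_conj.
rewrite !rmorphB rmorphM rmorphB /= !conjCK -(cmod_conj (w - z)) rmorphB.
by apply: hd; rewrite -cmod_conj rmorphB/= !conjCK.
Qed.

End Modulus.
Arguments derivable_const {R} k z.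
Arguments derivable_var {R} z.

(** * Integrals of complex functions over real segments *)

Section ComplexIntegral.
Variable R : realType.
Local Notation K := (Cplx R).
Local Notation mu := (@lebesgue_measure R).
Implicit Types (c : R -> K) (a b : R) (k : K).

Definition cint a b c : K :=
  Complex (\int[mu]_(x in `[a, b]) complex.Re (c x))
          (\int[mu]_(x in `[a, b]) complex.Im (c x)).

Definition continuous_on a b c :=
  forall x, a <= x <= b -> {for x, continuous c}.

Lemma integrable_Re a b c : continuous_on a b c ->
  mu.-integrable `[a, b] (EFin \o (fun x => complex.Re (c x))).
Proof.
move=> cc; apply: continuous_compact_integrable; first exact: segment_compact.
apply: continuous_in_subspaceT => x; rewrite inE/= in_itv/= => xab.
exact: (continuous_comp (cc x xab) (@continuous_Re R (c x))).
Qed.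

Lemma integrable_Im a b c : continuous_on a b c ->
  mu.-integrable `[a, b] (EFin \o (fun x => complex.Im (c x))).
Proof.
move=> cc; apply: continuous_compact_integrable; first exact: segment_compact.
apply: continuous_in_subspaceT => x; rewrite inE/= in_itv/= => xab.
exact: (continuous_comp (cc x xab) (@continuous_Im R (c x))).
Qed.

Lemma eq_cint a b c1 c2 : (forall x, a <= x <= b -> c1 x = c2 x) ->
  cint a b c1 = cint a b c2.
Proof.
move=> c12; congr Complex; apply: eq_Rintegral => x;
by rewrite inE/= in_itv/= => /c12 ->.
Qed.

Lemma cintD a b c1 c2 : continuous_on a b c1 -> continuous_on a b c2 ->
  cint a b (fun x => c1 x + c2 x) = cint a b c1 + cint a b c2.
Proof.
move=> h1 h2; congr Complex.
  under eq_Rintegral do rewrite creD.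
  by rewrite RintegralD//; exact: integrable_Re.
under eq_Rintegral do rewrite cimD.
by rewrite RintegralD//; exact: integrable_Im.
Qed.

Lemma cintZ a b k c : continuous_on a b c ->
  cint a b (fun x => k * c x) = k * cint a b c.
Proof.
move=> h.
have iR := integrable_Re h; have iI := integrable_Im h.
have mI : measurable (`[a, b]%classic : set (measurableTypeR R)) by [].
have iZ (f : R -> R) p : mu.-integrable `[a, b] (EFin \o f) ->
    mu.-integrable `[a, b] (EFin \o (fun x => p * f x)).
  move=> fi; rewrite (_ : EFin \o _ = (fun x => p%:E * (EFin \o f) x)%E).
    exact: integrableZl.
  by apply/funext => x; rewrite /= EFinM.
case: k => [p q]; congr Complex.
  under eq_Rintegral do rewrite creM/=.
  rewrite RintegralB// ?RintegralZl//; exact: iZ.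
under eq_Rintegral do rewrite cimM/=.
rewrite RintegralD// ?RintegralZl//; exact: iZ.
Qed.

Lemma cint_cst a b k : a <= b -> cint a b (fun=> k) = k * ((b - a)%:C)%C.
Proof.
move=> ab; case: k => p q; rewrite /cint !Rintegral_cst//= lebesgue_measure_itv/=.
rewrite lte_fin; case: ltP => [_|ba].
  by congr Complex; rewrite /=; ring.
have -> : b = a by apply/eqP; rewrite eq_le ab ba.
by congr Complex; rewrite /= !subrr; ring.
Qed.

Lemma cint_cat a b m c : a <= m -> m <= b -> continuous_on a b c ->
  cint a b c = cint a m c + cint m b c.
Proof.
move=> am mb h.
have split_int (f : R -> R) : mu.-integrable `[a, b] (EFin \o f) ->
    \int[mu]_(x in `[a, b]) f x =
    \int[mu]_(x in `[a, m]) f x + \int[mu]_(x in `[m, b]) f x.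
  move=> fi; have := @Rintegral_itvB R f (BLeft a) (BRight b) m fi.
  rewrite !bnd_simp => /(_ am mb); rewrite Rintegral_itv_obnd_cbnd => [<-|].
    by rewrite addrC subrK.
  apply: integrableS fi => //; apply: subset_itvr.
  by rewrite bnd_simp.
rewrite /cint !split_int; [by []|exact: integrable_Im|exact: integrable_Re].
Qed.

(** Real and imaginary parts are bounded separately, hence the factor 2. *)
Lemma cint_bound a b c M : a <= b -> continuous_on a b c ->
  (forall x, a <= x <= b -> cmod (c x) <= M) ->
  cmod (cint a b c) <= 2 * (M * (b - a)).
Proof.
move=> ab h cM.
have bound (f : R -> R) : mu.-integrable `[a, b] (EFin \o f) ->
    (forall x, a <= x <= b -> `|f x| <= M) ->
    `|\int[mu]_(x in `[a, b]) f x| <= M * (b - a).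
  move=> fi fM; apply: (le_trans (le_normr_Rintegral _ fi)) => //.
  have -> : M * (b - a) = \int[mu]_(x in `[a, b]) M.
    rewrite Rintegral_cst//= lebesgue_measure_itv/= lte_fin.
      case: ltP => [_ //|ba]; have -> : b = a by apply/eqP; rewrite eq_le ab ba.
    by rewrite subrr.
  apply: le_Rintegral => //.
  - exact: integrable_norm.
  - apply: continuous_compact_integrable; first exact: segment_compact.
    by apply: continuous_subspaceT => x; exact: cst_continuous.
have -> : 2 * (M * (b - a)) = M * (b - a) + M * (b - a) by ring.
apply: (le_trans (le_cmod_ReIm _)); apply: lerD.
  apply: bound; first exact: integrable_Re.
  by move=> x /cM; exact: le_trans (le_Re_cmod _).
apply: bound; first exact: integrable_Im.
by move=> x /cM; exact: le_trans (le_Im_cmod _).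
Qed.

(** Used to see that the winding integral [cauchy_cst] does not vanish. *)
Lemma Im_cint_ge a b c m : a <= b -> continuous_on a b c ->
  (forall x, a <= x <= b -> m <= complex.Im (c x)) ->
  m * (b - a) <= complex.Im (cint a b c).
Proof.
move=> ab h cm.
have -> : m * (b - a) = \int[mu]_(x in `[a, b]) m.
  rewrite Rintegral_cst//= lebesgue_measure_itv/= lte_fin.
    case: ltP => [_ //|ba]; have -> : b = a by apply/eqP; rewrite eq_le ab ba.
  by rewrite subrr.
apply: le_Rintegral => //.
- apply: continuous_compact_integrable; first exact: segment_compact.
  by apply: continuous_subspaceT => x; exact: cst_continuous.
- exact: integrable_Im.
Qed.

End ComplexIntegral.

(** * Contour integrals over rectangles *)

Section Rectangles.
Variable R : realType.
Local Notation K := (Cplx R).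
Implicit Types (f g : K -> K) (x y : R) (z w : K).

Definition rect x0 x1 y0 y1 : set K :=
  [set z | x0 <= complex.Re z <= x1 /\ y0 <= complex.Im z <= y1].

(** The boundary of a rectangle, as a set; it is where integrands have to be
    continuous. *)
Definition edge x0 x1 y0 y1 : set K :=
  [set z | rect x0 x1 y0 y1 z /\
    [\/ complex.Re z = x0, complex.Re z = x1,
        complex.Im z = y0 | complex.Im z = y1]].

(** The counterclockwise contour integral along the boundary of a rectangle. *)
Definition rect_int x0 x1 y0 y1 f : K :=
  cint x0 x1 (fun x => f (Complex x y0)) +
  'i * cint y0 y1 (fun y => f (Complex x1 y)) -
  cint x0 x1 (fun x => f (Complex x y1)) -
  'i * cint y0 y1 (fun y => f (Complex x0 y)).

Definition continuous_at_all (A : set K) f := forall z, A z -> {for z, continuous f}.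
Definition derivable_at_all (A : set K) f := forall z, A z -> derivable f z 1.

Lemma edge_rect x0 x1 y0 y1 : edge x0 x1 y0 y1 `<=` rect x0 x1 y0 y1.
Proof. by move=> z []. Qed.

Lemma continuous_hline y x : {for x, continuous (fun t : R => Complex t y : K)}.
Proof.
apply/continuous_cmodP => e e0; near=> t.
have -> : (Complex t y - Complex x y : K) = ((t - x)%:C)%C.
  by apply/eqP; rewrite eq_complex /= subrr !eqxx.
rewrite cmod_real distrC; near: t.
exact: (@cvgr_dist_lt _ _ _ _ _ id x cvg_id e e0).
Unshelve. all: by end_near. Qed.

Lemma continuous_vline x y : {for y, continuous (fun t : R => Complex x t : K)}.
Proof.
apply/continuous_cmodP => e e0; near=> t.
have -> : (Complex x t - Complex x y : K) = 'i * ((t - y)%:C)%C.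
  by apply/eqP; rewrite eq_complex -complexiE /=; apply/andP; split; apply/eqP; ring.
rewrite cmodM cmod_i mul1r cmod_real distrC; near: t.
exact: (@cvgr_dist_lt _ _ _ _ _ id y cvg_id e e0).
Unshelve. all: by end_near. Qed.

Lemma continuous_on_hline (A : set K) f y x0 x1 : continuous_at_all A f ->
  (forall x, x0 <= x <= x1 -> A (Complex x y)) ->
  continuous_on x0 x1 (fun x => f (Complex x y)).
Proof.
move=> cf hA x /hA/cf cx.
exact: (continuous_comp (@continuous_hline y x) cx).
Qed.

Lemma continuous_on_vline (A : set K) f x y0 y1 : continuous_at_all A f ->
  (forall y, y0 <= y <= y1 -> A (Complex x y)) ->
  continuous_on y0 y1 (fun y => f (Complex x y)).
Proof.
move=> cf hA y /hA/cf cy.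
exact: (continuous_comp (@continuous_vline x y) cy).
Qed.

Section Fixed.
Variables x0 x1 y0 y1 : R.
Hypotheses (x01 : x0 <= x1) (y01 : y0 <= y1).
Local Notation bd := (edge x0 x1 y0 y1).
Local Notation oint := (rect_int x0 x1 y0 y1).

Lemma edge_bottom x : x0 <= x <= x1 -> bd (Complex x y0).
Proof. by move=> hx; split; [split; rewrite //= lexx|constructor 3]. Qed.

Lemma edge_top x : x0 <= x <= x1 -> bd (Complex x y1).
Proof. by move=> hx; split; [split; rewrite //= lexx andbT|constructor 4]. Qed.

Lemma edge_left y : y0 <= y <= y1 -> bd (Complex x0 y).
Proof. by move=> hx; split; [split; rewrite //= lexx|constructor 1]. Qed.

Lemma edge_right y : y0 <= y <= y1 -> bd (Complex x1 y).
Proof. by move=> hx; split; [split; rewrite //= lexx andbT|constructor 2]. Qed.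

Lemma continuous_on_sides f : continuous_at_all bd f ->
  [/\ continuous_on x0 x1 (fun x => f (Complex x y0)),
      continuous_on x0 x1 (fun x => f (Complex x y1)),
      continuous_on y0 y1 (fun y => f (Complex x0 y)) &
      continuous_on y0 y1 (fun y => f (Complex x1 y))].
Proof.
move=> cf; split.
- exact: (continuous_on_hline cf edge_bottom).
- exact: (continuous_on_hline cf edge_top).
- exact: (continuous_on_vline cf edge_left).
- exact: (continuous_on_vline cf edge_right).
Qed.

Lemma eq_rect_int f g : {in bd, f =1 g} -> oint f = oint g.
Proof.
move=> fg; congr (_ + 'i * _ - _ - 'i * _); apply: eq_cint => t ht;
  apply: fg; rewrite inE.
- exact: edge_bottom.
- exact: edge_right.
- exact: edge_top.
- exact: edge_left.
Qed.

Lemma rect_intD f g : continuous_at_all bd f -> continuous_at_all bd g ->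
  oint (fun z => f z + g z) = oint f + oint g.
Proof.
move=> /continuous_on_sides[f1 f2 f3 f4] /continuous_on_sides[g1 g2 g3 g4].
by rewrite /rect_int !cintD//; ring.
Qed.

Lemma rect_intZ k f : continuous_at_all bd f ->
  oint (fun z => k * f z) = k * oint f.
Proof.
move=> /continuous_on_sides[f1 f2 f3 f4].
by rewrite /rect_int !cintZ//; ring.
Qed.

(** The last factor is half the perimeter; the other half and the factor 2 of
    [cint_bound] make up the 4. *)
Lemma rect_int_bound f M : continuous_at_all bd f ->
  (forall z, bd z -> cmod (f z) <= M) ->
  cmod (oint f) <= 4 * M * ((x1 - x0) + (y1 - y0)).
Proof.
move=> /continuous_on_sides[f1 f2 f3 f4] fM.
have b1 := cint_bound x01 f1 (fun x hx => fM _ (edge_bottom hx)).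
have b2 := cint_bound x01 f2 (fun x hx => fM _ (edge_top hx)).
have b3 := cint_bound y01 f3 (fun x hx => fM _ (edge_left hx)).
have b4 := cint_bound y01 f4 (fun x hx => fM _ (edge_right hx)).
rewrite /rect_int.
set u1 := cint _ _ _ in b1 *; set u2 := cint _ _ _ in b2 *.
set u3 := cint _ _ _ in b3 *; set u4 := cint _ _ _ in b4 *.
have h1 := le_cmodD (u1 + 'i * u4 - u2) (- ('i * u3)).
have h2 := le_cmodD (u1 + 'i * u4) (- u2).
have h3 := le_cmodD u1 ('i * u4).
rewrite !cmodN !cmodM !cmod_i !mul1r in h1 h2 h3.
lra.
Qed.

(** The integrals over opposite sides differ by the integral of a constant, and the
    two resulting contributions cancel. *)
Lemma rect_int_affine p l w : oint (fun z => p + l * (z - w)) = 0.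
Proof.

have cst c a b : continuous_on a b (fun=> c : K).
  by move=> x _; exact: cst_continuous.
have lin c : continuous_at_all bd (fun z => c + l * (z - w)).
  move=> z _; apply: derivable_continuous.
  by apply: derivableD => //; apply: derivableM => //; apply: derivableB.
have [f1 f2 f3 f4] := continuous_on_sides (lin p).
have hx : cint x0 x1 (fun x => p + l * (Complex x y0 - w)) =
    cint x0 x1 (fun x => p + l * (Complex x y1 - w)) -
    l * 'i * ((y1 - y0)%:C)%C * ((x1 - x0)%:C)%C.
  have := cintD f2 (cst (- (l * 'i * ((y1 - y0)%:C)%C)) x0 x1).
  rewrite (cint_cst _ x01) mulNr; apply: etrans; apply: eq_cint => x _.
  have -> : (Complex x y1 : K) = Complex x y0 + 'i * ((y1 - y0)%:C)%C.
    by apply/eqP; rewrite eq_complex -complexiE /=; apply/andP; split; apply/eqP; ring.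
  by ring.
have hy : cint y0 y1 (fun y => p + l * (Complex x1 y - w)) =
    cint y0 y1 (fun y => p + l * (Complex x0 y - w)) +
    l * ((x1 - x0)%:C)%C * ((y1 - y0)%:C)%C.
  have := cintD f3 (cst (l * ((x1 - x0)%:C)%C) y0 y1).
  rewrite (cint_cst _ y01); apply: etrans; apply: eq_cint => y _.
  have -> : (Complex x1 y : K) = Complex x0 y + ((x1 - x0)%:C)%C.
    by apply/eqP; rewrite eq_complex /=; apply/andP; split; apply/eqP; ring.
  by ring.
by rewrite /rect_int hx hy; ring.
Qed.
End Fixed.

Lemma rect_int_splitx x0 x1 x2 y0 y1 f : x0 <= x1 -> x1 <= x2 -> y0 <= y1 ->
  continuous_at_all (edge x0 x2 y0 y1) f ->
  rect_int x0 x2 y0 y1 f = rect_int x0 x1 y0 y1 f + rect_int x1 x2 y0 y1 f.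
Proof.
move=> x01 x12 y01 cf.
have [f1 f2 f3 f4] := continuous_on_sides (le_trans x01 x12) y01 cf.
rewrite /rect_int (cint_cat x01 x12 f1) (cint_cat x01 x12 f2); ring.
Qed.

Lemma rect_int_splity x0 x1 y0 y1 y2 f : x0 <= x1 -> y0 <= y1 -> y1 <= y2 ->
  continuous_at_all (edge x0 x1 y0 y2) f ->
  rect_int x0 x1 y0 y2 f = rect_int x0 x1 y0 y1 f + rect_int x0 x1 y1 y2 f.
Proof.
move=> x01 y01 y12 cf.
have [f1 f2 f3 f4] := continuous_on_sides x01 (le_trans y01 y12) cf.
rewrite /rect_int (cint_cat y01 y12 f3) (cint_cat y01 y12 f4); ring.
Qed.

End Rectangles.

(** * Goursat's theorem on rectangles *)

Section Cauchy.
Variable R : realType.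
Local Notation K := (Cplx R).
Implicit Types (f g : K -> K) (x y : R) (z w : K).

Lemma halving_lt (L d : R) : 0 < d -> exists n, L / 2 ^+ n < d.
Proof.
move=> d0; have [n hn] : exists n : nat, L / d < n%:R.
  by exists (Num.truncn (L / d)).+1; exact: truncnS_gt.
exists n; rewrite ltr_pdivrMr ?exprn_gt0// mulrC -ltr_pdivrMr//.
apply: (lt_le_trans hn); rewrite -natrX ler_nat.
exact: (ltnW (ltn_expl n (isT : (1 < 2)%N))).
Qed.

(** The left ends increase and the right ends decrease, so the supremum of the left
    ends lies in every interval. *)
Lemma nested_halving (u : nat -> R) (L : R) : 0 <= L ->
  (forall n, u n <= u n.+1 /\ u n.+1 + L / 2 ^+ n.+1 <= u n + L / 2 ^+ n) ->
  exists p, forall n, u n <= p <= u n + L / 2 ^+ n.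
Proof.
move=> L0 hu.
have inc m n : (m <= n)%N -> u m <= u n /\ u n + L / 2 ^+ n <= u m + L / 2 ^+ m.
  elim: n => [|n IH]; first by rewrite leqn0 => /eqP ->.
  rewrite leq_eqVlt => /predU1P[->//|]; rewrite ltnS => /IH[h1 h2].
  by have [h3 h4] := hu n; split; [exact: le_trans h3|exact: le_trans h2].
have pos n : 0 <= L / 2 ^+ n by rewrite divr_ge0// exprn_ge0.
have ub n : ubound (range u) (u n + L / 2 ^+ n).
  move=> _ [m _ <-]; have [mn|nm] := leqP m n.
    by have [h1 _] := inc _ _ mn; rewrite (le_trans h1)// lerDl.
  have [_ h2] := inc _ _ (ltnW nm); apply: le_trans h2.
  by rewrite lerDl.
exists (sup (range u)) => n; apply/andP; split.
  by apply: ub_le_sup; [exists (u 0%N + L / 2 ^+ 0); exact: ub|exists n].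
by apply: ge_sup; [exists (u 0%N), 0%N|exact: ub].
Qed.

(** The step of Goursat's bisection: the four quarters add up to the whole, so one
    of them carries at least a quarter of the integral. *)
Lemma rect_quarter x0 x1 y0 y1 (h v : R) f (M : R) :
  0 <= h -> 0 <= v -> x1 = x0 + h + h -> y1 = y0 + v + v ->
  derivable_at_all (rect x0 x1 y0 y1) f ->
  4 * M <= cmod (rect_int x0 x1 y0 y1 f) ->
  exists x y, [/\ x0 <= x, x + h <= x1, y0 <= y, y + v <= y1 &
    M <= cmod (rect_int x (x + h) y (y + v) f)].
Proof.
move=> h0 v0 -> -> df hM.
have bx1 : x0 <= x0 + h by rewrite lerDl.
have bx2 : x0 + h <= x0 + h + h by rewrite lerDl.
have by1 : y0 <= y0 + v by rewrite lerDl.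
have by2 : y0 + v <= y0 + v + v by rewrite lerDl.
have bx := le_trans bx1 bx2; have byy := le_trans by1 by2.
have cf (a b c d : R) : x0 <= a -> b <= x0 + h + h -> y0 <= c ->
    d <= y0 + v + v -> continuous_at_all (edge a b c d) f.
  move=> ha hb hc hd z [[/andP[h1 h2] /andP[h3 h4]] _].
  apply: derivable_continuous; apply: df.
  by split; apply/andP; split; apply: le_trans; eassumption.
have split4 : rect_int x0 (x0 + h + h) y0 (y0 + v + v) f =
    rect_int x0 (x0 + h) y0 (y0 + v) f +
    rect_int x0 (x0 + h) (y0 + v) (y0 + v + v) f +
    (rect_int (x0 + h) (x0 + h + h) y0 (y0 + v) f +
     rect_int (x0 + h) (x0 + h + h) (y0 + v) (y0 + v + v) f).
  rewrite (rect_int_splitx bx1 bx2 byy); last exact: cf.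
  rewrite (rect_int_splity bx1 by1 by2); last exact: cf.
  by rewrite (rect_int_splity bx2 by1 by2)//; exact: cf.
have [M1|M1] := leP M (cmod (rect_int x0 (x0 + h) y0 (y0 + v) f)).
  by exists x0, y0.
have [M2|M2] := leP M (cmod (rect_int (x0 + h) (x0 + h + h) y0 (y0 + v) f)).
  by exists (x0 + h), y0.
have [M3|M3] := leP M (cmod (rect_int x0 (x0 + h) (y0 + v) (y0 + v + v) f)).
  by exists x0, (y0 + v).
have [M4|M4] :=
  leP M (cmod (rect_int (x0 + h) (x0 + h + h) (y0 + v) (y0 + v + v) f)).
  by exists (x0 + h), (y0 + v).
exfalso; move: M1 M2 M3 M4 hM; rewrite split4.
move: (rect_int _ _ _ _ _) (rect_int _ _ _ _ _).
move: (rect_int _ _ _ _ _) (rect_int _ _ _ _ _) => u4 u3 u2 u1.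
have := le_cmodD (u1 + u3) (u2 + u4).
have := le_cmodD u1 u3; have := le_cmodD u2 u4.
clear; lra.
Qed.

(** Bisection produces rectangles shrinking to a point [p] whose integrals decrease
    at most like [4 ^- n].  Near [p] the function differs from an affine function,
    whose integral vanishes, by a small multiple of the diameter, and the perimeter is
    comparable to the diameter: the integral is at most [e] times [4 ^- n] for every
    [e > 0]. *)
Theorem goursat x0 x1 y0 y1 f : x0 <= x1 -> y0 <= y1 ->
  derivable_at_all (rect x0 x1 y0 y1) f -> rect_int x0 x1 y0 y1 f = 0.
Proof.
move=> x01 y01 df; apply/eqP; rewrite -cmod_eq0; apply/negPn/negP => E0.
have {E0} : 0 < cmod (rect_int x0 x1 y0 y1 f) by rewrite lt_def E0 cmod_ge0.
have [E0 eE0] : exists E, E = cmod (rect_int x0 x1 y0 y1 f) by eexists.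
rewrite -eE0 => E0p.
have [H eH] : exists H, H = x1 - x0 by eexists.
have [V eV] : exists V, V = y1 - y0 by eexists.
have H0 : 0 <= H by rewrite eH subr_ge0.
have V0 : 0 <= V by rewrite eV subr_ge0.
pose hn n : R := H / 2 ^+ n; pose vn n : R := V / 2 ^+ n.
have hnS n : hn n = hn n.+1 + hn n.+1.
  rewrite /hn exprS; field; exact: lt0r_neq0 (exprn_gt0 _ _).
have vnS n : vn n = vn n.+1 + vn n.+1.
  rewrite /vn exprS; field; exact: lt0r_neq0 (exprn_gt0 _ _).
have hn0 n : 0 <= hn n by rewrite divr_ge0// exprn_ge0.
have vn0 n : 0 <= vn n by rewrite divr_ge0// exprn_ge0.
pose Q n (p : R * R) := [/\ x0 <= p.1, p.1 + hn n <= x1, y0 <= p.2,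
  p.2 + vn n <= y1 &
  E0 / 4 ^+ n <= cmod (rect_int p.1 (p.1 + hn n) p.2 (p.2 + vn n) f)].
have /choice[g hg] : forall np : nat * (R * R), exists p' : R * R,
    Q np.1 np.2 -> [/\ Q np.1.+1 p', np.2.1 <= p'.1,
      p'.1 + hn np.1.+1 <= np.2.1 + hn np.1, np.2.2 <= p'.2 &
      p'.2 + vn np.1.+1 <= np.2.2 + vn np.1].
  move=> [n [a b]]; have [/=[/= q1 q2 q3 q4 q5]|nq] := pselect (Q n (a, b)); last first.
    by exists (0, 0).
  have := @rect_quarter a (a + hn n) b (b + vn n) (hn n.+1) (vn n.+1) f
    (E0 / 4 ^+ n.+1) (hn0 _) (vn0 _).
  rewrite {1}hnS {1}vnS !addrA => /(_ erefl erefl).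
  case.
  - move=> z [/andP[h1 h2] /andP[h3 h4]]; apply: df.
    move: h1 h2 h3 h4 q1 q2 q3 q4; clear => *.
    by split; apply/andP; split; lra.
  - apply: le_trans q5; rewrite exprS le_eqVlt; apply/orP; left; apply/eqP.
    by field; exact: lt0r_neq0 (exprn_gt0 _ _).
  move=> a' [b' [h1 h2 h3 h4 h5]]; exists (a', b') => _ /=.
  split => //; split => //=; move: h1 h2 h3 h4 q1 q2 q3 q4; clear; lra.
pose s := fix s n := if n is m.+1 then g (m, s m) else (x0, y0).
have sQ n : Q n (s n).
  elim: n => [|n IH]; last by have [] := hg (n, s n) IH.
  have e1 : x0 + hn 0%N = x1 by rewrite /hn eH expr0; field.
  have e2 : y0 + vn 0%N = y1 by rewrite /vn eV expr0; field.
  by split; rewrite /= ?e1 ?e2 ?expr0 ?divr1 ?eE0.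
have sS n := hg (n, s n) (sQ n).
have [|px hpx] := @nested_halving (fun n => (s n).1) H H0.
  by move=> n; have [] := sS n.
have [|py hpy] := @nested_halving (fun n => (s n).2) V V0.
  by move=> n; have [] := sS n.
have rp : rect x0 x1 y0 y1 (Complex px py).
  have [q1 q2 q3 q4 _] := sQ 0%N; have := hpx 0%N; have := hpy 0%N.
  rewrite -/(hn 0%N) -/(vn 0%N) => /andP[h1 h2] /andP[h3 h4].
  move: h1 h2 h3 h4 q1 q2 q3 q4; clear => *.
  by split; apply/andP; split; rewrite /=; lra.
have /derivable_cmodP[l hl] := df _ rp.
set L := H + V.
have L0 : 0 <= L by rewrite addr_ge0.
pose e := E0 / (8 * (L ^+ 2 + 1)).
have L21 : 0 < L ^+ 2 + 1 by rewrite ltr_wpDl// sqr_ge0.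
have e0 : 0 < e by rewrite divr_gt0// mulr_gt0.
have [d d0 hd] := hl _ e0.
have [n hn_d] := halving_lt L d0.
have [q1 q2 q3 q4 q5] := sQ n.
have eL : L / 2 ^+ n = hn n + vn n by rewrite /L mulrDl.
pose p : K := Complex px py.
set B := edge (s n).1 ((s n).1 + hn n) (s n).2 ((s n).2 + vn n).
have xs : (s n).1 <= (s n).1 + hn n by rewrite lerDl.
have ys : (s n).2 <= (s n).2 + vn n by rewrite lerDl.
have Bd z : B z -> cmod (z - p) <= L / 2 ^+ n.
  move=> [[/andP[h1 h2] /andP[h3 h4]] _].
  apply: (le_trans (le_cmod_ReIm _)); rewrite creB cimB /= eL.
  have := hpx n; have := hpy n; rewrite -/(hn n) -/(vn n) => /andP[h5 h6] /andP[h7 h8].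
  move: h1 h2 h3 h4 h5 h6 h7 h8; clear => *.
  by apply: lerD; rewrite ler_norml; lra.
have Bf : continuous_at_all B f.
  move=> z [[/andP[h1 h2] /andP[h3 h4]] _]; apply: derivable_continuous.
  apply: df; move: h1 h2 h3 h4 q1 q2 q3 q4; clear => *.
  by split; apply/andP; split; lra.
pose A z := - f p - l * (z - p).
have BA : continuous_at_all B A.
  move=> z _; apply: derivable_continuous.
  by apply: derivableB => //; apply: derivableM => //; apply: derivableB.
have A0 : rect_int (s n).1 ((s n).1 + hn n) (s n).2 ((s n).2 + vn n) A = 0.
  rewrite -[RHS](rect_int_affine xs ys (- f p) (- l) p).
  by apply: eq_rect_int => // z _; rewrite /A mulNr.
have BfA : continuous_at_all B (fun z => f z + A z).
  by move=> z Bz; apply: continuousD; [exact: Bf|exact: BA].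
have BM z : B z -> cmod (f z + A z) <= e * (L / 2 ^+ n).
  move=> Bz; rewrite /A addrA; have zp := Bd _ Bz.
  by apply: (le_trans (hd _ (le_lt_trans zp hn_d))); rewrite ler_pM2l.
have := rect_int_bound xs ys BfA BM.
have eI := rect_intD xs ys Bf BA; rewrite A0 addr0 in eI; rewrite eI leNgt => /negP; apply; apply: lt_le_trans q5.
have -> : 4 * (e * (L / 2 ^+ n)) * ((s n).1 + hn n - (s n).1 + ((s n).2 + vn n - (s n).2))
  = 4 * e * L ^+ 2 / 4 ^+ n.
  have -> : (s n).1 + hn n - (s n).1 + ((s n).2 + vn n - (s n).2) = L / 2 ^+ n.
    by rewrite eL; ring.
  have -> : (4 : R) ^+ n = 2 ^+ n * 2 ^+ n by rewrite -exprMn; congr (_ ^+ _); ring.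
  by field; exact: lt0r_neq0 (exprn_gt0 _ _).
rewrite ltr_pM2r ?invr_gt0 ?exprn_gt0//.
have -> : 4 * e * L ^+ 2 = E0 * (L ^+ 2 / (L ^+ 2 + 1)) / 2.
  by rewrite /e; field; exact: lt0r_neq0.
have : L ^+ 2 / (L ^+ 2 + 1) <= 1 by rewrite ler_pdivrMr// mul1r lerDl.
rewrite -(ler_pM2l E0p); move: E0p; clear; lra.
Qed.

End Cauchy.

(** * Cauchy's formula and Taylor expansion on the unit square *)

Section CauchyFormula.
Variable R : realType.
Local Notation K := (Cplx R).
Implicit Types (f g : K -> K) (x y : R) (z w a : K).

(** The part of the outer rectangle outside the inner one is cut into four
    rectangles on which Goursat's theorem applies. *)
Lemma rect_int_shrink (x0 x1 y0 y1 a0 a1 b0 b1 : R) f :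
  x0 <= a0 -> a0 <= a1 -> a1 <= x1 -> y0 <= b0 -> b0 <= b1 -> b1 <= y1 ->
  derivable_at_all [set z | rect x0 x1 y0 y1 z /\
    ~ (a0 < complex.Re z < a1 /\ b0 < complex.Im z < b1)] f ->
  rect_int x0 x1 y0 y1 f = rect_int a0 a1 b0 b1 f.
Proof.
move=> xa0 a01 ax1 yb0 b01 b1y df.
have y01 := le_trans yb0 (le_trans b01 b1y).
have cont (u0 u1 v0 v1 : R) : x0 <= u0 -> u1 <= x1 -> y0 <= v0 -> v1 <= y1 ->
    (u0 <= a0) || (a1 <= u0) -> (u1 <= a0) || (a1 <= u1) ->
    (v0 <= b0) || (b1 <= v0) -> (v1 <= b0) || (b1 <= v1) ->
    continuous_at_all (edge u0 u1 v0 v1) f.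
  move=> h1 h2 h3 h4 k1 k2 k3 k4 z [[/andP[z1 z2] /andP[z3 z4]] ez].
  apply: derivable_continuous; apply: df; split.
    by split; apply/andP; split; apply: le_trans; eassumption.
  move=> [/andP[q1 q2] /andP[q3 q4]].
  case: ez => e.
  - by move: k1; rewrite -e leNgt q1 leNgt q2.
  - by move: k2; rewrite -e leNgt q1 leNgt q2.
  - by move: k3; rewrite -e leNgt q3 leNgt q4.
  - by move: k4; rewrite -e leNgt q3 leNgt q4.
have zero (u0 u1 v0 v1 : R) : x0 <= u0 -> u0 <= u1 -> u1 <= x1 -> y0 <= v0 ->
    v0 <= v1 -> v1 <= y1 ->
    [\/ u1 <= a0, a1 <= u0, v1 <= b0 | b1 <= v0] ->
    rect_int u0 u1 v0 v1 f = 0.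
  move=> h1 u01 h2 h3 v01 h4 out; apply: goursat => //.
  move=> z [/andP[z1 z2] /andP[z3 z4]]; apply: df; split.
    by split; apply/andP; split; apply: le_trans; eassumption.
  move=> [/andP[q1 q2] /andP[q3 q4]]; case: out => o.
  - by move: (lt_le_trans q1 z2); rewrite ltNge o.
  - by move: (le_lt_trans z1 q2); rewrite ltNge o.
  - by move: (lt_le_trans q3 z4); rewrite ltNge o.
  - by move: (le_lt_trans z3 q4); rewrite ltNge o.
have c1 : continuous_at_all (edge x0 x1 y0 y1) f.
  by apply: cont; rewrite ?xa0 ?ax1 ?yb0 ?b1y ?orbT.
have c2 : continuous_at_all (edge a0 x1 y0 y1) f.
  by apply: cont; rewrite ?xa0 ?ax1 ?yb0 ?b1y ?lexx ?orbT.
have c3 : continuous_at_all (edge a0 a1 y0 y1) f.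
  by apply: cont; rewrite ?xa0 ?ax1 ?yb0 ?b1y ?lexx ?orbT.
have c4 : continuous_at_all (edge a0 a1 b0 y1) f.
  by apply: cont; rewrite ?xa0 ?ax1 ?yb0 ?b1y ?lexx ?orbT.
rewrite (rect_int_splitx xa0 (le_trans a01 ax1) y01 c1).
rewrite (rect_int_splitx a01 ax1 y01 c2).
rewrite (rect_int_splity a01 yb0 (le_trans b01 b1y) c3).
rewrite (rect_int_splity a01 b01 b1y c4).
rewrite (zero x0 a0 y0 y1)//; last 2 first.
- exact: le_trans ax1.
- by constructor 1.
rewrite (zero a1 x1 y0 y1)//; last 2 first.
- exact: le_trans a01.
- by constructor 2.
rewrite (zero a0 a1 y0 b0)//; last 2 first.
- exact: le_trans b1y.
- by constructor 3.
rewrite (zero a0 a1 b1 y1)//; last 2 first.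
- exact: le_trans b01.
- by constructor 4.
by rewrite !add0r !addr0.
Qed.

Local Notation S := (rect (-1) 1 (-1) 1).
Local Notation T := (edge (-1) 1 (-1) 1).
Local Notation J := (rect_int (-1) 1 (-1) 1).

Lemma leN11 : -1 <= 1 :> R. Proof. lra. Qed.

Lemma edge_cmod_ge r z : 0 <= r -> edge (- r) r (- r) r z -> r <= cmod z.
Proof.
move=> r0 [_ []] e.
- by apply: le_trans (le_Re_cmod z); rewrite e normrN ger0_norm.
- by apply: le_trans (le_Re_cmod z); rewrite e ger0_norm.
- by apply: le_trans (le_Im_cmod z); rewrite e normrN ger0_norm.
- by apply: le_trans (le_Im_cmod z); rewrite e ger0_norm.
Qed.

Lemma derivable_div f a z : derivable f z 1 -> z != a ->
  derivable (fun w => f w / (w - a)) z 1.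
Proof.
move=> df za.
have d1 := derivable_sub (derivable_var z) (derivable_const a z).
have za0 : z - a != 0 by rewrite subr_eq0.
exact: (derivable_mul df (@derivable_inv R (fun w => w - a) z za0 d1)).
Qed.

Lemma small_eq0 (r : R) : 0 <= r -> (forall e, 0 < e -> r <= e) -> r = 0.
Proof.
move=> r0 h; apply/eqP; rewrite eq_le r0 andbT.
by apply/ler_addgt0Pr => e e0; rewrite add0r; exact: h.
Qed.

(** The difference quotient is bounded near [a], so its integral over small squares
    around [a] tends to 0; shrinking the contour shows that it does not depend on the
    square. *)
Lemma cauchy_kernel f a : derivable_at_all S f -> cmod a < 1 ->
  J (fun z => (f z - f a) / (z - a)) = 0.
Proof.
move=> df a1.
have ra := le_lt_trans (le_Re_cmod a) a1.
have ia := le_lt_trans (le_Im_cmod a) a1.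
have Sa : S a.
  by split; rewrite -ler_norml ltW.
have /derivable_cmodP[l hl] := df _ Sa.
have [d d0 hd] := hl 1 ltr01.
pose k z := (f z - f a) / (z - a).
have kb z : cmod (z - a) < d -> cmod (k z) <= cmod l + 1.
  move=> za; have [->|zna] := eqVneq z a.
    by rewrite /k !subrr mul0r cmod0 addr_ge0// cmod_ge0.
  have z0 : 0 < cmod (z - a) by rewrite cmod_gt0 subr_eq0.
  rewrite /k cmodM cmodV ler_pdivrMr// mulrDl mul1r -cmodM.
  have := hd _ za; rewrite mul1r => h1.
  have -> : f z - f a = l * (z - a) + (f z - f a - l * (z - a)) by ring.
  by apply: (le_trans (le_cmodD _ _)); rewrite lerD2l.
have dk z : S z -> z != a -> derivable k z 1.
  move=> Sz za; apply: (@derivable_div (fun w => f w - f a)) => //.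
  exact: derivable_sub (df z Sz) (derivable_const _ _).
apply/eqP; rewrite -cmod_eq0; apply/eqP; apply: small_eq0; first exact: cmod_ge0.
move=> e e0; set m := cmod l + 1 in kb.
have m0 : 0 < m by rewrite ltr_wpDl ?cmod_ge0.
have [t [t0 t1 t2 t3]] : exists t, [/\ 0 < t, t + cmod a < 1, t + t < d &
    4 * m * ((t + t) + (t + t)) <= e].
  pose A := Num.min ((1 - cmod a) / 2) (Num.min (d / 4) (e / (16 * m))).
  have A0 : 0 < A.
    by rewrite !lt_min !divr_gt0 ?mulr_gt0// subr_gt0.
  have A1 : A <= (1 - cmod a) / 2 by rewrite !ge_min lexx.
  have A2 : A <= d / 4 by rewrite !ge_min lexx orbT.
  have A3 : A <= e / (16 * m) by rewrite !ge_min lexx !orbT.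
  exists A; split => //.
  - move: A1 a1; clear; lra.
  - move: A2 d0; clear; lra.
  - by move: A3; rewrite ler_pdivlMr ?mulr_gt0//; clear; lra.
have sh : J k = rect_int (complex.Re a - t) (complex.Re a + t)
    (complex.Im a - t) (complex.Im a + t) k.
  move: (le_Re_cmod a) (le_Im_cmod a); rewrite !ler_norml.
  move=> /andP[r1 r2] /andP[i1 i2].
  have bounds : [/\ -1 <= complex.Re a - t, complex.Re a - t <= complex.Re a + t,
    complex.Re a + t <= 1, -1 <= complex.Im a - t &
    complex.Im a - t <= complex.Im a + t /\ complex.Im a + t <= 1].
    by move: r1 r2 i1 i2 t0 t1; clear => *; split; [lra|lra|lra|lra|split; lra].
  have [w1 w2 w3 w4 [w5 w6]] := bounds.
  apply: rect_int_shrink => // z [Sz nz]; apply: dk => //; apply/eqP => za.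
  by apply: nz; rewrite za !gtrBl !ltrDl t0.
rewrite -/k sh; apply: le_trans t3.
have x01 : complex.Re a - t <= complex.Re a + t by move: t0; clear; lra.
have y01 : complex.Im a - t <= complex.Im a + t by move: t0; clear; lra.
pose B := edge (complex.Re a - t) (complex.Re a + t) (complex.Im a - t) (complex.Im a + t).
have za z : B z -> z != a.
  move=> [_ ez]; apply/eqP => za; move: ez t0; rewrite za; clear.
  by move=> [] *; lra.
have SB z : B z -> S z.
  move=> [[/andP[z1 z2] /andP[z3 z4]] _].
  move: (le_Re_cmod a) (le_Im_cmod a); rewrite !ler_norml.
  move=> /andP[r1 r2] /andP[i1 i2].
  move: r1 r2 i1 i2 z1 z2 z3 z4 t1; clear => *.
  by split; apply/andP; split; lra.
have cB : continuous_at_all B k.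
  by move=> z Bz; apply: derivable_continuous; apply: dk; [exact: SB|exact: za].
have bB z : B z -> cmod (k z) <= m.
  move=> [[/andP[z1 z2] /andP[z3 z4]] _]; apply: kb; apply: le_lt_trans t2.
  apply: (le_trans (le_cmod_ReIm _)); rewrite creB cimB.
  by apply: lerD; rewrite ler_norml; move: z1 z2 z3 z4; clear => *; lra.
apply: (le_trans (rect_int_bound x01 y01 cB bB)).
by rewrite ler_pM2l ?mulr_gt0//; clear; lra.
Qed.

(** The constant [2 i pi] of Cauchy's formula, kept in the form of an integral. *)
Definition cauchy_cst : K := J (fun z => z^-1).
Local Notation c := cauchy_cst.

(** Both integrals may be moved to a large square of half-side [r], where the two
    integrands differ by [O(r ^- 2)] while the perimeter is [O(r)]. *)
Lemma kernel_cst a : cmod a < 1 -> J (fun z => (z - a)^-1) = c.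
Proof.
move=> a1; apply/eqP; rewrite -subr_eq0 -cmod_eq0; apply/eqP.
apply: small_eq0 => [|e e0]; first exact: cmod_ge0.
have dinv b z : cmod b < cmod z -> derivable (fun w => (w - b)^-1) z 1.
  move=> bz; have zb0 : z - b != 0.
    by rewrite subr_eq0; apply/eqP => zb; rewrite zb ltxx in bz.
  have d1 := derivable_sub (derivable_var z) (derivable_const b z).
  exact: (@derivable_inv R (fun w => w - b) z zb0 d1).
have enl b r : 1 < r -> cmod b < 1 ->
    J (fun z => (z - b)^-1) = rect_int (- r) r (- r) r (fun z => (z - b)^-1).
  move=> r1 b1; symmetry.
  have bounds : [/\ - r <= -1, -1 <= 1 :> R & 1 <= r].
    by move: r1; clear => *; split; lra.
  have [w1 w2 w3] := bounds.
  apply: rect_int_shrink => // z [_ nz]; apply: dinv; apply: (lt_le_trans b1).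
  rewrite leNgt; apply/negP => z1; apply: nz.
  have := le_lt_trans (le_Re_cmod z) z1; have := le_lt_trans (le_Im_cmod z) z1.
  by rewrite !ltr_norml.
pose r := 2 + 16 / e.
have q0 : 0 < 16 / e by rewrite divr_gt0.
have r1 : 1 < r by rewrite /r; move: q0; clear; lra.
have r0 : 0 < r by apply: lt_trans r1.
have rr : - r <= r by move: r0; clear; lra.
have eJ : c = J (fun z => (z - 0)^-1) by apply: eq_rect_int => // z _; rewrite subr0.
rewrite eJ (enl a r)// (enl 0 r) ?cmod0//.
pose B := edge (- r) r (- r) r.
have cB b : cmod b < 1 -> continuous_at_all B (fun z => (z - b)^-1).
  move=> b1 z Bz; apply: derivable_continuous; apply: dinv.
  apply: (lt_le_trans (lt_trans b1 r1)); apply: edge_cmod_ge Bz; exact: ltW.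
have c01 : cmod (0 : K) < 1 by rewrite cmod0.
have cN : continuous_at_all B (fun z => -1 * (z - 0)^-1).
  move=> z Bz; apply: continuousM; [exact: cst_continuous|exact: cB].
have -> : rect_int (- r) r (- r) r (fun z => (z - a)^-1) -
    rect_int (- r) r (- r) r (fun z => (z - 0)^-1) =
    rect_int (- r) r (- r) r (fun z => (z - a)^-1 + -1 * (z - 0)^-1).
  by rewrite (rect_intD rr rr (cB a a1) cN) (rect_intZ rr rr _ (cB 0 c01)) mulN1r.
have cC : continuous_at_all B (fun z => (z - a)^-1 + -1 * (z - 0)^-1).
  move=> z Bz; apply: continuousD; [exact: cB|exact: cN].
have bC z : B z -> cmod ((z - a)^-1 + -1 * (z - 0)^-1) <= (r * (r - 1))^-1.
  move=> /(edge_cmod_ge (ltW r0)) rz.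
  have z0 : z != 0 by rewrite -cmod_gt0; exact: lt_le_trans rz.
  have za : r - 1 <= cmod (z - a).
    by apply: le_trans (le_cmodB z a); move: rz a1; clear; lra.
  have r10 : 0 < r - 1 by rewrite subr_gt0.
  have za0 : z - a != 0 by rewrite -cmod_gt0; exact: lt_le_trans za.
  have -> : (z - a)^-1 + -1 * (z - 0)^-1 = a / (z * (z - a)).
    by field; rewrite za0 z0.
  rewrite cmodM cmodV cmodM -[leRHS]mul1r; apply: ler_pM => //.
  - exact: cmod_ge0.
  - by rewrite invr_ge0 mulr_ge0// cmod_ge0.
  - exact: ltW.
  rewrite lef_pV2 ?posrE ?mulr_gt0//; first by apply: ler_pM => //; exact: ltW.
    exact: lt_le_trans rz.
  exact: lt_le_trans za.
apply: (le_trans (rect_int_bound rr rr cC bC)).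
have -> : 4 * (r * (r - 1))^-1 * (r - - r + (r - - r)) = 16 / (r - 1).
  have rn1 : r - 1 != 0 by rewrite subr_eq0 gt_eqF.
  have rn0 : r != 0 by rewrite gt_eqF.
  by field; rewrite ?rn1 ?rn0.
rewrite ler_pdivrMr ?subr_gt0// mulrC -ler_pdivrMr// /r; clear; lra.
Qed.

Lemma creV z : complex.Re z^-1 =
  complex.Re z / (complex.Re z ^+ 2 + complex.Im z ^+ 2).
Proof. by case: z. Qed.

Lemma cimV z : complex.Im z^-1 =
  - (complex.Im z / (complex.Re z ^+ 2 + complex.Im z ^+ 2)).
Proof. by case: z. Qed.

(** Each of the four sides turns counterclockwise around 0, and contributes at least 1
    to the imaginary part. *)
Lemma Im_cauchy_cst_gt0 : 0 < complex.Im c.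
Proof.
have cinv : continuous_at_all T (fun z => z^-1).
  move=> z Tz; apply: derivable_continuous.
  have z0 : z != 0.
    have T1 : 1 <= cmod z by exact: edge_cmod_ge Tz.
    by rewrite -cmod_gt0 (lt_le_trans ltr01).
  exact: (@derivable_inv R (fun w => w) z z0 (derivable_var z)).
have [f1 f2 f3 f4] := continuous_on_sides leN11 leN11 cinv.
have zcont (k : K) (f : R -> K) : continuous_on (-1) 1 f ->
    continuous_on (-1) 1 (fun x => k * f x).
  by move=> cf x hx; apply: continuousM; [exact: cst_continuous|exact: cf].
have half x : -1 <= x <= 1 -> 2^-1 <= (x ^+ 2 + 1)^-1.
  move=> /andP[x1 x2]; have p : 0 < x ^+ 2 + 1 by rewrite ltr_wpDl// sqr_ge0.
  rewrite lef_pV2 ?posrE//.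
  by move: x1 x2; clear; nra.
have ge1 (f : R -> K) : continuous_on (-1) 1 f ->
    (forall x, -1 <= x <= 1 -> 2^-1 <= complex.Im (f x)) ->
    1 <= complex.Im (cint (-1) 1 f).
  move=> cf hf; apply: le_trans (Im_cint_ge leN11 cf hf).
  by clear; lra.
have e1 : 1 <= complex.Im (cint (-1) 1 (fun x => (Complex x (-1) : K)^-1)).
  apply: ge1 => // x hx; rewrite cimV /= sqrrN expr1n mulNr opprK mul1r.
  exact: half.
have e2 : 1 <= complex.Im ((-1) * cint (-1) 1 (fun x => (Complex x 1 : K)^-1)).
  rewrite -(cintZ (-1) f2); apply: ge1 => [|x hx]; first exact: zcont.
  rewrite mulN1r -[- _](mulN1r) cimM cimV /= oppr0 mul0r addr0 expr1n mul1r mulrNN mul1r.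
  exact: half.
have e3 : 1 <= complex.Im ('i * cint (-1) 1 (fun y => (Complex 1 y : K)^-1)).
  rewrite -(cintZ 'i f4); apply: ge1 => [|x hx]; first exact: zcont.
  rewrite cimM creV -complexiE /= mul0r add0r expr1n !mul1r addrC.
  exact: half.
have e4 : 1 <= complex.Im ((- 'i) * cint (-1) 1 (fun y => (Complex (-1) y : K)^-1)).
  rewrite -(cintZ (- 'i) f3); apply: ge1 => [|x hx]; first exact: zcont.
  rewrite cimM creV -complexiE /= oppr0 mul0r add0r sqrrN expr1n mulNr mul1r mulN1r opprK addrC.
  exact: half.
rewrite mulN1r in e2; rewrite mulNr in e4.
rewrite /cauchy_cst /rect_int !cimD.
move: e1 e2 e3 e4.
set u1 := complex.Im _; set u2 := complex.Im _; set u3 := complex.Im _.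
set u4 := complex.Im _; clear; lra.
Qed.

Lemma cauchy_cst_neq0 : c != 0.
Proof.
by apply/eqP => c0; have := Im_cauchy_cst_gt0; rewrite c0 ltxx.
Qed.

Lemma cauchy_formula f a : derivable_at_all S f -> cmod a < 1 ->
  J (fun z => f z / (z - a)) = c * f a.
Proof.
move=> df a1.
have za0 z : T z -> z - a != 0.
  move=> Tz; rewrite -cmod_gt0; apply: lt_le_trans (le_cmodB z a).
  by rewrite subr_gt0; apply: (lt_le_trans a1); exact: edge_cmod_ge Tz.
have dinv z : T z -> derivable (fun w => (w - a)^-1) z 1.
  move=> Tz; have d1 := derivable_sub (derivable_var z) (derivable_const a z).
  exact: (@derivable_inv R (fun w => w - a) z (za0 z Tz) d1).
have c1 : continuous_at_all T (fun z => f z / (z - a)).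
  move=> z Tz; apply: derivable_continuous.
  exact: (@derivable_mul R f _ z (df z (edge_rect Tz)) (dinv z Tz)).
have c2 : continuous_at_all T (fun z => (z - a)^-1).
  by move=> z Tz; apply: derivable_continuous; exact: dinv.
have c3 : continuous_at_all T (fun z => - f a * (z - a)^-1).
  move=> z Tz; apply: derivable_continuous.
  exact: (@derivable_mul R (fun=> - f a) _ z (derivable_const _ z) (dinv z Tz)).
have := cauchy_kernel df a1.
have -> : J (fun z => (f z - f a) / (z - a)) =
    J (fun z => f z / (z - a) + - f a * (z - a)^-1).
  by apply: eq_rect_int; rewrite ?leN11// => z _; rewrite mulrBl mulNr.
rewrite (rect_intD leN11 leN11 c1 c3) (rect_intZ leN11 leN11 _ c2) (kernel_cst a1) mulNr.
by move=> /eqP; rewrite subr_eq0 => /eqP ->; rewrite mulrC.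
Qed.

Definition taylor_coef f n : K := c^-1 * J (fun z => f z / z ^+ n.+1).

(** Expansion of the Cauchy kernel: [1 / (z - a)] is [1 / z + a / (z (z - a))], and
    the last term reproduces the kernel. *)
Lemma taylor_remainder f a n : derivable_at_all S f -> cmod a < 1 ->
  f a = \sum_(i < n) taylor_coef f i * a ^+ i +
        c^-1 * a ^+ n * J (fun z => f z / z ^+ n / (z - a)).
Proof.
move=> df a1.
have z0 z : T z -> z != 0.
  move=> Tz; rewrite -cmod_gt0; apply: (lt_le_trans ltr01).
  exact: edge_cmod_ge Tz.
have za0 z : T z -> z - a != 0.
  move=> Tz; rewrite -cmod_gt0; apply: lt_le_trans (le_cmodB z a).
  by rewrite subr_gt0; apply: (lt_le_trans a1); exact: edge_cmod_ge Tz.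
have dX m z : derivable (fun w : K => w ^+ m) z 1.
  by apply: exprn_derivable.
have dq m z : T z -> derivable (fun w => f w / w ^+ m) z 1.
  move=> Tz; have zm0 : z ^+ m != 0 by rewrite expf_neq0// z0.
  have dV := @derivable_inv R (fun w => w ^+ m) z zm0 (dX m z).
  exact: (@derivable_mul R f _ z (df z (edge_rect Tz)) dV).
have dqa m z : T z -> derivable (fun w => f w / w ^+ m / (w - a)) z 1.
  move=> Tz; have d1 := derivable_sub (derivable_var z) (derivable_const a z).
  have dV := @derivable_inv R (fun w => w - a) z (za0 z Tz) d1.
  exact: (@derivable_mul R (fun w => f w / w ^+ m) _ z (dq m z Tz) dV).
elim: n => [|n IH].
  rewrite big_ord0 add0r expr0 mulr1; have -> :
      J (fun z => f z / z ^+ 0 / (z - a)) = J (fun z => f z / (z - a)).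
    by apply: eq_rect_int; rewrite ?leN11// => z _; rewrite expr0 invr1 mulr1.
  by rewrite cauchy_formula// mulrA mulVf ?mul1r// cauchy_cst_neq0.
rewrite big_ord_recr /= [LHS]IH -addrA; congr (_ + _).
have -> : J (fun z => f z / z ^+ n / (z - a)) =
    J (fun z => f z / z ^+ n.+1 + a * (f z / z ^+ n.+1 / (z - a))).
  apply: eq_rect_int; rewrite ?leN11// => z; rewrite inE => Tz.
  have zn0 : z ^+ n != 0 by rewrite expf_neq0// z0.
  have h0 := z0 z Tz; have h1 := za0 z Tz.
  by rewrite exprS; field; rewrite h0 h1 zn0.
have c1 : continuous_at_all T (fun z => f z / z ^+ n.+1).
  by move=> z Tz; apply: derivable_continuous; exact: dq.
have c2 : continuous_at_all T (fun z => f z / z ^+ n.+1 / (z - a)).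
  by move=> z Tz; apply: derivable_continuous; exact: dqa.
have c3 : continuous_at_all T (fun z => a * (f z / z ^+ n.+1 / (z - a))).
  move=> z Tz; apply: derivable_continuous.
  exact: (@derivable_mul R (fun=> a) _ z (derivable_const a z) (dqa n.+1 z Tz)).
rewrite (rect_intD leN11 leN11 c1 c3) (rect_intZ leN11 leN11 _ c2) /taylor_coef exprS.
by ring.
Qed.

(** The remainder only involves the values on the boundary of the square; the
    constant does not depend on [f], which is what makes the estimate uniform in
    families of functions. *)
Lemma taylor_bound f a n (M : R) : derivable_at_all S f ->
  (forall z, T z -> cmod (f z) <= M) -> cmod a < 1 ->
  cmod (f a - \sum_(i < n) taylor_coef f i * a ^+ i) <=
    16 / cmod c * M * (cmod a ^+ n / (1 - cmod a)).
Proof.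
move=> df fM a1.
rewrite {1}(taylor_remainder n df a1) addrC addKr !cmodM cmodV cmodX.
have ca : 0 < 1 - cmod a by rewrite subr_gt0.
have T1 z : T z -> 1 <= cmod z by exact: edge_cmod_ge.
have za z : T z -> 1 - cmod a <= cmod (z - a).
  by move=> /T1 h; apply: le_trans (le_cmodB z a); rewrite lerD2r.
have cT : continuous_at_all T (fun z => f z / z ^+ n / (z - a)).
  move=> z Tz; apply: derivable_continuous.
  have zn0 : z ^+ n != 0.
    by rewrite expf_neq0// -cmod_gt0 (lt_le_trans ltr01 (T1 z Tz)).
  have za0 : z - a != 0 by rewrite -cmod_gt0 (lt_le_trans ca (za z Tz)).
  have dX : derivable (fun w : K => w ^+ n) z 1 by apply: exprn_derivable.
  have dV := @derivable_inv R (fun w => w ^+ n) z zn0 dX.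
  have d1 := derivable_sub (derivable_var z) (derivable_const a z).
  have dW := @derivable_inv R (fun w => w - a) z za0 d1.
  have dq := @derivable_mul R f _ z (df z (edge_rect Tz)) dV.
  exact: (@derivable_mul R (fun w => f w / w ^+ n) _ z dq dW).
have bT z : T z -> cmod (f z / z ^+ n / (z - a)) <= M / (1 - cmod a).
  move=> Tz; rewrite !cmodM !cmodV cmodX; apply: ler_pM.
  - by rewrite mulr_ge0 ?cmod_ge0// invr_ge0 exprn_ge0// cmod_ge0.
  - by rewrite invr_ge0 cmod_ge0.
  - rewrite -[leRHS]mulr1; apply: ler_pM; rewrite ?cmod_ge0//.
    + by rewrite invr_ge0 exprn_ge0// cmod_ge0.
    + exact: fM.
    + by rewrite invf_le1 ?exprn_gt0// ?exprn_ege1 ?(lt_le_trans ltr01)// ?T1.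
  by rewrite lef_pV2 ?posrE//; [exact: za|exact: lt_le_trans (za z Tz)].
have := rect_int_bound leN11 leN11 cT bT.
have cn : 0 <= (cmod c)^-1 * cmod a ^+ n.
  by rewrite mulr_ge0 ?exprn_ge0 ?invr_ge0 ?cmod_ge0.
move=> /(ler_wpM2l cn) /le_trans; apply.
rewrite le_eqVlt; apply/orP; left; apply/eqP.
have : cmod c != 0 by rewrite cmod_eq0 cauchy_cst_neq0.
have := lt0r_neq0 ca; move: (cmod a) (cmod c) => A C A0 C0.
by field; rewrite A0 C0.
Qed.

End CauchyFormula.

(** * Identity principle and second-order estimate *)

Section Consequences.
Variable R : realType.
Local Notation K := (Cplx R).
Implicit Types (f g : K -> K) (x y : R) (z w p a : K).
Local Notation S := (rect (-1 : R) 1 (-1) 1).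
Local Notation T := (edge (-1 : R) 1 (-1) 1).

Lemma compact_rect (x0 x1 y0 y1 : R) : compact (rect x0 x1 y0 y1).
Proof.
have -> : rect x0 x1 y0 y1 =
    (fun u : R * R => Complex u.1 u.2 : K) @` (`[x0, x1] `*` `[y0, y1]).
  apply/seteqP; split => [z [h1 h2]|_ [[x y] [/= h1 h2] <-]].
    exists (complex.Re z, complex.Im z); last by case: z {h1 h2}.
    by split; rewrite /= in_itv.
  by rewrite /= !in_itv/= in h1 h2; split.
apply: continuous_compact; last first.
  by apply: compact_setX; exact: segment_compact.
apply: continuous_subspaceT => -[x y].
apply/continuous_cmodP => e e0.
have e2 : 0 < e / 2 by rewrite divr_gt0.
near=> u; apply: (le_lt_trans (le_cmod_ReIm _)); rewrite creB cimB /=.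
have -> : e = e / 2 + e / 2 by field.
apply: ltrD; rewrite distrC; near: u.
- exact: (@cvgr_dist_lt _ _ _ _ _ (fun u : R * R => u.1) x cvg_fst _ e2).
- exact: (@cvgr_dist_lt _ _ _ _ _ (fun u : R * R => u.2) y cvg_snd _ e2).
Unshelve. all: by end_near. Qed.

Lemma compact_edge (x0 x1 y0 y1 : R) : x0 <= x1 -> y0 <= y1 ->
  compact (edge x0 x1 y0 y1).
Proof.
move=> x01 y01.
(* each side is a degenerate rectangle *)
have -> : edge x0 x1 y0 y1 = rect x0 x0 y0 y1 `|` rect x1 x1 y0 y1 `|`
    rect x0 x1 y0 y0 `|` rect x0 x1 y1 y1.
  apply/seteqP; split => z.
    move=> [[hx hy] []] e; rewrite /rect/=.
    - by left; left; left; rewrite e lexx.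
    - by left; left; right; rewrite e lexx.
    - by left; right; rewrite e lexx.
    - by right; rewrite e lexx.
  by move=> [[[]|]|] [/andP[h1 h2] /andP[h3 h4]];
    (split; [by split; apply/andP; split;
      first [assumption | apply: le_trans; eassumption]|]);
    [constructor 1|constructor 2|constructor 3|constructor 4];
    apply/eqP; rewrite eq_le ?h1 ?h2 ?h3 ?h4.
by do ! apply: compactU; exact: compact_rect.
Qed.

(** Stated for functions that are continuous at the points of [A] in the ambient
    plane, as integrands are only controlled near the contour. *)
Lemma compact_cmod_bounded (A : set K) f : compact A -> continuous_at_all A f ->
  exists2 M, 0 < M & forall z, A z -> cmod (f z) <= M.
Proof.
move=> /compact_near_coveringP cA cf.
have := cA R +oo (fun M z => cmod (f z) <= M) _.
case.
  move=> z /cf/continuous_cmodP/(_ 1 ltr01) hz.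
  exists ([set z' | cmod (f z' - f z) < 1], [set M | cmod (f z) + 1 <= M]).
    split => //=.
    by apply: nbhs_pinfty_ge; rewrite num_real.
  move=> [z' M] /= [h1 h2]; apply: le_trans h2.
  have h3 := le_cmodD (f z' - f z) (f z); rewrite subrK in h3.
  by apply: (le_trans h3); rewrite addrC lerD2l ltW.
move=> M [_ hM].
exists (Num.max 1 (M + 1)); first by rewrite lt_max ltr01.
by move=> z Az; apply: (hM (Num.max 1 (M + 1))) => //; rewrite lt_max ltrDl ltr01 orbT.
Qed.

Definition square p r : set K :=
  [set z | `|complex.Re (z - p)| <= r /\ `|complex.Im (z - p)| <= r].

Lemma rectS z : S z <-> `|complex.Re z| <= 1 /\ `|complex.Im z| <= 1.
Proof. by rewrite /rect/= !ler_norml. Qed.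

Lemma derivable_affine p k z : derivable (fun w => p + k * w) z 1.
Proof.
have h1 := @derivable_mul R (fun=> k) (fun w => w) z (derivable_const k z) (derivable_var z).
exact: (@derivable_add R (fun=> p) (fun w => k * w) z (derivable_const p z) h1).
Qed.

Lemma derivable_rescale p (r : R) f : 0 < r -> derivable_at_all (square p r) f ->
  derivable_at_all S (fun w => f (p + (r%:C)%C * w)).
Proof.
move=> r0 df z /rectS[z1 z2].
have := @derivable_comp R f (fun w => p + (r%:C)%C * w) z (@derivable_affine p (r%:C)%C z).
apply; apply: df; rewrite /square/= [p + _]addrC addrK creM cimM /= !mul0r subr0 addr0.
by rewrite !normrM (gtr0_norm r0) !ler_piMr// ltW.
Qed.

(** On the positive real axis, the first nonzero Taylor coefficient would be of the
    order of the next power of [x]; so all coefficients vanish, and the remainder tends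
    to 0 as the order grows. *)
Lemma identity_unit f (d : R) : derivable_at_all S f -> 0 < d ->
  (forall x, 0 < x < d -> f (x%:C)%C = 0) ->
  forall a, cmod a < 1 -> f a = 0.
Proof.
move=> df d0 f0.
have cf : continuous_at_all T f.
  by move=> z Tz; apply: derivable_continuous; apply: df; exact: edge_rect.
have [M M0 fM] := compact_cmod_bounded (compact_edge (@leN11 R) (@leN11 R)) cf.
pose C := 16 / cmod (cauchy_cst R) * M.
have C0 : 0 < C.
  by rewrite mulr_gt0// divr_gt0// cmod_gt0 cauchy_cst_neq0.
have TB n a : cmod a < 1 ->
    cmod (f a - \sum_(i < n) taylor_coef f i * a ^+ i) <=
    C * (cmod a ^+ n / (1 - cmod a)).
  by move=> a1; exact: taylor_bound.
have coef0 n : taylor_coef f n = 0.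
  elim/ltn_ind: n => n IH; apply/eqP; rewrite -cmod_eq0; apply/eqP.
  apply: small_eq0 => [|e e0]; first exact: cmod_ge0.
  pose x := Num.min (d / 2) (Num.min (2^-1) (e / (2 * C))).
  have C20 : 0 < 2 * C by rewrite mulr_gt0.
  have x0 : 0 < x by rewrite !lt_min invr_gt0 ltr0n !divr_gt0.
  have x1 : x <= d / 2 by rewrite !ge_min lexx.
  have x2 : x <= 2^-1 by rewrite !ge_min lexx orbT.
  have x3 : x * (2 * C) <= e.
    by rewrite -ler_pdivlMr// !ge_min lexx !orbT.
  have cx : cmod (x%:C)%C = x by rewrite cmod_real gtr0_norm.
  have := TB n.+1 (x%:C)%C; rewrite cx big_ord_recr /= big1; last first.
    by move=> i _; rewrite IH// mul0r.
  rewrite f0 ?x0/=; last by apply: (le_lt_trans x1); move: d0; clear; lra.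
  have x1' : x < 1 by apply: (le_lt_trans x2); clear; lra.
  rewrite !add0r cmodN cmodM cmodX cx exprS => /(_ x1').
  have xn : 0 < x ^+ n by rewrite exprn_gt0.
  have -> : C * (x * x ^+ n / (1 - x)) = C * (x / (1 - x)) * x ^+ n by ring.
  rewrite ler_pM2r// => /le_trans; apply; apply: le_trans x3.
  rewrite [leRHS]mulrC [leRHS]mulrAC [leRHS]mulrC ler_pM2l// mulrC ler_pM2r//.
  rewrite invf_ple ?posrE ?subr_gt0//.
  by move: x2; clear; lra.
move=> a a1; apply/eqP; rewrite -cmod_eq0; apply/eqP.
apply: small_eq0 => [|e e0]; first exact: cmod_ge0.
have ca : 0 < 1 - cmod a by rewrite subr_gt0.
have q0 : 0 < C / (1 - cmod a) by rewrite divr_gt0.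
have : (cmod a ^+ n : R) @[n --> \oo] --> (0 : R).
  by apply: cvg_expr; rewrite ger0_norm ?cmod_ge0.
move=> /cvgrPdist_lt/(_ (e / (C / (1 - cmod a))) (divr_gt0 e0 q0)) [n _ /(_ n (leqnn n))] /=.
rewrite sub0r normrN ger0_norm ?exprn_ge0 ?cmod_ge0// => hn.
have := TB n a a1; rewrite big1 => [|i _]; last by rewrite coef0 mul0r.
rewrite subr0 => /le_trans; apply.
have -> : C * (cmod a ^+ n / (1 - cmod a)) = cmod a ^+ n * (C / (1 - cmod a)) by ring.
by rewrite -ler_pdivlMr// ltW.
Qed.

Theorem identity_square f p (r d : R) : 0 < r -> derivable_at_all (square p r) f ->
  0 < d -> (forall x, 0 < x < d -> f (p + (x%:C)%C) = 0) ->
  forall z, cmod (z - p) < r -> f z = 0.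
Proof.
move=> r0 df d0 f0 z zp.
have rC : (r%:C)%C != 0 :> K by rewrite -cmod_gt0 cmod_real gtr0_norm.
have := @identity_unit _ (d / r) (derivable_rescale r0 df) (divr_gt0 d0 r0).
have ez : z = p + (r%:C)%C * ((z - p) / (r%:C)%C).
  by rewrite mulrC divfK// addrC subrK.
move=> /(_ _ ((z - p) / (r%:C)%C)); rewrite -ez; apply.
  move=> x /andP[x0 xd]; have -> : (r%:C)%C * (x%:C)%C = ((r * x)%:C)%C :> K.
    by rewrite rmorphM.
  by apply: f0; rewrite mulr_gt0//= mulrC -ltr_pdivlMr.
by rewrite cmodM cmodV cmod_real gtr0_norm// ltr_pdivrMr// mul1r.
Qed.

Corollary identity_entire f : (forall z, derivable f z 1) ->
  (forall x, f (x%:C)%C = 0) -> forall z, f z = 0.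
Proof.
move=> df f0 z.
have r0 : 0 < cmod z + 1 by rewrite ltr_wpDl ?cmod_ge0.
apply: (@identity_square f 0 (cmod z + 1) 1) => //.
- by move=> x _; rewrite add0r.
- by rewrite subr0 ltrDl.
Qed.

(** Twice the constant of [taylor_bound], as [1 / (1 - |a|) <= 2] for [|a| <= 1 / 2]. *)
Definition quad_cst : R := 32 / cmod (cauchy_cst R).

(** This is the form in which Cauchy's estimates are used: with a bound on [f] that is
    uniform in a parameter, the remainder is uniform too, and one may differentiate
    under the contour integral. *)
Theorem second_order_bound f p (r M : R) : 0 < r ->
  derivable_at_all (square p r) f ->
  (forall z, square p r z -> cmod (f z) <= M) ->
  exists l, forall z, cmod (z - p) <= r / 2 ->
    cmod (f z - f p - l * (z - p)) <= quad_cst * M * (cmod (z - p) / r) ^+ 2.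
Proof.
move=> r0 df fM; set g := fun w => f (p + (r%:C)%C * w).
have rC : (r%:C)%C != 0 :> K by rewrite -cmod_gt0 cmod_real gtr0_norm.
have dg := derivable_rescale r0 df.
have gM z : T z -> cmod (g z) <= M.
  move=> /edge_rect/rectS[z1 z2]; apply: fM.
  rewrite /square/= [p + _]addrC addrK creM cimM /= !mul0r subr0 addr0.
  by rewrite !normrM (gtr0_norm r0) !ler_piMr// ltW.
have M0 : 0 <= M.
  apply: le_trans (fM p _); first exact: cmod_ge0.
  by rewrite /square/= subrr /= normr0 ltW.
have g0 : g 0 = f p by rewrite /g mulr0 addr0.
have c01 : cmod (0 : K) < 1 by rewrite cmod0.
have e0 : taylor_coef g 0 = f p.
  have := @taylor_bound R g 0 1 M dg gM c01.
  rewrite cmod0 expr1 mul0r mulr0 big_ord_recr big_ord0 /= add0r expr0 mulr1 g0 => h.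
  apply/eqP; rewrite eq_sym -subr_eq0 -cmod_eq0 eq_le h; exact: cmod_ge0.
exists (taylor_coef g 1 / (r%:C)%C) => z zp.
set a := (z - p) / (r%:C)%C.
have ca : cmod a = cmod (z - p) / r.
  by rewrite /a cmodM cmodV cmod_real gtr0_norm.
have a2 : cmod a <= 2^-1 by rewrite ca ler_pdivrMr// mulrC.
have a1 : cmod a < 1 by apply: (le_lt_trans a2); clear; lra.
have := @taylor_bound R g a 2 M dg gM a1.
have -> : g a = f z.
  by rewrite /g /a; congr f; rewrite mulrC divfK// addrC subrK.
rewrite !big_ord_recr big_ord0 /= add0r expr0 mulr1 expr1 e0 -ca.
have -> : f z - (f p + taylor_coef g 1 * a) =
    f z - f p - taylor_coef g 1 / (r%:C)%C * (z - p).
  by rewrite /a; ring.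
move=> /le_trans; apply.
have -> : quad_cst * M * cmod a ^+ 2 =
    16 / cmod (cauchy_cst R) * M * (cmod a ^+ 2 * 2).
  by rewrite /quad_cst; ring.
apply: ler_wpM2l.
  by rewrite mulr_ge0// divr_ge0// cmod_ge0.
apply: ler_wpM2l; first by rewrite exprn_ge0// cmod_ge0.
rewrite invf_ple ?posrE ?subr_gt0//.
by move: a2; clear; lra.
Qed.

End Consequences.

(** * Holomorphic curves *)

Section Curves.
Variable R : realType.
Local Notation K := (Cplx R).
Local Notation V := ('rV[K]_4).
Implicit Types (z v : V) (s t : K).

(** Testing maps of several variables along holomorphic curves reduces everything
    below to functions of one variable. *)
Definition hol_curve (gam : K -> V) :=
  forall j s, derivable (fun s => gam s 0 j) s 1.

Lemma hol_curve_differentiable gam s : hol_curve gam -> differentiable gam s.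
Proof.
move=> hg.
have -> : gam = fun s => \sum_(j < 4) gam s 0 j *: (delta_mx 0 j : V).
  by apply/funext => s'; exact: row_sum_delta.
have -> : (fun s0 : K => \sum_(j < 4) gam s0 0 j *: (delta_mx 0 j : V)) =
    \sum_(j < 4) (fun s0 : K => gam s0 0 j *: (delta_mx 0 j : V)).
  by apply/funext => s'; rewrite fct_sumE.
apply: differentiable_sum => j.
apply: (@differentiableZl _ _ _ (fun s0 : K => gam s0 0 j)).
by apply/derivable1_diffP; exact: hg.
Qed.

Lemma hol_curve_continuous gam s : hol_curve gam -> {for s, continuous gam}.
Proof. by move=> /hol_curve_differentiable -/(_ s)/differentiable_continuous. Qed.

(** The chain rule, in the direction from several variables to one. *)
Lemma derivable_along_curve (f : V -> V) gam s j : hol_curve gam ->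
  differentiable f (gam s) -> derivable (fun s => f (gam s) 0 j) s 1.
Proof.
move=> /hol_curve_differentiable -/(_ s) dg df; apply/derivable1_diffP.
have dfg := differentiable_comp dg df.
exact: (@differentiable_comp _ _ _ _ (f \o gam) (fun M : V => M 0 j) s dfg
  (differentiable_coord (f (gam s)) 0 j)).
Qed.

Lemma hol_curve_line z v : hol_curve (fun s => z + s *: v).
Proof.
move=> j s; have -> : (fun s0 : K => (z + s0 *: v) 0 j) = (fun s0 => z 0 j + v 0 j * s0).
  by apply/funext => s0; rewrite !mxE mulrC.
exact: derivable_affine.
Qed.

End Curves.

(** * Hartogs extension *)

Lemma ltr_half2 (R : realType) (a b : R) : a < 2^-1 -> b < 2^-1 -> a + b <= 1.
Proof. lra. Qed.

Lemma ltr_quarter3 (R : realType) (x a b d : R) :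
  a <= x / 4 -> b < x / 4 -> d <= x / 4 -> 0 < x -> a + b + d < x.
Proof. lra. Qed.

Lemma ler_half (R : realType) (x : R) : 0 < x -> x / 2 <= x.
Proof. lra. Qed.

Section Hartogs.
Variable R : realType.
Local Notation K := (Cplx R).
Local Notation V := ('rV[K]_4).
Local Notation S := (rect (-1 : R) 1 (-1) 1).
Local Notation T := (edge (-1 : R) 1 (-1) 1).
Local Notation J := (rect_int (-1) 1 (-1) 1).
Local Notation c := (cauchy_cst R).
Variables (delta : V -> R) (e : V) (f : V -> K).
Implicit Types (z v : V) (s t : K) (gam : K -> V).
Local Notation D := [set z | 0 < delta z].
Hypothesis delta_continuous : continuous delta.
Hypothesis delta_e : forall z s, delta (z + s *: e) = delta z + complex.Re s.
Hypothesis f_continuous : forall z, D z -> {for z, continuous f}.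
Hypothesis f_curve : forall gam s, hol_curve gam -> D (gam s) ->
  derivable (fun s => f (gam s)) s 1.

(** The contour in the direction [v] around [z] stays in the domain. *)
Definition admissible v z := forall t, T t -> D (z + t *: v).

(** Cauchy's integral for the value at the centre of the disc [t |-> z + t v]; it only
    involves the values of [f] on the contour, so it is meaningful when the disc itself
    leaves the domain. *)
Definition cauchy_ext v z : K := c^-1 * J (fun t => f (z + t *: v) / t).

Lemma edge_neq0 t : T t -> t != 0.
Proof.
move=> Tt; rewrite -cmod_gt0; apply: (lt_le_trans ltr01).
exact: edge_cmod_ge Tt.
Qed.

Lemma continuous_translate v gam t0 s0 : hol_curve gam ->
  {for (t0, s0), continuous (fun u : K * K => gam u.2 + u.1 *: v)}.
Proof.
move=> hg; apply: continuousD.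
  apply: (@continuous_comp _ _ _ (fun u : K * K => u.2) gam); first exact: cvg_snd.
  exact: hol_curve_continuous.
apply: (@continuous_comp _ _ _ (fun u : K * K => u.1) (fun t => t *: v)).
  exact: cvg_fst.
exact: scalel_continuous.
Qed.

Lemma near_admissible v gam s0 : hol_curve gam -> admissible v (gam s0) ->
  \forall s \near s0, admissible v (gam s).
Proof.
move=> hg adm.
have /compact_near_coveringP cT := compact_edge (@leN11 R) (@leN11 R).
apply: (cT K (nbhs s0) (fun s t => D (gam s + t *: v))) => t0 Tt0.
have cc := continuous_comp (@continuous_translate v gam t0 s0 hg)
  (@delta_continuous _).
have := cc [set x | 0 < x]; apply.
by apply: open_nbhs_nbhs; split; [exact: open_gt|exact: adm].
Qed.

(** The contour is compact, so continuity of [f] on it gives one radius that works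
    for all its points, and even for the points close to it. *)
Lemma near_uniform v gam s0 : hol_curve gam -> admissible v (gam s0) ->
  exists2 r : R, 0 < r & forall t, T t -> \forall t' \near t,
    forall s, square s0 r s -> D (gam s + t' *: v) /\
      cmod (f (gam s + t' *: v) - f (gam s0 + t' *: v)) <= 1.
Proof.
move=> hg adm.
have /compact_near_coveringP cT := compact_edge (@leN11 R) (@leN11 R).
pose P (r : R) (t : K) := \forall t' \near t,
  forall s, square s0 r s -> D (gam s + t' *: v) /\
    cmod (f (gam s + t' *: v) - f (gam s0 + t' *: v)) <= 1.
have HP : \forall r \near 0^'+, T `<=` P r.
  apply: cT => t0 Tt0.
  have ct : {for (t0, s0), continuous (fun u : K * K => gam u.2 + u.1 *: v)}.
    exact: continuous_translate.
  have cd := continuous_comp ct (@delta_continuous _).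
  have cf := continuous_comp ct (f_continuous (adm _ Tt0)).
  have Dn : \forall u \near (t0, s0), D (gam u.2 + u.1 *: v).
    have := cd [set x | 0 < x]; apply.
    by apply: open_nbhs_nbhs; split; [exact: open_gt|exact: adm].
  have h2 : 0 < 2^-1 :> R by rewrite invr_gt0.
  have fn : \forall u \near (t0, s0),
      cmod (f (gam u.2 + u.1 *: v) - f (gam s0 + t0 *: v)) < 2^-1.
    by have /continuous_cmodP/(_ _ h2) := cf.
  have [[A B] [/= nA nB] AB] := filterI Dn fn.
  have [d d0 dB] := (nbhs_cmodP s0 B).1 nB.
  exists (interior A, [set r | r < d / 2]).
    split => /=; first exact: (@nbhs_interior (Cplx R : topologicalType) t0 A nA).
    by apply: nbhs_right_lt; rewrite divr_gt0.
  move=> [t r] [/= At rd]; apply: filterS At => t' At' s [s1 s2].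
  have Bs : B s.
    apply: dB; apply: (le_lt_trans (le_cmod_ReIm _)).
    rewrite [d]splitr; apply: ltrD; exact: le_lt_trans rd.
  have Bs0 : B s0 by apply: dB; rewrite subrr cmod0.
  have [Ds fs] := AB (t', s) (conj At' Bs).
  have [_ fs0] := AB (t', s0) (conj At' Bs0).
  split=> //; move: fs fs0 => /=.
  set x := f (gam s + _); set y := f (gam s0 + t' *: v); set w := f _ => h1 h3.
  have -> : x - y = (x - w) - (y - w) by ring.
  apply: (le_trans (le_cmodD _ _)); rewrite cmodN.
  exact: ltr_half2.
have [r [r0 hr]] := filter_ex (filterI (nbhs_right_gt (0 : R)) HP).
by exists r.
Qed.

(** Differentiation under the contour integral.  For [t] on the contour,
    [s |-> f (gam s + t v)] has an expansion of order 2 at [s0] with a remainder uniform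
    in [t]; its linear coefficient [l t] is a uniform limit of difference quotients, so it
    is continuous and may be integrated. *)
Theorem cauchy_ext_derivable v gam s0 : hol_curve gam ->
  admissible v (gam s0) -> derivable (fun s => cauchy_ext v (gam s)) s0 1.
Proof.
move=> hg adm.
have [r r0 hU] := near_uniform hg adm.
pose k s t := f (gam s + t *: v).
pose U := [set t | forall s, square s0 r s ->
  D (gam s + t *: v) /\ cmod (k s t - k s0 t) <= 1].
have TU t : T t -> U t by move=> /hU/nbhs_singleton.
have sq0 : square s0 r s0 by rewrite /square/= subrr /= normr0 ltW.
have dk t s : U t -> square s0 r s -> derivable (fun s => k s t) s 1.
  move=> Ut /Ut[Ds _].
  have hgt : hol_curve (fun s => gam s + t *: v).
    move=> j s'; have -> : (fun s => (gam s + t *: v) 0 j) =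
        (fun s => gam s 0 j + (t *: v) 0 j) by apply/funext => s''; rewrite !mxE.
    exact: (@derivable_add R (fun s => gam s 0 j) (fun=> (t *: v) 0 j) s'
      (hg j s') (derivable_const _ s')).
  exact: (f_curve hgt Ds).
pose Q := quad_cst R.
have Q0 : 0 <= Q by rewrite divr_ge0 ?cmod_ge0.
have /choice[l hl] : forall t, exists l, U t -> forall s, cmod (s - s0) <= r / 2 ->
    cmod (k s t - k s0 t - l * (s - s0)) <= Q * (cmod (s - s0) / r) ^+ 2.
  move=> t; have [Ut|nUt] := pselect (U t); last by exists 0.
  have dh : derivable_at_all (square s0 r) (fun s => k s t - k s0 t).
    move=> s sqs; exact: (@derivable_sub R (fun s => k s t) (fun=> k s0 t) s
      (dk t s Ut sqs) (derivable_const _ s)).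
  have [l hl] := second_order_bound r0 dh (fun s sqs => (Ut s sqs).2).
  exists l => _ s hs; have := hl s hs; rewrite mulr1.
  by have -> : k s t - k s0 t - (k s0 t - k s0 t) - l * (s - s0) =
    k s t - k s0 t - l * (s - s0) by ring.
have kc s t : T t -> square s0 r s -> {for t, continuous (k s)}.
  move=> Tt sqs; have [Ds _] := TU _ Tt s sqs.
  apply: (@continuous_comp _ _ _ (fun t => gam s + t *: v) f).
    apply: continuousD; first exact: cst_continuous.
    exact: scalel_continuous.
  exact: f_continuous.
have rsq s : cmod (s - s0) <= r / 2 -> square s0 r s.
  move=> h; have r2 := ler_half r0.
  by split; apply: le_trans r2; apply: le_trans h; [exact: le_Re_cmod|exact: le_Im_cmod].
have lc : continuous_at_all T l.
  move=> t Tt; apply/continuous_cmodP => e' e0.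
  (* the difference quotient at distance [h] is within [Q * h / r ^+ 2] of [l] *)
  have [h [h0 hr hQ]] : exists h : R, [/\ 0 < h, h <= r / 2 & Q * h / r ^+ 2 <= e' / 4].
    pose A := Num.min (r / 2) (e' / 4 * r ^+ 2 / (Q + 1)).
    have Q1 : 0 < Q + 1 by rewrite ltr_wpDl.
    have A0 : 0 < A.
      by rewrite lt_min divr_gt0//= divr_gt0// mulr_gt0 ?divr_gt0// exprn_gt0.
    exists A; split=> //; first by rewrite ge_min lexx.
    rewrite ler_pdivrMr ?exprn_gt0//.
    have A2 : A * (Q + 1) <= e' / 4 * r ^+ 2.
      by rewrite -ler_pdivlMr// ge_min lexx orbT.
    by apply: le_trans A2; rewrite mulrC ler_pM2l// lerDl.
  pose s1 := s0 + (h%:C)%C.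
  have es1 : s1 - s0 = (h%:C)%C by rewrite /s1 addrC addKr.
  have hC : (h%:C)%C != 0 :> K by rewrite -cmod_gt0 cmod_real gtr0_norm.
  have cs1 : cmod (s1 - s0) = h by rewrite es1 cmod_real gtr0_norm.
  have dl t' : U t' -> cmod ((k s1 t' - k s0 t') / (h%:C)%C - l t') <= e' / 4.
    move=> Ut'; apply: le_trans hQ.
    have ch : cmod ((h%:C)%C : K) = h by rewrite -es1.
    rewrite -(ler_pM2r h0) -[X in _ * X <= _]ch -cmodM mulrBl divfK//.
    have := hl t' Ut' s1; rewrite cs1 es1 => /(_ hr) /le_trans; apply.
    rewrite le_eqVlt; apply/orP; left; apply/eqP; field.
    exact: lt0r_neq0.
  have qc : {for t, continuous (fun t' => (k s1 t' - k s0 t') / (h%:C)%C)}.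
    apply: continuousM; last exact: cst_continuous.
    apply: continuousB; [apply: kc => //; apply: rsq; rewrite cs1//|exact: kc].
  have e4 : 0 < e' / 4 by rewrite divr_gt0.
  have /continuous_cmodP/(_ _ e4) qn := qc.
  have Un : \forall t' \near t, U t' by exact: hU.
  near=> t'.
  have Ut' : U t' by near: t'.
  have q1 : cmod ((k s1 t' - k s0 t') / (h%:C)%C - (k s1 t - k s0 t) / (h%:C)%C)
      < e' / 4 by near: t'.
  have q2 := dl t' Ut'; have q3 := dl t (TU _ Tt).
  move: q1 q2 q3; set a := _ / _; set b := _ / _ => q1 q2 q3.
  have -> : l t' - l t = - (a - l t') + (a - b) + (b - l t) by ring.
  apply: (le_lt_trans (le_cmodD _ _)).
  apply: (le_lt_trans (lerD (le_cmodD _ _) (lexx _))); rewrite cmodN.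
  exact: (ltr_quarter3 q2 q1 q3).
have div_cont (g : K -> K) : continuous_at_all T g ->
    continuous_at_all T (fun t => g t / t).
  move=> cg t Tt; apply: continuousM; first exact: cg.
  have dV := @derivable_inv R (fun w => w) t (edge_neq0 Tt) (derivable_var t).
  exact: (derivable_continuous dV).
have kC s : square s0 r s -> continuous_at_all T (k s).
  by move=> sqs t Tt; exact: kc.
set L := c^-1 * J (fun t => l t / t).
set m := 16 / cmod c * (Q / r ^+ 2).
have m0 : 0 <= m.
  by rewrite mulr_ge0// ?divr_ge0 ?cmod_ge0 ?exprn_ge0// ltW.
have bound s : cmod (s - s0) <= r / 2 ->
    cmod (cauchy_ext v (gam s) - cauchy_ext v (gam s0) - L * (s - s0)) <=
    m * cmod (s - s0) ^+ 2.
  move=> hs; have sqs := rsq _ hs.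
  have c1 := div_cont _ (kC s sqs); have c2 := div_cont _ (kC s0 sq0).
  have c3 := div_cont _ lc.
  have c2' : continuous_at_all T (fun t => -1 * (k s0 t / t)).
    by move=> t Tt; apply: continuousM; [exact: cst_continuous|exact: c2].
  have c3' : continuous_at_all T (fun t => (- (s - s0)) * (l t / t)).
    by move=> t Tt; apply: continuousM; [exact: cst_continuous|exact: c3].
  have c12 : continuous_at_all T (fun t => k s t / t + -1 * (k s0 t / t)).
    by move=> t Tt; apply: continuousD; [exact: c1|exact: c2'].
  have c123 : continuous_at_all T (fun t => k s t / t + -1 * (k s0 t / t) +
      (- (s - s0)) * (l t / t)).
    by move=> t Tt; apply: continuousD; [exact: c12|exact: c3'].
  have eJ : cauchy_ext v (gam s) - cauchy_ext v (gam s0) - L * (s - s0) =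
      c^-1 * J (fun t => k s t / t + -1 * (k s0 t / t) + (- (s - s0)) * (l t / t)).
    rewrite (rect_intD (@leN11 R) (@leN11 R) c12 c3') (rect_intD (@leN11 R) (@leN11 R) c1 c2').
    rewrite (rect_intZ (@leN11 R) (@leN11 R) _ c2) (rect_intZ (@leN11 R) (@leN11 R) _ c3).
    have ek s' : cauchy_ext v (gam s') = c^-1 * J (fun t => k s' t / t) by [].
    rewrite !ek /L; move: (J _) (J _) (J _) c^-1 => j0 j1 j2 i.
    by ring.
  rewrite eJ cmodM cmodV.
  have bT t : T t -> cmod (k s t / t + -1 * (k s0 t / t) + (- (s - s0)) * (l t / t)) <=
      Q * (cmod (s - s0) / r) ^+ 2.
    move=> Tt; have -> : k s t / t + -1 * (k s0 t / t) + (- (s - s0)) * (l t / t) =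
      (k s t - k s0 t - l t * (s - s0)) / t by ring.
    rewrite cmodM cmodV -[leRHS]mulr1; apply: ler_pM; rewrite ?invr_ge0 ?cmod_ge0//.
      by apply: hl => //; exact: TU.
    have T1 : 1 <= cmod t by exact: edge_cmod_ge Tt.
    by rewrite invf_le1// (lt_le_trans ltr01).
  have cc : 0 <= (cmod c)^-1 by rewrite invr_ge0 cmod_ge0.
  have := rect_int_bound (@leN11 R) (@leN11 R) c123 bT.
  move=> /(ler_wpM2l cc)/le_trans; apply.
  rewrite le_eqVlt; apply/orP; left; apply/eqP; rewrite /m.
  by move: (cmod c) (cmod (s - s0)) => x y; rewrite expr_div_n; ring.
apply/derivable_cmodP; exists L => e' e0.
exists (Num.min (r / 2) (e' / (m + 1))).
  by rewrite lt_min !divr_gt0// ltr_wpDl.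
move=> s; rewrite lt_min => /andP[h1 h2].
apply: (le_trans (bound s (ltW h1))); rewrite expr2 mulrA ler_wpM2r ?cmod_ge0//.
have m1 : 0 < m + 1 by rewrite ltr_wpDl.
move: h2; rewrite ltr_pdivlMr// => /ltW; apply: le_trans.
by rewrite mulrC ler_wpM2l ?cmod_ge0// lerDl.
Unshelve. all: by end_near. Qed.

(** A disc with centre far to the right, large enough to contain 0, fits into the
    half-plane; the identity principle applies to it. *)
Lemma half_plane_identity (h : K -> K) (eps b : R) : 0 < eps ->
  (forall s, - eps < complex.Re s -> derivable h s 1) ->
  (forall s, b < complex.Re s -> h s = 0) -> h 0 = 0.
Proof.
move=> eps0 dh h0.
have [P P0 bP] : exists2 P, 0 < P & b < P.
  by exists (Num.max 1 (b + 1)); rewrite lt_max ?ltr01// ltrDl ltr01 orbT.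
have r0 : 0 < P + eps / 2 by rewrite addr_gt0// divr_gt0.
apply: (@identity_square R h (P%:C)%C (P + eps / 2) 1) => //.
- move=> s [s1 _]; apply: dh; move: s1; rewrite creB /= ler_norml => /andP[s1 _].
  apply: lt_le_trans (_ : - (eps / 2) <= _).
    by rewrite ltrN2 ltr_pdivrMr// ltr_pMr// ltr1n.
  by move: s1; rewrite lerBrDr opprD addrAC addNr add0r.
- move=> x /andP[x0 _]; apply: h0; rewrite creD /=.
  by rewrite (lt_trans bP)// ltrDl.
- by rewrite sub0r cmodN cmod_real gtr0_norm// ltrDl divr_gt0.
Qed.

Lemma cauchy_ext_disc v z : (forall t, S t -> D (z + t *: v)) ->
  cauchy_ext v z = f z.
Proof.
move=> hD; have dh : derivable_at_all S (fun t => f (z + t *: v)).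
  by move=> t St; exact: (@f_curve _ t (@hol_curve_line R z v) (hD t St)).
have c0 : cmod (0 : K) < 1 by rewrite cmod0.
have := cauchy_formula dh c0; rewrite scale0r addr0.
have -> : J (fun t => f (z + t *: v) / (t - 0)) = J (fun t => f (z + t *: v) / t).
  by apply: eq_rect_int; rewrite ?leN11// => t _; rewrite subr0.
by rewrite /cauchy_ext => ->; rewrite mulrA mulVf ?mul1r// cauchy_cst_neq0.
Qed.

(** Moving by [s] along [e] adds [Re s] to [delta], and [delta] is bounded below on the
    compact disc: far out the whole disc lies in the domain, and Cauchy's formula
    applies. *)
Lemma cauchy_ext_far v z : exists b : R, forall s, b < complex.Re s ->
  D (z + s *: e) /\ cauchy_ext v (z + s *: e) = f (z + s *: e).
Proof.
have /compact_near_coveringP cS := @compact_rect R (-1) 1 (-1) 1.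
have : \forall b \near +oo, S `<=` (fun t => 0 < delta (z + t *: v) + b).
  apply: cS => t0 St0.
  have ct : {for t0, continuous (fun t => delta (z + t *: v))}.
    apply: (@continuous_comp _ _ _ (fun t => z + t *: v) delta).
      apply: continuousD; first exact: cst_continuous.
      exact: scalel_continuous.
    exact: delta_continuous.
  exists ([set t | delta (z + t0 *: v) - 1 < delta (z + t *: v)],
          [set b | 1 - delta (z + t0 *: v) <= b]).
    split => /=.
      have := ct [set x | delta (z + t0 *: v) - 1 < x]; apply.
      apply: open_nbhs_nbhs; split; first exact: open_gt.
      by rewrite /= gtrBl ltr01.
    by apply: nbhs_pinfty_ge; rewrite num_real.
  move=> [t b] /= [h1 h2]; apply: le_lt_trans (_ : delta (z + t0 *: v) - 1 + b < _).
    by move: h2; rewrite lerBlDr -subr_ge0 => h2; rewrite addrAC [_ + b]addrC.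
  by rewrite ltrD2r.
move=> [b [_ hb]]; exists (b + 1) => s bs.
have hS t : S t -> D (z + s *: e + t *: v).
  move=> St; have := hb (complex.Re s) _ t St.
  rewrite addrAC /= delta_e; apply.
  by apply: lt_trans bs; rewrite ltrDl.
split; last exact: cauchy_ext_disc.
have S0 : S 0 by rewrite /rect/= ?lexx oppr_le0 ler01.
by have := hS 0 S0; rewrite scale0r addr0.
Qed.

(** The margin lets the point move by [s e] with [Re s > - eps], so the identity
    principle is applied on an open half-plane around 0. *)
Lemma admissible_margin v z : admissible v z ->
  exists2 eps : R, 0 < eps & forall t, T t -> eps < delta (z + t *: v).
Proof.
move=> adm.
have /compact_near_coveringP cT := compact_edge (@leN11 R) (@leN11 R).
have H : \forall eps \near 0^'+, T `<=` (fun t => eps < delta (z + t *: v)).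
  apply: cT => t0 Tt0.
  have ct : {for t0, continuous (fun t => delta (z + t *: v))}.
    apply: (@continuous_comp _ _ _ (fun t => z + t *: v) delta).
      apply: continuousD; first exact: cst_continuous.
      exact: scalel_continuous.
    exact: delta_continuous.
  have d0 : 0 < delta (z + t0 *: v) by exact: adm.
  exists ([set t | delta (z + t0 *: v) / 2 < delta (z + t *: v)],
          [set x | x < delta (z + t0 *: v) / 2]).
    split => /=.
      have := ct [set x | delta (z + t0 *: v) / 2 < x]; apply.
      apply: open_nbhs_nbhs; split; first exact: open_gt.
      by rewrite /= ltr_pdivrMr// ltr_pMr// ltr1n.
    by apply: nbhs_right_lt; rewrite divr_gt0.
  by move=> [t x] /= [h1 h2]; exact: lt_trans h1.
have [eps [eps0 heps]] := filter_ex (filterI (nbhs_right_gt (0 : R)) H).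
by exists eps.
Qed.

Lemma admissible_shift v z s eps : (forall t, T t -> eps < delta (z + t *: v)) ->
  - eps < complex.Re s -> admissible v (z + s *: e).
Proof.
move=> h hs t Tt; rewrite addrAC /= delta_e -ltrBlDr sub0r.
by apply: lt_trans (h t Tt); rewrite ltrNl.
Qed.

(** Both sides are holomorphic along the half-plane [z + s e] and agree far out, so
    they agree although the disc around [z] need not lie in the domain. *)
Lemma cauchy_ext_eq v z : D z -> admissible v z -> cauchy_ext v z = f z.
Proof.
move=> Dz /admissible_margin[eps eps0 heps].
have [b hb] := cauchy_ext_far v z.
pose m := Num.min eps (delta z).
have m0 : 0 < m by rewrite lt_min eps0.
have := @half_plane_identity
  (fun s => cauchy_ext v (z + s *: e) - f (z + s *: e)) m b m0.
rewrite scale0r addr0 => H; apply/eqP; rewrite -subr_eq0; apply/eqP; apply: H.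
  move=> s ms.
  have me : - eps < complex.Re s by apply: le_lt_trans ms; rewrite lerN2 ge_min lexx.
  have md : - delta z < complex.Re s.
    by apply: le_lt_trans ms; rewrite lerN2 ge_min lexx orbT.
  have d1 := cauchy_ext_derivable (@hol_curve_line R z e) (admissible_shift heps me).
  have Ds : D (z + s *: e) by rewrite /= delta_e -ltrBlDl sub0r.
  have d2 := f_curve (@hol_curve_line R z e) Ds.
  exact: (@derivable_sub R _ _ s d1 d2).
by move=> s /hb[_ ->]; rewrite subrr.
Qed.

(** The values obtained from different directions agree for the same reason; they
    therefore patch together to one function. *)
Lemma cauchy_ext_indep v w z : admissible v z -> admissible w z ->
  cauchy_ext v z = cauchy_ext w z.
Proof.
move=> /admissible_margin[eps eps0 heps] /admissible_margin[eta eta0 heta].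
have [b hb] := cauchy_ext_far v z; have [b' hb'] := cauchy_ext_far w z.
pose m := Num.min eps eta.
have m0 : 0 < m by rewrite lt_min eps0.
have := @half_plane_identity
  (fun s => cauchy_ext v (z + s *: e) - cauchy_ext w (z + s *: e)) m (Num.max b b') m0.
rewrite scale0r addr0 => H; apply/eqP; rewrite -subr_eq0; apply/eqP; apply: H.
  move=> s ms.
  have me : - eps < complex.Re s by apply: le_lt_trans ms; rewrite lerN2 ge_min lexx.
  have md : - eta < complex.Re s.
    by apply: le_lt_trans ms; rewrite lerN2 ge_min lexx orbT.
  have d1 := cauchy_ext_derivable (@hol_curve_line R z e) (admissible_shift heps me).
  have d2 := cauchy_ext_derivable (@hol_curve_line R z e) (admissible_shift heta md).
  exact: (@derivable_sub R _ _ s d1 d2).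
by move=> s; rewrite gt_max => /andP[/hb[_ ->] /hb'[_ ->]]; rewrite subrr.
Qed.

(** Near a point, one fixed direction stays admissible, and the extension is given
    by the contour integral in that direction. *)
Theorem hartogs_extension : (forall z, exists v, admissible v z) ->
  exists F : V -> K, (forall z, D z -> F z = f z) /\
    (forall gam, hol_curve gam -> forall s, derivable (fun s => F (gam s)) s 1).
Proof.
move=> /choice[v hv]; exists (fun z => cauchy_ext (v z) z); split.
  by move=> z Dz; exact: cauchy_ext_eq.
move=> gam hg s0.
have d1 := cauchy_ext_derivable hg (hv (gam s0)).
apply: near_eq_derivable d1.
near=> s; apply: cauchy_ext_indep; last exact: hv.
by near: s; exact: near_admissible.
Unshelve. all: by end_near. Qed.

End Hartogs.

(** * The defining function of the hypersurface *)

Section Conjugation.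
Variable R : realType.
Implicit Types x y : Cplx R.
Lemma conjD x y : (x + y)^* = x^* + y^*. Proof. exact: rmorphD. Qed.
Lemma conjB x y : (x - y)^* = x^* - y^*. Proof. exact: rmorphB. Qed.
Lemma conjN x : (- x)^* = - x^*. Proof. exact: rmorphN. Qed.
Lemma conjM x y : (x * y)^* = x^* * y^*. Proof. exact: rmorphM. Qed.
Lemma conjX x n : (x ^+ n)^* = x^* ^+ n. Proof. exact: rmorphXn. Qed.
Lemma conj1 : 1^* = 1 :> Cplx R. Proof. exact: rmorph1. Qed.
Lemma conjn n : n%:R^* = n%:R :> Cplx R. Proof. exact: rmorph_nat. Qed.
Lemma conjV x : (x^-1)^* = (x^*)^-1. Proof. exact: fmorphV. Qed.
Lemma conji : 'i^* = - 'i :> Cplx R. Proof. exact: conjCi. Qed.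
Lemma conjR (a : R) : ((a%:C)%C : Cplx R)^* = (a%:C)%C.
Proof. by apply/CrealP/complex_realP; exists a. Qed.
Definition conjE := (conjD, conjB, conjN, conjM, conjX, conj1, conjn, conjV, conji, conjR).
End Conjugation.

Section Model.
Variables (R : realType) (s : bool).
Local Notation K := (Cplx R).
Local Notation V := ('rV[K]_4).
Local Notation T := (edge (-1 : R) 1 (-1) 1).
Implicit Types (z w v : V) (t : K).
Local Notation pm := ((-1) ^+ s : K).

(** The polarization of the defining function, holomorphic in [z] and antiholomorphic
    in [w]. *)
Definition pol z w : K :=
  z 0 0 * (w 0 1)^* + z 0 1 * (w 0 0)^* + z 0 2 * (w 0 2)^* +
  pm * (z 0 0 ^+ 2 * ((w 0 0)^*) ^+ 2).

(** [z] lies on the Segre variety of [w]; the pairs with [z = w] are the points of the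
    hypersurface. *)
Definition seg z w := z 0 3 + (w 0 3)^* = 2 * pol z w.

Lemma pol_conj z w : (pol z w)^* = pol w z.
Proof.
by rewrite /pol !conjE !conjCK; ring.
Qed.

Lemma model_funE z : model_fun s z = pol z z.
Proof.
rewrite /model_fun /pol -exprMn -!normCK; congr (_ + _ + _ * _).
by rewrite -exprM.
Qed.

Lemma conj_eq_real (k : K) : k^* = k -> k = ((complex.Re k)%:C)%C.
Proof. by move=> /CrealP/RRe_real. Qed.

Lemma ReJ (k : K) : k + k^* = 2 * ((complex.Re k)%:C)%C.
Proof. exact: addcJ. Qed.

Variable sg : R.
Hypothesis sg2 : sg * sg = 1.

(** The sign [sg] distinguishes the two sides of the hypersurface. *)
Definition defect z : R := sg * complex.Re (z 0 3 - pol z z).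

(** The direction in which [defect] grows at unit speed. *)
Definition axis : V := (sg%:C)%C *: delta_mx 0 3.

Lemma axisE j t z : (z + t *: axis) 0 j = if j == 3 then z 0 3 + t * (sg%:C)%C else z 0 j.
Proof.
rewrite !mxE /=; case: eqP => [->|_]; first by rewrite mulr1.
by rewrite mulr0 mulr0 addr0.
Qed.

Lemma pol_axis z w t t' : pol (z + t *: axis) (w + t' *: axis) = pol z w.
Proof. by rewrite /pol !axisE. Qed.

Lemma defect_axis z t : defect (z + t *: axis) = defect z + complex.Re t.
Proof.
rewrite /defect pol_axis axisE /= !creB creD creM /= mulr0 subr0.
have E (a b r : R) : sg * (a + r * sg - b) = sg * (a - b) + r.
  by rewrite -[r in RHS]mul1r -sg2; ring.
exact: E.
Qed.

Lemma continuous_conjC : continuous (fun k : K => k^*).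
Proof.
move=> k; apply/continuous_cmodP => e e0; apply/nbhs_cmodP; exists e => // k' h.
by rewrite -rmorphB cmod_conj.
Qed.

Lemma continuous_defect : continuous defect.
Proof.
have cc (j : 'I_4) : continuous (fun z : V => z 0 j) by exact: coord_continuous.
have cj (j : 'I_4) : continuous (fun z : V => (z 0 j)^*).
  by move=> z; apply: (@continuous_comp _ _ _ (fun z : V => z 0 j) (fun k : K => k^*));
     [exact: cc|exact: continuous_conjC].
move=> z; apply: (@continuousM _ _ (fun=> sg) (fun z => complex.Re (z 0 3 - pol z z))).
  exact: cst_continuous.
apply: (@continuous_comp _ _ _ (fun z : V => z 0 3 - pol z z) (@complex.Re R)).
  apply: continuousB; first exact: cc.
  rewrite /pol; apply: continuousD; [apply: continuousD; [apply: continuousD|]|].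
  - by apply: continuousM; [exact: cc|exact: cj].
  - by apply: continuousM; [exact: cc|exact: cj].
  - by apply: continuousM; [exact: cc|exact: cj].
  - apply: continuousM; first exact: cst_continuous.
    apply: continuousM.
      exact: (@continuousM _ _ (fun z : V => z 0 0) (fun z => z 0 0) z (cc 0 z) (cc 0 z)).
    exact: (@continuousM _ _ (fun z : V => (z 0 0)^*) (fun z => (z 0 0)^*) z (cj 0 z) (cj 0 z)).
exact: continuous_Re.
Qed.

Lemma edge_cmod_le2 t : T t -> cmod t <= 2.
Proof.
move=> /edge_rect/rectS[h1 h2].
apply: (le_trans (le_cmod_ReIm t)); have -> : 2 = 1 + 1 :> R by [].
exact: lerD.
Qed.

End Model.

(** * Lines whose circles lie in the domain *)

Lemma circle_quadratic_ge (R : realType) (x y u k : R) :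
  - (u * y) <= x -> y * 1 <= y * (k * y - u) -> y <= x + k * (y * y).
Proof. nra. Qed.

Lemma defect_gt0_arith (R : realType) (d r q P u a W X : R) :
  let M := `|d| + `|r| + q + 2 * u + P in
  a <= u -> W <= P -> M + 1 <= X -> 0 <= M -> 0 < d + r - (2 * (a - X) + q + W).
Proof.
move=> M; rewrite /M; have := ler_norm (- d); have := ler_norm (- r).
rewrite !normrN; move: `|d| `|r| => m n; clear; lra.
Qed.

Section Admissible.
Variables (R : realType) (s : bool).
Local Notation K := (Cplx R).
Local Notation V := ('rV[K]_4).
Local Notation T := (edge (-1 : R) 1 (-1) 1).
Implicit Types (z w v : V) (t : K).
Local Notation pm := ((-1) ^+ s : K).

Lemma Re_pol z : complex.Re (pol s z z) =
  2 * complex.Re (z 0 0 * (z 0 1)^*) + cmod (z 0 2) ^+ 2 +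
  (-1) ^+ s * cmod (z 0 0) ^+ 4.
Proof.
have h2 (k : K) : k * k^* = ((cmod k ^+ 2)%:C)%C.
  by rewrite -normCK cmodE rmorphXn.
have -> : pol s z z = (z 0 0 * (z 0 1)^* + (z 0 0 * (z 0 1)^*)^*) +
    z 0 2 * (z 0 2)^* + pm * (z 0 0 * (z 0 0)^*) ^+ 2.
  by rewrite /pol !conjE !conjCK; ring.
rewrite ReJ !h2.
have -> : pm = (((-1) ^+ s)%:C)%C by rewrite rmorphXn rmorphN1.
have -> : 2 = ((2%:C)%C : K) by rewrite rmorph_nat.
rewrite -rmorphXn -!rmorphM -!rmorphD /= -exprM.
by [].
Qed.

(** On this side the form in [z_3] has the favourable sign: the direction is that of
    [z_3], and a long enough circle leaves the complement. *)
Lemma admissible_lt z : exists v, admissible (defect s (-1)) v z.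
Proof.
pose a := cmod (z 0 2); pose b := 1 + `|defect s (-1) z| + a ^+ 2.
pose A := a + b.
have a0 : 0 <= a by exact: cmod_ge0.
have b0 : 1 <= b by rewrite /b -addrA lerDl addr_ge0// exprn_ge0.
exists ((A%:C)%C *: delta_mx 0 2) => t Tt /=.
have co j : (z + t *: ((A%:C)%C *: delta_mx 0 2 : V)) 0 j =
    if j == 2 then z 0 2 + t * (A%:C)%C else z 0 j.
  rewrite !mxE /=; case: eqP => [->|_]; first by rewrite mulr1.
  by rewrite mulr0 mulr0 addr0.
have -> : defect s (-1) (z + t *: ((A%:C)%C *: delta_mx 0 2)) =
    defect s (-1) z - a ^+ 2 + cmod (z 0 2 + t * (A%:C)%C) ^+ 2.
  by rewrite /defect !creB !Re_pol !co /= -/a; ring.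
have t1 : 1 <= cmod t by exact: edge_cmod_ge Tt.
have hb : b <= cmod (z 0 2 + t * (A%:C)%C).
  have -> : z 0 2 + t * (A%:C)%C = t * (A%:C)%C - (- z 0 2).
    by rewrite opprK addrC.
  apply: le_trans (le_cmodB _ _).
  have A0 : 0 <= A by rewrite addr_ge0 ?(le_trans ler01 b0).
  rewrite cmodN cmodM cmod_real ger0_norm// lerBrDr -/a [b + a]addrC -/A.
  by rewrite ler_peMl.
have b2 : b <= b ^+ 2 by rewrite expr2 ler_peMl// (le_trans ler01 b0).
have bc : b ^+ 2 <= cmod (z 0 2 + t * (A%:C)%C) ^+ 2.
  by rewrite lerXn2r// nnegrE ?cmod_ge0 ?(le_trans ler01 b0).
have := ler_norm (- defect s (-1) z); rewrite normrN.
move: bc b2; rewrite /b; move: (cmod _ ^+ 2) (defect _ _ _) (a ^+ 2) (_ ^+ 2).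
move=> p q r u; move: `|q| => n; clear; lra.
Qed.

(** On this side the direction is [(c, - A, 0, 0)], on which the quadratic part of the form is
    negative.  The first entry [c] is chosen before [A], so that the quartic term stays
    bounded on the circle while the quadratic term grows with [A]. *)
Lemma admissible_gt z : exists v, admissible (defect s 1) v z.
Proof.
pose c := cmod (z 0 0) + 1.
pose B := cmod (z 0 1).
pose M := `|defect s 1 z| + `|complex.Re (pol s z z)| + cmod (z 0 2) ^+ 2 +
   2 * ((c + 2 * c) * B) + (c + 2 * c) ^+ 4.
pose A := M + 1.
have c0 : 1 <= c by rewrite lerDr cmod_ge0.
exists ((c%:C)%C *: delta_mx 0 0 - (A%:C)%C *: delta_mx 0 1) => t Tt /=.
set w := z + _.
have w0 : w 0 0 = z 0 0 + t * (c%:C)%C by rewrite !mxE /=; ring.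
have w1 : w 0 1 = z 0 1 - t * (A%:C)%C by rewrite !mxE /=; ring.
have w2 : w 0 2 = z 0 2 by rewrite !mxE /=; ring.
have w3 : w 0 3 = z 0 3 by rewrite !mxE /=; ring.
have t1 : 1 <= cmod t by exact: edge_cmod_ge Tt.
have t2 := edge_cmod_le2 Tt.
pose X := complex.Re (z 0 0 * t^*) + c * cmod t ^+ 2.
have X1 : 1 <= X.
  have h1 : - (cmod (z 0 0) * cmod t) <= complex.Re (z 0 0 * t^*).
    have := le_Re_cmod (z 0 0 * t^*); rewrite cmodM cmod_conj ler_norml.
    by move=> /andP[].
  have h2 : cmod t * 1 <= cmod t * (c * cmod t - cmod (z 0 0)).
    rewrite ler_wpM2l ?cmod_ge0// lerBrDr addrC -/c ler_peMr//.
    exact: le_trans c0.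
  apply: (le_trans t1); move: h1 h2; rewrite /X expr2.
  exact: circle_quadratic_ge.
have e1 : complex.Re (w 0 0 * (w 0 1)^*) =
    complex.Re (w 0 0 * (z 0 1)^*) - A * X.
  have tt : t * t^* = ((cmod t ^+ 2)%:C)%C.
    by rewrite -normCK cmodE rmorphXn.
  have -> : w 0 0 * (w 0 1)^* = w 0 0 * (z 0 1)^* -
      (A%:C)%C * (z 0 0 * t^* + (c%:C)%C * (t * t^*)).
    by rewrite w1 !conjE w0; ring.
  rewrite tt -rmorphM creB; congr (_ - _).
  by rewrite creM /= mul0r subr0 creD.
have hw : cmod (w 0 0) <= c + 2 * c.
  rewrite w0; apply: (le_trans (le_cmodD _ _)); rewrite cmodM cmod_real.
  rewrite ger0_norm ?(le_trans ler01 c0)//; apply: lerD; first by rewrite lerDl.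
  by rewrite ler_wpM2r ?(le_trans ler01 c0).
have h3 : complex.Re (w 0 0 * (z 0 1)^*) <= (c + 2 * c) * B.
  apply: (le_trans (ler_norm _)); apply: (le_trans (le_Re_cmod _)).
  by rewrite cmodM cmod_conj ler_wpM2r// cmod_ge0.
have h4 : (-1) ^+ s * cmod (w 0 0) ^+ 4 <= (c + 2 * c) ^+ 4.
  have h5 : cmod (w 0 0) ^+ 4 <= (c + 2 * c) ^+ 4.
    by rewrite lerXn2r// nnegrE ?cmod_ge0// (le_trans _ hw)// cmod_ge0.
  apply: le_trans h5; rewrite -[leRHS]mul1r ler_wpM2r ?exprn_ge0 ?cmod_ge0//.
  by case: (s); rewrite ?expr1 ?expr0// lerN10.
have M0 : 0 <= M.
  have cc : 0 <= c + 2 * c.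
    have c00 := le_trans ler01 c0.
    by apply: addr_ge0 => //; apply: mulr_ge0.
  apply: addr_ge0; last exact: exprn_ge0.
  apply: addr_ge0; last by apply: mulr_ge0 => //; apply: mulr_ge0 => //; exact: cmod_ge0.
  apply: addr_ge0; last by rewrite exprn_ge0// cmod_ge0.
  exact: addr_ge0.
have AX : A <= A * X by rewrite ler_peMr// addr_ge0.
have r3 : complex.Re (z 0 3) = defect s 1 z + complex.Re (pol s z z).
  by rewrite /defect mul1r creB subrK.
rewrite /defect mul1r creB w3 Re_pol e1 w2 r3.
exact: (defect_gt0_arith h3 h4 AX M0).
Qed.

Lemma admissible_exists (sg : R) z : sg = 1 \/ sg = -1 ->
  exists v, admissible (defect s sg) v z.
Proof. by move=> [->|->]; [exact: admissible_gt|exact: admissible_lt]. Qed.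

End Admissible.

(** * Entire maps, polarization and Segre varieties *)

Section Row4.
Variable R : realType.
Local Notation K := (Cplx R).

Definition mk4 (a b c d : K) : 'rV[K]_4 := \row_j [:: a; b; c; d]`_j.

Lemma mk4_0 a b c d : mk4 a b c d 0 0 = a. Proof. by rewrite mxE. Qed.
Lemma mk4_1 a b c d : mk4 a b c d 0 1 = b. Proof. by rewrite mxE. Qed.
Lemma mk4_2 a b c d : mk4 a b c d 0 2 = c. Proof. by rewrite mxE. Qed.
Lemma mk4_3 a b c d : mk4 a b c d 0 3 = d. Proof. by rewrite mxE. Qed.
Definition mk4E := (mk4_0, mk4_1, mk4_2, mk4_3).

Lemma row4P (z w : 'rV[K]_4) : z 0 0 = w 0 0 -> z 0 1 = w 0 1 ->
  z 0 2 = w 0 2 -> z 0 3 = w 0 3 -> z = w.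
Proof.
move=> e0 e1 e2 e3; apply/rowP => j.
case: j => [[|[|[|[|//]]]] hj].
- by rewrite (_ : Ordinal hj = 0)//; apply: val_inj.
- by rewrite (_ : Ordinal hj = 1)//; apply: val_inj.
- by rewrite (_ : Ordinal hj = 2)//; apply: val_inj.
- by rewrite (_ : Ordinal hj = 3)//; apply: val_inj.
Qed.
End Row4.

Section EntireMaps.
Variables (R : realType) (s : bool) (sg : R).
Hypothesis sg1 : sg = 1 \/ sg = -1.
Local Notation K := (Cplx R).
Local Notation V := ('rV[K]_4).
Implicit Types (z w v : V) (t : K) (F G : V -> V).
Local Notation pm := ((-1) ^+ s : K).
Local Notation delta := (defect s sg).
Local Notation D := [set z : V | 0 < delta z].
Local Notation ax := (axis sg).

Lemma sg_sqr : sg * sg = 1.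
Proof. by case: sg1 => ->; rewrite ?mulr1 ?mulrNN ?mulr1. Qed.

(** Closed under composition by definition, and enough for the one-variable identity
    principles. *)
Definition hol_map F := forall gam, hol_curve gam -> hol_curve (fun t => F (gam t)).

Lemma hol_map_comp F G : hol_map F -> hol_map G -> hol_map (fun z => F (G z)).
Proof. by move=> hF hG gam hg; exact: (hF _ (hG _ hg)). Qed.

Lemma hol_map_extension F : holomorphic_on D F ->
  exists2 G, hol_map G & forall z, D z -> G z = F z.
Proof.
move=> hF.
have ext j : exists g : V -> K, (forall z, D z -> g z = F z 0 j) /\
    (forall gam, hol_curve gam -> forall t, derivable (fun t => g (gam t)) t 1).
  apply: (@hartogs_extension R delta ax (fun z => F z 0 j)).
  - exact: continuous_defect.
  - by move=> z t; exact: (defect_axis s sg_sqr).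
  - move=> z /hF/differentiable_continuous cF.
    apply: (@continuous_comp _ _ _ F (fun M : V => M 0 j)) => //.
    exact: coord_continuous.
  - by move=> gam t hg /hF; exact: derivable_along_curve.
  - by move=> z; exact: admissible_exists.
have [g hg] := choice ext.
exists (fun z => \row_j g j z).
  move=> gam hgam j t.
  have -> : (fun t => (\row_j g j (gam t)) 0 j) = (fun t => g j (gam t)).
    by apply/funext => t'; rewrite mxE.
  exact: (hg j).2.
by move=> z Dz; apply/rowP => j; rewrite mxE (hg j).1.
Qed.

(** Every point is moved into the domain by going far enough along [axis]. *)
Lemma hol_map_eq F G : hol_map F -> hol_map G -> (forall z, D z -> F z = G z) ->
  forall z, F z = G z.
Proof.
move=> hF hG FG z; apply/rowP => j.
have hl := @hol_curve_line R z ax.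
have d1 t := hF _ hl j t; have d2 t := hG _ hl j t.
have := @half_plane_identity R
  (fun t => F (z + t *: ax) 0 j - G (z + t *: ax) 0 j) 1 (- delta z) ltr01.
rewrite scale0r addr0 => H; apply/eqP; rewrite -subr_eq0; apply/eqP; apply: H.
  move=> t _; exact: (@derivable_sub R _ _ t (d1 t) (d2 t)).
move=> t ht; rewrite FG ?subrr//= (defect_axis s sg_sqr).
by rewrite -ltrBlDl sub0r.
Qed.

Lemma hol_map_id : hol_map id.
Proof. by []. Qed.

(** A boundary point is a limit of points of [D] along [axis], so its image is in the
    closure of [D]; were it in [D], so would be the point itself, by means of [G]. *)
Lemma boundary_preserved F G : hol_map F ->
  (forall z, D z -> D (F z)) -> (forall z, D z -> D (G z)) ->
  (forall z, G (F z) = z) ->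
  forall z, delta z = 0 -> delta (F z) = 0.
Proof.
move=> hF FD GD GF z z0; apply/eqP; rewrite eq_le; apply/andP; split.
  by rewrite leNgt; apply/negP => /GD; rewrite GF /= z0 ltxx.
rewrite leNgt; apply/negP => neg.
have hl := hF _ (@hol_curve_line R z ax).
have cc : {for 0, continuous (fun t : K => delta (F (z + t *: ax)))}.
  apply: (@continuous_comp _ _ _ (fun t : K => F (z + t *: ax)) delta).
    exact: (hol_curve_continuous hl).
  exact: continuous_defect.
have : \forall t \near (0 : K), delta (F (z + t *: ax)) < 0.
  have := cc [set x | x < 0]; apply.
  by apply: open_nbhs_nbhs; split; [exact: open_lt|rewrite /= scale0r addr0].
move=> /nbhs_cmodP[d d0 hd].
have d2 : 0 < d / 2 by rewrite divr_gt0.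
have := hd ((d / 2)%:C)%C; rewrite subr0 cmod_real gtr0_norm// => /(_ _)/ltW.
rewrite leNgt => /(_ _)/negP; apply; last first.
  by apply: FD; rewrite /= (defect_axis s sg_sqr) z0 add0r.
by rewrite ltr_pdivrMr// ltr_pMr// ltr1n.
Qed.

Lemma segP z : seg s z z <-> delta z = 0.
Proof.
have rp : pol s z z = ((complex.Re (pol s z z))%:C)%C.
  by apply: conj_eq_real; exact: pol_conj.
rewrite /seg ReJ /defect creB; split.
  have t0 : (2 : K) != 0 by rewrite pnatr_eq0.
  by move=> /(mulfI t0) h; rewrite -h /= subrr mulr0.
move=> /eqP; rewrite mulf_eq0.
have -> : (sg == 0) = false.
  by apply/negbTE; case: sg1 => ->; rewrite ?oppr_eq0 oner_neq0.
by rewrite /= subr_eq0 => /eqP ->; rewrite -rp.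
Qed.

(** The curve is [t |-> a + t b] in the first three coordinates, with
    [a = (z + w) / 2] and [b = (z - w) / (2 i)], so that it takes the values [z] and [w]
    at [i] and [- i].  The fourth coordinate is the polarized form along the curve plus
    [i] times an affine function with real coefficients, so that real parameters
    give points of the hypersurface; its two real coefficients are fitted to the last
    coordinates of [z] and [w], and the relation [seg s z w] makes the fit possible. *)
Lemma polarizing_curve z w : seg s z w ->
  exists2 gam : K -> V, hol_curve gam &
    [/\ gam 'i = z, gam ('i^*) = w & forall x : R, seg s (gam (x%:C)%C) (gam (x%:C)%C)].
Proof.
move=> zw.
pose a j := (z 0 j + w 0 j) / 2.
pose b j := (z 0 j - w 0 j) / (2 * 'i).
pose k := (z 0 3 - pol s z w) / 'i.
pose u0 := (k + k^*) / 2; pose u1 := (k - k^*) / (2 * 'i).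
have t0 : (2 : K) != 0 by rewrite pnatr_eq0.
have i0 : ('i : K) != 0 by exact: neq0Ci.
have i2 : 'i * 'i = -1 :> K by rewrite -expr2 sqrCi.
pose l j t := a j + b j * t.
pose m j t := (a j)^* + (b j)^* * t.
pose q t := l 0 t * m 1 t + l 1 t * m 0 t + l 2 t * m 2 t +
  pm * ((l 0 t * l 0 t) * (m 0 t * m 0 t)).
pose gam t : V := \row_j (if j == 3 then q t + 'i * (u0 + u1 * t) else l j t).
have li j : l j 'i = z 0 j by rewrite /l /a /b; field; rewrite ?t0 ?i0.
have lNi j : l j (- 'i) = w 0 j by rewrite /l /a /b; field; rewrite ?t0 ?i0.
have mE j t : m j t = (l j t^*)^* by rewrite /m /l !conjE conjCK.
exists gam.
  move=> j t; case: (eqVneq j 3) => [->|j3].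
    have -> : (fun t => gam t 0 3) = (fun t => q t + 'i * (u0 + u1 * t)).
      by apply/funext => t'; rewrite mxE eqxx.
    have dl j' : derivable (l j') t 1 by exact: derivable_affine.
    have dm j' : derivable (m j') t 1 by exact: derivable_affine.
    have d1 := @derivable_mul R (l 0) (m 1) t (dl 0) (dm 1).
    have d2 := @derivable_mul R (l 1) (m 0) t (dl 1) (dm 0).
    have d3 := @derivable_mul R (l 2) (m 2) t (dl 2) (dm 2).
    have d4 := @derivable_mul R (l 0) (l 0) t (dl 0) (dl 0).
    have d5 := @derivable_mul R (m 0) (m 0) t (dm 0) (dm 0).
    have d6 := @derivable_mul R _ _ t d4 d5.
    have d7 := @derivable_mul R (fun=> pm) _ t (derivable_const pm t) d6.
    have d8 := @derivable_add R _ _ t (@derivable_add R _ _ t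
      (@derivable_add R _ _ t d1 d2) d3) d7.
    have d9 := @derivable_mul R (fun=> 'i) _ t (derivable_const 'i t)
      (@derivable_affine R u0 u1 t).
    exact: (@derivable_add R _ _ t d8 d9).
  have -> : (fun t => gam t 0 j) = l j.
    by apply/funext => t'; rewrite mxE (negbTE j3).
  exact: derivable_affine.
have qi : q 'i = pol s z w.
  by rewrite /q !mE conji !li !lNi /pol !expr2.
have qNi : q (- 'i) = pol s w z.
  by rewrite /q !mE conjN conji opprK !li !lNi /pol !expr2.
have k3 : z 0 3 = pol s z w + 'i * k.
  by rewrite /k mulrC divfK// addrC subrK.
have k4 : w 0 3 = pol s w z + 'i * k^*.
  have /(congr1 (fun x => (x - z 0 3)^*)) := zw.
  have aux (p x : K) : (2 * p - (p + 'i * x))^* = p^* + 'i * x^*.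
    by rewrite !conjE; ring.
  by rewrite addrC addKr conjCK => ->; rewrite k3 -(pol_conj s z w); exact: aux.
split.
- apply/rowP => j; rewrite mxE; case: eqP => [->|_]; last exact: li.
  rewrite qi k3 /u0 /u1; congr (_ + _ * _); by field; rewrite ?t0 ?i0.
- rewrite conji; apply/rowP => j; rewrite mxE; case: eqP => [->|_]; last exact: lNi.
  rewrite qNi k4 /u0 /u1; congr (_ + _ * _); by field; rewrite ?t0 ?i0.
move=> x; rewrite /seg /pol !mxE /=.
have xr : ((x%:C)%C : K)^* = (x%:C)%C by exact: conjR.
have au0 (y : K) : ((y + y^*) / 2)^* = (y + y^*) / 2.
  by rewrite !conjE conjCK addrC.
have au1 (y : K) : ((y - y^*) / (2 * 'i))^* = (y - y^*) / (2 * 'i).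
  by rewrite !conjE conjCK; field; rewrite ?t0 ?i0.
have u0r : u0^* = u0 by exact: au0.
have u1r : u1^* = u1 by exact: au1.
have lc j : (l j (x%:C)%C)^* = m j (x%:C)%C by rewrite mE xr.
have aux (A0 A1 A2 B0 B1 B2 U W X : K) : A0^* = B0 -> A1^* = B1 -> A2^* = B2 ->
    U^* = U -> W^* = W -> X^* = X ->
    let Q := A0 * B1 + A1 * B0 + A2 * B2 + pm * ((A0 * A0) * (B0 * B0)) +
      'i * (U + W * X) in
    Q + Q^* = 2 * (A0 * A1^* + A1 * A0^* + A2 * A2^* + pm * (A0 ^+ 2 * A0^* ^+ 2)).
  move=> <- <- <- hU hW hX /=; rewrite !conjE !conjCK hU hW hX; ring.
exact: (aux _ _ _ _ _ _ _ _ _ (lc 0) (lc 1) (lc 2) u0r u1r xr).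
Qed.

(** Along the curve that joins [z] to [w], the defining equation of the image reads
    [h t = 0] with [h] entire, by Schwarz reflection.  It holds for real [t], hence for
    [t = i], where it is the claim. *)
Lemma segre_preserved F : hol_map F -> (forall z, delta z = 0 -> delta (F z) = 0) ->
  forall z w, seg s z w -> seg s (F z) (F w).
Proof.
move=> hF F0 z w zw.
have [gam hg [<- <- real]] := polarizing_curve zw.
have hFg := hF _ hg.
pose p j t := F (gam t) 0 j.
pose q j t := (F (gam t^*) 0 j)^*.
have dp j t : derivable (p j) t 1 by exact: hFg.
have dq j t : derivable (q j) t 1.
  exact: (@derivable_reflect R (p j) t (hFg j t^*)).
pose h t := p 3 t + q 3 t - 2 * (p 0 t * q 1 t + p 1 t * q 0 t + p 2 t * q 2 t +
  pm * ((p 0 t * p 0 t) * (q 0 t * q 0 t))).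
have dh t : derivable h t 1.
  have d1 := @derivable_mul R (p 0) (q 1) t (dp 0 t) (dq 1 t).
  have d2 := @derivable_mul R (p 1) (q 0) t (dp 1 t) (dq 0 t).
  have d3 := @derivable_mul R (p 2) (q 2) t (dp 2 t) (dq 2 t).
  have d4 := @derivable_mul R (p 0) (p 0) t (dp 0 t) (dp 0 t).
  have d5 := @derivable_mul R (q 0) (q 0) t (dq 0 t) (dq 0 t).
  have d6 := @derivable_mul R _ _ t d4 d5.
  have d7 := @derivable_mul R (fun=> pm) _ t (derivable_const pm t) d6.
  have d8 := @derivable_add R _ _ t (@derivable_add R _ _ t
    (@derivable_add R _ _ t d1 d2) d3) d7.
  have d9 := @derivable_mul R (fun=> 2) _ t (derivable_const 2 t) d8.
  exact: (@derivable_sub R _ _ t (@derivable_add R _ _ t (dp 3 t) (dq 3 t)) d9).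
have h0 x : h (x%:C)%C = 0.
  have : seg s (F (gam (x%:C)%C)) (F (gam (x%:C)%C)).
    by apply/segP/F0/segP; exact: real.
  rewrite /seg /pol /h /p /q conjR !expr2 => ->; exact: subrr.
have := identity_entire dh h0 'i.
rewrite /h /p /q /seg /pol !expr2 => /eqP; rewrite subr_eq0 => /eqP ->.
by [].
Qed.

(** Two Segre varieties are graphs over the first three coordinates.  If their centres
    differ in one of these, the difference of the graphs is a nonconstant polynomial
    of degree 1 in a suitable variable, and it vanishes somewhere. *)
Lemma segre_meet (p p' : V) :
  ~~ [&& p 0 0 == p' 0 0, p 0 1 == p' 0 1 & p 0 2 == p' 0 2] ->
  exists z, seg s z p /\ seg s z p'.
Proof.
pose c := (p 0 3 - p' 0 3)^*.
have t0 : (2 : K) != 0 by rewrite pnatr_eq0.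
have reach x y u : 2 * (pol s (mk4 x y u 0) p - pol s (mk4 x y u 0) p') = c ->
    exists z, seg s z p /\ seg s z p'.
  move=> h; exists (mk4 x y u (2 * pol s (mk4 x y u 0) p - (p 0 3)^*)).
  have polE w d : pol s (mk4 x y u d) w = pol s (mk4 x y u 0) w.
    by rewrite /pol !mk4E.
  rewrite /seg !polE mk4E subrK; split=> //.
  have -> : 2 * pol s (mk4 x y u 0) p = 2 * pol s (mk4 x y u 0) p' + c.
    by rewrite -h; ring.
  by rewrite /c conjB; ring.
have nz x y : x != y -> (x - y)^* != 0 by rewrite fmorph_eq0 subr_eq0.
case: (eqVneq (p 0 0) (p' 0 0)) => [e0|/nz n0 _]; last first.
  apply: (reach 0 (c / (2 * (p 0 0 - p' 0 0)^*)) 0).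
  rewrite /pol !mk4E conjB in n0 *; field; by rewrite ?n0 ?t0.
case: (eqVneq (p 0 1) (p' 0 1)) => [e1|/nz n1 _]; last first.
  apply: (reach (c / (2 * (p 0 1 - p' 0 1)^*)) 0 0).
  rewrite /pol !mk4E e0 conjB in n1 *; field; by rewrite ?n1 ?t0.
case: (eqVneq (p 0 2) (p' 0 2)) => [//|/nz n2 _].
apply: (reach 0 0 (c / (2 * (p 0 2 - p' 0 2)^*))).
rewrite /pol !mk4E e0 e1 conjB in n2 *; field; by rewrite ?n2 ?t0.
Qed.

(** The classes of this relation are the lines parallel to the last axis, called
    vertical below. *)
Definition same_base (w w' : V) :=
  [/\ w 0 0 = w' 0 0, w 0 1 = w' 0 1 & w 0 2 = w' 0 2].

Lemma pol_base z z' w w' : same_base z z' -> same_base w w' ->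
  pol s z w = pol s z' w'.
Proof. by rewrite /pol => -[-> -> ->] [-> -> ->]. Qed.

(** Segre varieties with centres on a common vertical line are translates of each
    other, hence disjoint when distinct, while all other pairs meet; the map [G] pulls a
    common point of the varieties of [F w] and [F w'] back to one of those of [w] and
    [w']. *)
Lemma fibers_preserved F G : (forall z w, seg s z w -> seg s (G z) (G w)) ->
  (forall z, G (F z) = z) ->
  forall w w', same_base w w' -> same_base (F w) (F w').
Proof.
move=> Gseg GF w w' ww'.
case: (boolP [&& F w 0 0 == F w' 0 0, F w 0 1 == F w' 0 1 & F w 0 2 == F w' 0 2]).
  by move=> /and3P[/eqP ? /eqP ? /eqP ?].
move=> /segre_meet[z [/Gseg + /Gseg]]; rewrite !GF /seg => h h'.
suff -> : w = w' by [].
have e3 : w 0 3 = w' 0 3.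
  have e : pol s (G z) w = pol s (G z) w' by apply: pol_base.
  by rewrite e -h' in h; move/addrI: h => /(can_inj conjCK).
by case: ww' => e0 e1 e2; exact: row4P.
Qed.

End EntireMaps.

(** * The group as polynomial maps *)

Section NormalForm.
Variables (R : realType) (s : bool).
Local Notation K := (Cplx R).
Local Notation V := ('rV[K]_4).
Local Notation pm := ((-1) ^+ s : K).
Implicit Types (z w : V).

Section Palg.
Variables (q E W rho sigma tau b d v : K).

(** The maps of the group, with [E] and [W] in place of the unimodular numbers
    [e^(i phi)] and [e^(i psi)] and [v] in place of [i u]: their properties become
    polynomial identities. *)
Definition palg z : V :=
  let z1 := z 0 0 in let z2 := z 0 1 in let z3 := z 0 2 in let z4 := z 0 3 in
  mk4 (q * E * z1 + rho)
    ((- pm * 2 * (rho * rho^*) * q * E + q ^+ 2 * b) * z1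
      + q ^+ 3 * E * z2 + q * d * z3
      - pm * 2 * rho^* * q ^+ 2 * E ^+ 2 * z1 ^+ 2 + sigma)
    (- d^* * (E * W) * z1 + q ^+ 2 * W * z3 + tau)
    ((2 * sigma^* * q * E + 2 * rho^* * q ^+ 2 * b
       - 2 * tau^* * d^* * (E * W)) * z1
      + 2 * rho^* * q ^+ 3 * E * z2
      + (2 * rho^* * q * d + 2 * tau^* * q ^+ 2 * W) * z3
      + q ^+ 4 * z4
      - pm * 2 * rho^* ^+ 2 * q ^+ 2 * E ^+ 2 * z1 ^+ 2
      + rho * sigma^* + sigma * rho^* + tau * tau^* + pm * (rho * rho^*) ^+ 2 + v).

Definition pinv1 z := (q * E)^-1 * (z 0 0 - rho).
Definition pinv3 z :=
  (q ^+ 2 * W)^-1 * (z 0 2 - tau + d^* * (E * W) * pinv1 z).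
Definition pinv2 z := (q ^+ 3 * E)^-1 *
  (z 0 1 - sigma - (- pm * 2 * (rho * rho^*) * q * E + q ^+ 2 * b) * pinv1 z -
   q * d * pinv3 z + pm * 2 * rho^* * q ^+ 2 * E ^+ 2 * (pinv1 z * pinv1 z)).
Definition pinv4 z := (q ^+ 4)^-1 *
  (z 0 3 - (2 * sigma^* * q * E + 2 * rho^* * q ^+ 2 * b
       - 2 * tau^* * d^* * (E * W)) * pinv1 z
   - 2 * rho^* * q ^+ 3 * E * pinv2 z
   - (2 * rho^* * q * d + 2 * tau^* * q ^+ 2 * W) * pinv3 z
   + pm * 2 * rho^* ^+ 2 * q ^+ 2 * E ^+ 2 * (pinv1 z * pinv1 z)
   - (rho * sigma^* + sigma * rho^* + tau * tau^* + pm * (rho * rho^*) ^+ 2 + v)).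
(** The equations are solved in the order 1, 3, 2, 4 of the coordinates. *)
Definition palg_inv z : V := mk4 (pinv1 z) (pinv2 z) (pinv3 z) (pinv4 z).

Hypotheses (q0 : q != 0) (E0 : E != 0) (W0 : W != 0).

Lemma palgK z : palg_inv (palg z) = z.
Proof.
have p1 : pinv1 (palg z) = z 0 0.
  by rewrite /pinv1 mk4E; field; rewrite ?q0 ?E0.
have p3 : pinv3 (palg z) = z 0 2.
  by rewrite /pinv3 p1 mk4E; field; rewrite ?q0 ?W0.
have p2 : pinv2 (palg z) = z 0 1.
  by rewrite /pinv2 p1 p3 mk4E; field; rewrite ?q0 ?E0.
have p4 : pinv4 (palg z) = z 0 3.
  by rewrite /pinv4 p1 p2 p3 mk4E; field; rewrite ?q0.
by apply: row4P; rewrite mk4E.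
Qed.

Lemma palg_invK z : palg (palg_inv z) = z.
Proof.
have e1 : q * E * pinv1 z = z 0 0 - rho by rewrite mulVKf// mulf_neq0.
have e3 : q ^+ 2 * W * pinv3 z = z 0 2 - tau + d^* * (E * W) * pinv1 z.
  by rewrite mulVKf// !mulf_neq0// expf_neq0.
have e2 : q ^+ 3 * E * pinv2 z = z 0 1 - sigma -
   (- pm * 2 * (rho * rho^*) * q * E + q ^+ 2 * b) * pinv1 z -
   q * d * pinv3 z + pm * 2 * rho^* * q ^+ 2 * E ^+ 2 * (pinv1 z * pinv1 z).
  by rewrite mulVKf// !mulf_neq0// expf_neq0.
have e4 : q ^+ 4 * pinv4 z =
   z 0 3 - (2 * sigma^* * q * E + 2 * rho^* * q ^+ 2 * b
       - 2 * tau^* * d^* * (E * W)) * pinv1 z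
   - 2 * rho^* * q ^+ 3 * E * pinv2 z
   - (2 * rho^* * q * d + 2 * tau^* * q ^+ 2 * W) * pinv3 z
   + pm * 2 * rho^* ^+ 2 * q ^+ 2 * E ^+ 2 * (pinv1 z * pinv1 z)
   - (rho * sigma^* + sigma * rho^* + tau * tau^* + pm * (rho * rho^*) ^+ 2 + v).
  by rewrite mulVKf// expf_neq0.
apply: row4P; rewrite /palg !mk4E.
- by rewrite e1 subrK.
- by rewrite e2; move: (pinv1 z) (pinv3 z) => x y; ring.
- by rewrite e3; move: (pinv1 z) => x; ring.
- by rewrite e4; move: (pinv1 z) (pinv2 z) (pinv3 z) => x x' y; ring.
Qed.

Hypotheses (qr : q^* = q) (Er : E^* = E^-1) (Wr : W^* = W^-1) (vr : v^* = - v).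
Hypothesis db : d * d^* = - q ^+ 3 * (E * b^* + E^-1 * b).

(** The hypotheses say that [q] is real, [E] and [W] are unimodular and [v] is
    imaginary.  The relation between [b] and [d] cancels the terms [z_1 w_1^*] that come
    from [z_1 z_2] and from [z_3]. *)
Lemma palg_seg z w :
  palg z 0 3 + (palg w 0 3)^* - 2 * pol s (palg z) (palg w) =
  q ^+ 4 * (z 0 3 + (w 0 3)^* - 2 * pol s z w).
Proof.
have eb : b = - E * (d * d^* / q ^+ 3 + E * b^*).
  by rewrite db; field; rewrite ?q0 ?E0.
rewrite /pol /palg !mk4E !conjE !conjCK qr Er Wr vr.
move: (z 0 0) (z 0 1) (z 0 2) (z 0 3) (w 0 0)^* (w 0 1)^* (w 0 2)^* (w 0 3)^*.
move=> z0 z1 z2 z3 w0 w1 w2 w3.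
move: eb; move: b^* d^* rho^* sigma^* tau^* pm => bc dc rc sc tc p ->.
by field; rewrite ?q0 ?E0 ?W0.
Qed.

End Palg.

Section Differentiability.
Variable x : V.
Implicit Types f g : V -> K.

Lemma differentiable_add f g : differentiable f x -> differentiable g x ->
  differentiable (fun z => f z + g z) x.
Proof. exact: differentiableD. Qed.

Lemma differentiable_sub f g : differentiable f x -> differentiable g x ->
  differentiable (fun z => f z - g z) x.
Proof. exact: differentiableB. Qed.

Lemma differentiable_mul f g : differentiable f x -> differentiable g x ->
  differentiable (fun z => f z * g z) x.
Proof. exact: differentiableM. Qed.

Lemma differentiable_scale (k : K) f : differentiable f x -> differentiable (fun z => k * f z) x.
Proof. by move=> h; apply: differentiable_mul => //; exact: differentiable_cst. Qed.

Lemma differentiable_shift (k : K) f : differentiable f x -> differentiable (fun z => f z + k) x.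
Proof. by move=> h; apply: differentiable_add => //; exact: differentiable_cst. Qed.

Lemma differentiable_entry (j : 'I_4) : differentiable (fun z : V => z 0 j) x.
Proof. exact: differentiable_coord. Qed.

Lemma differentiable_mk4 (f0 f1 f2 f3 : V -> K) : differentiable f0 x -> differentiable f1 x ->
  differentiable f2 x -> differentiable f3 x ->
  differentiable (fun z => mk4 (f0 z) (f1 z) (f2 z) (f3 z)) x.
Proof.
move=> h0 h1 h2 h3.
have -> : (fun z => mk4 (f0 z) (f1 z) (f2 z) (f3 z)) =
   (fun z => f0 z *: (delta_mx 0 0 : V)) + (fun z => f1 z *: (delta_mx 0 1 : V)) +
   (fun z => f2 z *: (delta_mx 0 2 : V)) + (fun z => f3 z *: (delta_mx 0 3 : V)).
  apply/funext => z; apply: row4P; rewrite mk4E !mxE /=; ring.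
by apply: differentiableD; [apply: differentiableD; [apply: differentiableD|]|];
  exact: differentiableZl.
Qed.

Lemma differentiable_palg q E W rho sigma tau b d v :
  differentiable (palg q E W rho sigma tau b d v) x.
Proof.
have c j := differentiable_entry j.
apply: (@differentiable_mk4 _ _ _ _).
- by apply: differentiable_shift; apply: differentiable_scale.
- apply: differentiable_shift; apply: differentiable_sub; last by apply: differentiable_scale; exact: differentiable_mul.
  by apply: differentiable_add; [apply: differentiable_add|]; apply: differentiable_scale.
- by apply: differentiable_shift; apply: differentiable_add; apply: differentiable_scale.
- do 5 apply: differentiable_shift; apply: differentiable_sub; last by apply: differentiable_scale; exact: differentiable_mul.
  by apply: differentiable_add; [apply: differentiable_add; [apply: differentiable_add|]|]; apply: differentiable_scale.
Qed.

Lemma differentiable_palg_inv q E W rho sigma tau b d v :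
  differentiable (palg_inv q E W rho sigma tau b d v) x.
Proof.
have c j := differentiable_entry j.
have d1 : differentiable (pinv1 q E rho) x.
  by apply: differentiable_scale; apply: differentiable_shift.
have d3 : differentiable (pinv3 q E W rho tau d) x.
  by apply: differentiable_scale; apply: differentiable_add; [apply: differentiable_shift|apply: differentiable_scale].
have d2 : differentiable (pinv2 q E W rho sigma tau b d) x.
  apply: differentiable_scale; apply: differentiable_add; last by apply: differentiable_scale; exact: differentiable_mul.
  apply: differentiable_sub; last exact: differentiable_scale.
  by apply: differentiable_sub; [apply: differentiable_shift|apply: differentiable_scale].
have d4 : differentiable (pinv4 q E W rho sigma tau b d v) x.
  apply: differentiable_scale; apply: differentiable_shift.
  apply: differentiable_add; last by apply: differentiable_scale; exact: differentiable_mul.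
  apply: differentiable_sub; last exact: differentiable_scale.
  apply: differentiable_sub; last exact: differentiable_scale.
  by apply: differentiable_sub; [|apply: differentiable_scale].
exact: (differentiable_mk4 d1 d2 d3 d4).
Qed.
End Differentiability.

End NormalForm.

(** * Polar coordinates *)

Section Expi.
Variable R : realType.
Local Notation K := (Cplx R).
Implicit Types (x y : R) (a : K).

Lemma expiD x y : expi (x + y) = expi x * expi y :> K.
Proof. by apply/eqP; rewrite eq_complex /= cosD sinD eqxx [X in _ == X]addrC eqxx. Qed.

Lemma cmod_expi x : cmod (expi x) = 1.
Proof.
apply/eqP; rewrite -(eqrXn2 (ltn0Sn 1)) ?cmod_ge0//.
by rewrite cmod_sqr /= cos2Dsin2 expr1n.
Qed.

Lemma expi_neq0 x : expi x != 0 :> K.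
Proof. by rewrite -cmod_eq0 cmod_expi oner_neq0. Qed.

Lemma conj_expi x : (expi x : K)^* = (expi x)^-1.
Proof.
apply: (mulfI (expi_neq0 x)); rewrite mulfV ?expi_neq0//.
by rewrite -normCK cmodE cmod_expi expr1n.
Qed.

(** [acos] gives the angle up to sign. *)
Lemma polar a : exists x, a = ((cmod a)%:C)%C * expi x.
Proof.
have [->|a0] := eqVneq a 0; first by exists 0; rewrite cmod0 mul0r.
have m0 : 0 < cmod a by rewrite cmod_gt0.
pose c := complex.Re a / cmod a; pose d := complex.Im a / cmod a.
have cd : c ^+ 2 + d ^+ 2 = 1.
  by rewrite /c /d !expr_div_n -mulrDl -cmod_sqr divff// expf_neq0// gt_eqF.
have ac : a = ((cmod a)%:C)%C * Complex c d.
  apply/eqP; rewrite eq_complex /= /c /d; move: (lt0r_neq0 m0).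
  move: (cmod a) (complex.Re a) (complex.Im a) => m x y n.
  by apply/andP; split; apply/eqP; field.
have c1 : -1 <= c <= 1.
  rewrite -ler_norml -(@ler_pXn2r _ 2)// ?nnegrE// expr1n real_normK ?num_real//.
  by rewrite -cd lerDl sqr_ge0.
have sd : Num.sqrt (1 - c ^+ 2) = `|d|.
  by rewrite -cd addrAC subrr add0r sqrtr_sqr.
have [d0|d0] := leP 0 d.
  exists (acos c); rewrite {1}ac; congr (_ * _).
  by rewrite /expi acosK ?in_itv// sin_acos// sd ger0_norm.
exists (- acos c); rewrite {1}ac; congr (_ * _).
by rewrite /expi cosN sinN acosK ?in_itv// sin_acos// sd ltr0_norm// opprK.
Qed.

Lemma P_mapE s (q phi psi u : R) (rho sigma tau b d : K) :
  P_map s q phi psi u rho sigma tau b d =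
  palg s (q%:C)%C (expi phi) (expi psi) rho sigma tau b d ('i * (u%:C)%C).
Proof.
apply/funext => z; rewrite /P_map.
have -> : expi (2 * phi) = expi phi ^+ 2 :> K.
  by rewrite mulrDl !mul1r expiD expr2.
have -> : `|rho| ^+ 4 = (rho * rho^*) ^+ 2 by rewrite -normCK -exprM.
by rewrite expiD !normCK.
Qed.

End Expi.

(** * Maps that fix the origin *)

Section Rigidity.
Variables (R : realType) (s : bool).
Local Notation K := (Cplx R).
Local Notation V := ('rV[K]_4).
Local Notation pm := ((-1) ^+ s : K).
Implicit Types (z w : V) (t : K).

(** [f x - l x] is additive, so its value at [x] is [n] times its value at [x / n]; the
    latter is [o(1 / n)]. *)
Lemma additive_derivable_linear (f : K -> K) : {morph f : x y / x + y} ->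
  derivable f 0 1 -> exists l, forall x, f x = l * x.
Proof.
move=> fD /derivable_cmodP[l hl]; exists l => x.
have f0 : f 0 = 0.
  by apply: (addrI (f 0)); rewrite -fD !addr0.
have fn n y : f (n%:R * y) = n%:R * f y.
  elim: n => [|n IH]; first by rewrite !mul0r f0.
  by rewrite -natr1 !mulrDl !mul1r fD IH.
apply/eqP; rewrite -subr_eq0 -cmod_eq0; apply/eqP.
apply: small_eq0 => [|e e0]; first exact: cmod_ge0.
have m0 : 0 < cmod x + 1 by rewrite ltr_wpDl ?cmod_ge0.
have [d d0 hd] := hl _ (divr_gt0 e0 m0).
pose n := (Num.truncn (cmod x / d)).+1.
have n0 : (n%:R : K) != 0 by rewrite pnatr_eq0.
have cn : cmod (n%:R : K) = n%:R.
  by rewrite -(rmorph_nat (real_complex R)) cmod_real ger0_norm.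
have ex : x = n%:R * (x / n%:R) by rewrite mulrC divfK.
have small : cmod (x / n%:R) < d.
  rewrite cmodM cmodV cn ltr_pdivrMr ?ltr0n// mulrC -ltr_pdivrMr//.
  exact: truncnS_gt.
have := hd (x / n%:R); rewrite !subr0 f0 subr0 => /(_ small) h.
have -> : f x - l * x = n%:R * (f (x / n%:R) - l * (x / n%:R)).
  by rewrite {1}ex fn {2}ex; ring.
rewrite cmodM cn.
have hn : 0 <= (n%:R : R) by [].
apply: (le_trans (ler_wpM2l hn h)).
have cxn : cmod x = n%:R * cmod (x / n%:R) by rewrite {1}ex cmodM cn.
have -> : n%:R * (e / (cmod x + 1) * cmod (x / n%:R)) = e * (cmod x / (cmod x + 1)).
  by rewrite mulrCA -cxn mulrAC mulrA.
rewrite -[leRHS]mulr1 ler_pM2l// ler_pdivrMr// mul1r lerDl//.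
Qed.

Section Structure.
Variable Psi : V -> V.
Hypothesis Psi_seg : forall z w, seg s z w -> seg s (Psi z) (Psi w).
Hypothesis Psi_base : forall z w, same_base z w -> same_base (Psi z) (Psi w).
Hypothesis Psi0 : Psi 0 = 0.
Hypothesis Psi_der : derivable (fun t => Psi (mk4 0 0 0 t) 0 3) 0 1.
Hypothesis Psi_surj : forall w, exists z, Psi z = w.

Local Notation phi := (fun t => Psi (mk4 0 0 0 t) 0 3).

Lemma same_base0 t : same_base (mk4 0 0 0 t) (0 : V).
Proof. by split; rewrite mk4E mxE. Qed.

Lemma pol_base0 z w : same_base w 0 -> pol s z w = 0.
Proof.
by move=> [e0 e1 e2]; rewrite /pol e0 e1 e2 !mxE !conjC0; ring.
Qed.

(** The pair of [x] and the point of the last axis at height [- x_4^*] satisfies the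
    Segre relation, and the form vanishes against points of this axis. *)
Lemma last_coordE z : Psi z 0 3 = phi (z 0 3).
Proof.
have key x : Psi x 0 3 = - (phi (- (x 0 3)^*))^*.
  have h : seg s x (mk4 0 0 0 (- (x 0 3)^*)).
    by rewrite /seg mk4E conjN conjCK subrr (pol_base0 _ (same_base0 _)) mulr0.
  have := Psi_seg h; rewrite /seg pol_base0 ?mulr0.
    by move=> /eqP; rewrite addr_eq0 => /eqP.
  by have := Psi_base (same_base0 (- (x 0 3)^*)); rewrite Psi0.
by rewrite [LHS]key [RHS]key mk4E.
Qed.

(** In the preserved relation the form only sees the first three coordinates; moving
    both last coordinates while keeping the relation shows that the last component
    depends additively on the value of the form. *)
Lemma last_coord_additive z w : phi (2 * pol s z w) = 2 * pol s (Psi z) (Psi w) /\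
  forall y, phi (2 * pol s z w + y) = phi (2 * pol s z w) + phi y.
Proof.
have skew y : phi y = - (phi (- y^*))^*.
  have h : seg s (mk4 0 0 0 y) (mk4 0 0 0 (- y^*)).
    by rewrite /seg !mk4E conjN conjCK subrr (pol_base0 _ (same_base0 _)) mulr0.
  have := Psi_seg h; rewrite /seg pol_base0 ?mulr0.
    by move=> /eqP; rewrite addr_eq0 => /eqP.
  by have := Psi_base (same_base0 (- y^*)); rewrite Psi0.
have phi0 : phi 0 = 0.
  have -> : mk4 0 0 0 0 = 0 :> V by apply: row4P; rewrite mk4E mxE.
  by rewrite Psi0 mxE.
have main y : phi (2 * pol s z w + y) - phi y = 2 * pol s (Psi z) (Psi w).
  pose z' := mk4 (z 0 0) (z 0 1) (z 0 2) (2 * pol s z w + y).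
  pose w' := mk4 (w 0 0) (w 0 1) (w 0 2) (- y^*).
  have bz : same_base z' z by split; rewrite mk4E.
  have bw : same_base w' w by split; rewrite mk4E.
  have h : seg s z' w'.
    by rewrite /seg (pol_base s bz bw) !mk4E conjN conjCK addrK.
  have := Psi_seg h; rewrite /seg (pol_base s (Psi_base bz) (Psi_base bw)).
  rewrite (last_coordE z') (last_coordE w') !mk4E => <-; congr (_ + _).
  by rewrite [in LHS]skew opprK.
have m0 := main 0; rewrite addr0 phi0 subr0 in m0.
by split=> // y; rewrite m0 -(main y) subrK.
Qed.

Lemma last_coord_linear : exists l, forall t, phi t = l * t.
Proof.
apply: additive_derivable_linear => // x y.
have [_ h] := last_coord_additive (mk4 1 0 0 0) (mk4 0 (x / 2)^* 0 0).
have e : 2 * pol s (mk4 1 0 0 0) (mk4 0 (x / 2)^* 0 0) = x.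
  rewrite /pol !mk4E conjCK !conjC0; field; by rewrite ?pnatr_eq0.
by rewrite e in h; exact: h.
Qed.

(** Dividing by the factor [l] of the last coordinate, the first three components
    satisfy [l * pol z w = pol (Psi z) (Psi w)].  Pairing with preimages of
    coordinate vectors puts every component, and the square of the first one, into the
    span of [z_1], [z_2], [z_3], [z_1 ^ 2].  Since the first component and its square are
    both in this span, the first component is a multiple of [z_1].  Comparing the
    coefficients of the form leaves exactly the parameters of the group: [q] and [phi]
    are the polar coordinates of the first multiplier [a], and [l = q ^ 4]. *)
Lemma linear_part : exists (q phi psi : R) (b d : K),
  [/\ 0 < q, d * d^* = - ((q%:C)%C ^+ 3) * (expi phi * b^* + (expi phi)^-1 * b) &
      Psi =1 palg s (q%:C)%C (expi phi) (expi psi) 0 0 0 b d 0].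
Proof.
have [l hl] := last_coord_linear.
have t0 : (2 : K) != 0 by rewrite pnatr_eq0.
have pl z w : l * pol s z w = pol s (Psi z) (Psi w).
  apply: (mulfI t0); rewrite -(last_coord_additive z w).1 hl; ring.
have last z : Psi z 0 3 = l * z 0 3 by rewrite last_coordE hl.
have l0 : l != 0.
  apply/eqP => l0; have [z hz] := Psi_surj (mk4 0 0 0 1).
  by have := last z; rewrite hz mk4E l0 mul0r => /eqP; rewrite oner_eq0.
pose u x y t : V := mk4 x y t 0.
have ubase z : same_base z (u (z 0 0) (z 0 1) (z 0 2)) by split; rewrite mk4E.
have pu x y t w : pol s (u x y t) w =
    x * (w 0 1)^* + y * (w 0 0)^* + t * (w 0 2)^* + pm * (x ^+ 2 * (w 0 0)^* ^+ 2).
  by rewrite /pol !mk4E.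
have pm2 : pm * pm = 1 by rewrite -exprMn mulrNN mulr1 expr1n.
(* preimages of the coordinate vectors express the components of Psi through
   the span of z_1, z_2, z_3, z_1 ^ 2 *)
have [w0 hw0] := Psi_surj (u 0 1 0).
have [w2 hw2] := Psi_surj (u 0 0 1).
have [w1 hw1] := Psi_surj (u 1 0 0).
have [w1' hw1'] := Psi_surj (u (-1) 0 0).
have A0 z : Psi z 0 0 = l * pol s z w0.
  by rewrite pl hw0 /pol !mk4E !(conjN, conj1, conjC0); ring.
have A2 z : Psi z 0 2 = l * pol s z w2.
  by rewrite pl hw2 /pol !mk4E !(conjN, conj1, conjC0); ring.
have A1p z : Psi z 0 1 + pm * Psi z 0 0 ^+ 2 = l * pol s z w1.
  by rewrite pl hw1 /pol !mk4E !(conjN, conj1, conjC0); ring.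
have A1m z : - Psi z 0 1 + pm * Psi z 0 0 ^+ 2 = l * pol s z w1'.
  by rewrite pl hw1' /pol !mk4E !(conjN, conj1, conjC0); ring.
have A1 z : Psi z 0 1 = l / 2 * (pol s z w1 - pol s z w1').
  have -> : l / 2 * (pol s z w1 - pol s z w1') = (l * pol s z w1 - l * pol s z w1') / 2.
    by ring.
  by rewrite -A1p -A1m; field; rewrite ?t0.
have A0sq z : Psi z 0 0 ^+ 2 = pm * l / 2 * (pol s z w1 + pol s z w1').
  have -> : pm * l / 2 * (pol s z w1 + pol s z w1') =
      pm * (l * pol s z w1 + l * pol s z w1') / 2 by ring.
  rewrite -A1p -A1m; move: pm2; move: pm (Psi z 0 0) (Psi z 0 1) => p x y pp.
  have -> : p * (y + p * x ^+ 2 + (- y + p * x ^+ 2)) / 2 = (p * p) * x ^+ 2.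
    by field; rewrite ?t0.
  by rewrite pp mul1r.
have sq0 (x y : K) : x ^+ 2 = y -> x ^+ 2 = - y -> x = 0.
  move=> e1 e2; apply/eqP; rewrite -sqrf_eq0.
  have : x ^+ 2 * 2 = 0 by rewrite mulr_natr mulr2n {2}e2 e1 subrr.
  by move=> /eqP; rewrite mulf_eq0 (negbTE t0) orbF.
have w00 : w0 0 0 = 0.
  have e1 := A0sq (u 0 1 0); have e2 := A0sq (u 0 (-1) 0).
  rewrite A0 !pu in e1; rewrite A0 !pu in e2.
  have h : l * (w0 0 0)^* = 0.
    apply: (sq0 _ (pm * l / 2 * ((w1 0 0)^* + (w1' 0 0)^*))).
      by apply: etrans (etrans e1 _); ring.
    by apply: etrans (etrans e2 _); ring.
  by apply/eqP; move/eqP: h; rewrite mulf_eq0 (negbTE l0) conjC_eq0.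
have w02 : w0 0 2 = 0.
  have e1 := A0sq (u 0 0 1); have e2 := A0sq (u 0 0 (-1)).
  rewrite A0 !pu in e1; rewrite A0 !pu in e2.
  have h : l * (w0 0 2)^* = 0.
    apply: (sq0 _ (pm * l / 2 * ((w1 0 2)^* + (w1' 0 2)^*))).
      by apply: etrans (etrans e1 _); ring.
    by apply: etrans (etrans e2 _); ring.
  by apply/eqP; move/eqP: h; rewrite mulf_eq0 (negbTE l0) conjC_eq0.
pose a := l * (w0 0 1)^*.
have B0 z : Psi z 0 0 = a * z 0 0.
  by rewrite A0 /pol w00 w02 !conjC0 /a; ring.
clearbody a.
have [b0 [b1 [b2 [b3 B1]]]] : exists b0 b1 b2 b3, forall z,
    Psi z 0 1 = b0 * z 0 0 + b1 * z 0 1 + b2 * z 0 2 + b3 * z 0 0 ^+ 2.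
  exists (l / 2 * ((w1 0 1)^* - (w1' 0 1)^*)), (l / 2 * ((w1 0 0)^* - (w1' 0 0)^*)),
    (l / 2 * ((w1 0 2)^* - (w1' 0 2)^*)),
    (l / 2 * pm * ((w1 0 0)^* ^+ 2 - (w1' 0 0)^* ^+ 2)) => z.
  by rewrite A1 /pol; ring.
have [c0 [c1 [c2 [c3 B2]]]] : exists c0 c1 c2 c3, forall z,
    Psi z 0 2 = c0 * z 0 0 + c1 * z 0 1 + c2 * z 0 2 + c3 * z 0 0 ^+ 2.
  exists (l * (w2 0 1)^*), (l * (w2 0 0)^*), (l * (w2 0 2)^*),
    (l * pm * (w2 0 0)^* ^+ 2) => z.
  by rewrite A2 /pol; ring.
(* comparing coefficients in [l * pol z w = pol (Psi z) (Psi w)] *)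
have cmp x y t x' y' t' :
    l * (x * y'^* + y * x'^* + t * t'^* + pm * (x ^+ 2 * x'^* ^+ 2)) =
    a * x * (b0^* * x'^* + b1^* * y'^* + b2^* * t'^* + b3^* * x'^* ^+ 2) +
    (b0 * x + b1 * y + b2 * t + b3 * x ^+ 2) * (a^* * x'^*) +
    (c0 * x + c1 * y + c2 * t + c3 * x ^+ 2) *
      (c0^* * x'^* + c1^* * y'^* + c2^* * t'^* + c3^* * x'^* ^+ 2) +
    pm * ((a * x) ^+ 2 * (a^* * x'^*) ^+ 2).
  have := pl (u x y t) (u x' y' t').
  by rewrite /pol !B0 !B1 !B2 !mk4E !(conjD, conjM, conjX).
have C1 : c1 = 0.
  have := cmp 0 1 0 0 1 0; rewrite !(conj1, conjC0) => h.
  have : c1 * c1^* = 0 by apply: etrans (etrans (esym h) _); ring.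
  by move=> /eqP; rewrite mulf_eq0 conjC_eq0 orbb => /eqP.
have C2 : l = c2 * c2^*.
  have := cmp 0 0 1 0 0 1; rewrite !(conj1, conjC0) => h.
  by apply: etrans (etrans h _); ring.
have c20 : c2 != 0.
  by apply/eqP => e; move/eqP: l0; apply; rewrite C2 e mul0r.
have R31 := cmp 0 0 1 1 0 0; have R3N1 := cmp 0 0 1 (-1) 0 0.
rewrite !(conj1, conjC0, conjN) in R31; rewrite !(conj1, conjC0, conjN) in R3N1.
have C3 : c3 = 0.
  have : c2 * c3^* * 2 = 0.
    have -> : c2 * c3^* * 2 = (b2 * a^* + c2 * (c0^* + c3^*)) + (- (b2 * a^*) + c2 * (- c0^* + c3^*)).
      by ring.
    have -> : b2 * a^* + c2 * (c0^* + c3^*) = 0.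
      by apply: etrans (etrans (esym R31) _); ring.
    rewrite add0r; by apply: etrans (etrans (esym R3N1) _); ring.
  by move=> /eqP; rewrite !mulf_eq0 (negbTE t0) (negbTE c20) orbF conjC_eq0 => /eqP.
have C0 : b2 * a^* + c2 * c0^* = 0.
  rewrite C3 conjC0 in R31.
  by apply: etrans (etrans (esym R31) _); ring.
have Bb : l = b1 * a^*.
  have := cmp 0 1 0 1 0 0; rewrite !(conj1, conjC0) C1 => h.
  by apply: etrans (etrans h _); ring.
have a0 : a != 0.
  by apply/eqP => e; move/eqP: l0; apply; rewrite Bb e conjC0 mulr0.
rewrite C1 C3 conjC0 in cmp.
pose P := a * b0^* + b0 * a^* + c0 * c0^*.
pose S := a * b3^*.
pose Y := pm * (l - a ^+ 2 * a^* ^+ 2).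
have Sc : S^* = b3 * a^* by rewrite /S conjM conjCK mulrC.
have E11 : Y = P + S + S^*.
  have := cmp 1 0 0 1 0 0; rewrite !(conj1, conjC0) => h.
  rewrite Sc /Y /P /S; apply/eqP; rewrite mulrBr subr_eq; apply/eqP.
  by apply: etrans (etrans _ h) _; ring.
have E1N : Y = - P + S - S^*.
  have := cmp 1 0 0 (-1) 0 0; rewrite !(conj1, conjC0, conjN) => h.
  rewrite Sc /Y /P /S; apply/eqP; rewrite mulrBr subr_eq; apply/eqP.
  by apply: etrans (etrans _ h) _; ring.
have EN1 : Y = - P - S + S^*.
  have := cmp (-1) 0 0 1 0 0; rewrite !(conj1, conjC0, conjN) => h.
  rewrite Sc /Y /P /S; apply/eqP; rewrite mulrBr subr_eq; apply/eqP.
  by apply: etrans (etrans _ h) _; ring.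
have E22 : 16 * Y = 4 * P + 8 * S + 8 * S^*.
  have := cmp 2 0 0 2 0 0; rewrite !(conjn, conjC0) => h.
  rewrite Sc /Y /P /S; apply/eqP; rewrite mulrBr mulrBr subr_eq; apply/eqP.
  by apply: etrans (etrans _ h) _; ring.
have P0 : P = 0.
  have h : Y = - P.
    by apply: (mulfI t0); rewrite mulr_natl mulr2n {1}E1N EN1; ring.
  have e : 16 * Y = 4 * P + 8 * (Y - P) by rewrite E22 E11; ring.
  have : 4 * P = 0.
    have -> : 4 * P = (4 * P + 8 * (Y - P)) - 16 * Y + 8 * (P + Y) by ring.
    by rewrite -e subrr h subrr mulr0 addr0.
  by move=> /eqP; rewrite mulf_eq0 pnatr_eq0 /= => /eqP.
rewrite P0 in E11 E1N EN1.
have S0 : S = 0.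
  have Y0 : Y = 0.
    by apply: (mulfI t0); rewrite mulr_natl mulr2n {1}E1N EN1; ring.
  have : 2 * S = 0.
    have -> : 2 * S = (0 + S + S^*) + (- 0 + S - S^*) by ring.
    by rewrite -E11 -E1N Y0 addr0.
  by move=> /eqP; rewrite mulf_eq0 (negbTE t0) => /eqP.
have B3 : b3 = 0.
  by move/eqP: S0; rewrite mulf_eq0 (negbTE a0) conjC_eq0 => /eqP.
have la : l = (a * a^*) ^+ 2.
  have : Y = 0 by rewrite E11 S0 conjC0 !addr0.
  move=> /eqP; rewrite mulf_eq0 signr_eq0 /= subr_eq0 => /eqP ->.
  by rewrite exprMn.
have [x ax] := polar a; have [y cy] := polar c2.
pose q : K := ((cmod a)%:C)%C.
have q0 : q != 0 by rewrite -cmod_eq0 cmod_real normr_eq0 gt_eqF// cmod_gt0.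
have sq (k : K) : k * k^* = ((cmod k)%:C)%C ^+ 2 by rewrite -normCK cmodE.
have lq : l = q ^+ 4 by rewrite la sq -exprM.
have c2q : ((cmod c2)%:C)%C = q ^+ 2 :> K.
  have h : cmod c2 ^+ 2 = (cmod a ^+ 2) ^+ 2.
    apply: complexI; rewrite !rmorphXn /=.
    by rewrite -sq -C2 lq -exprM.
  have h2 : cmod c2 = cmod a ^+ 2.
    by apply/eqP; rewrite -(eqrXn2 (ltn0Sn 1)) ?cmod_ge0 ?exprn_ge0 ?cmod_ge0// h.
  by rewrite h2 rmorphXn.
have E0 := expi_neq0 x; have W0 := expi_neq0 y.
have aE : a = q * expi x by [].
have cE : c2 = q ^+ 2 * expi y by rewrite {1}cy c2q.
have acE : a^* = q * (expi x)^-1 by rewrite aE conjM conjR conj_expi.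
have ccE : c2^* = q ^+ 2 * (expi y)^-1 by rewrite cE conjM conjX conjR conj_expi.
have bE : b1 = q ^+ 3 * expi x.
  have ac0 : a^* != 0 by rewrite conjC_eq0.
  apply: (mulIf ac0); rewrite -Bb lq acE; field; exact: E0.
have c0E : c0 = - (b2 / q)^* * (expi x * expi y).
  have cc0 : c2^* != 0 by rewrite conjC_eq0.
  apply: (mulfI cc0); have /(congr1 (fun k => k^*)) := C0.
  rewrite conjD !conjM !conjCK conjC0 => /eqP; rewrite addrC addr_eq0 => /eqP ->.
  rewrite conjV conjR -/q ccE aE; field; by rewrite ?W0 ?q0.
exists (cmod a), x, y, (b0 / q ^+ 2), (b2 / q).
rewrite -/q; split.
- by rewrite cmod_gt0.
- have hq : (q : K)^* = q by exact: conjR.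
  have hc : c0 * c0^* = b2 / q * (b2 / q)^*.
    rewrite c0E; move: (b2 / q) => D; rewrite !(conjM, conjN, conjCK) !conj_expi.
    by field; rewrite ?E0 ?W0.
  rewrite -hc.
  have -> : c0 * c0^* = P - (a * b0^* + b0 * a^*) by rewrite /P; ring.
  rewrite P0 acE aE !(conjM, conjV, conjX) hq; field; by rewrite ?E0 ?q0.
- move=> z; apply: row4P; rewrite /palg !mk4E ?conjC0.
  + by rewrite B0 aE addr0.
  + by rewrite B1 B3 bE; field; rewrite ?q0.
  + by rewrite B2 C1 C3 cE c0E; ring.
  + by rewrite last lq; ring.
Qed.
End Structure.
End Rigidity.

(** * The automorphism groups *)

Section MainTheorem.
Variables (R : realType) (s : bool).
Local Notation K := (Cplx R).
Local Notation V := ('rV[K]_4).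
Local Notation pm := ((-1) ^+ s : K).
Implicit Types (z w : V) (t : K).

Lemma segE z w : seg s z w <-> z 0 3 + (w 0 3)^* - 2 * pol s z w = 0.
Proof.
by rewrite /seg; split=> [->|/eqP]; [exact: subrr|rewrite subr_eq0 => /eqP].
Qed.

(** Every element of the group is a translation after a map that fixes the origin. *)
Lemma palg_comp q E W rho sigma tau b d v z :
  palg s 1 1 1 rho sigma tau 0 0 v (palg s q E W 0 0 0 b d 0 z) =
  palg s q E W rho sigma tau b d v z.
Proof. by apply: row4P; rewrite /palg !mk4E ?conjC0; ring. Qed.

Lemma palg_inv_base q E W rho sigma tau b d v z w : same_base z w ->
  same_base (palg_inv s q E W rho sigma tau b d v z)
            (palg_inv s q E W rho sigma tau b d v w).
Proof.
move=> [e0 e1 e2].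
have p1 : pinv1 q E rho z = pinv1 q E rho w by rewrite /pinv1 e0.
have p3 : pinv3 q E W rho tau d z = pinv3 q E W rho tau d w.
  by rewrite /pinv3 e2 p1.
by split; rewrite !mk4E// /pinv2 e1 p1 p3.
Qed.

(** The term [E^-1 * b] is the conjugate of [E * b^*]; that the real part is nonpositive
    follows from the equation, since [|d| ^ 2] is nonnegative. *)
Lemma group_condition (q phi : R) (b d : K) : 0 < q ->
  d * d^* = - ((q%:C)%C ^+ 3) * (expi phi * b^* + (expi phi)^-1 * b) <->
  'Re (expi phi * b^*) <= 0 /\
  `|d| ^+ 2 = - 2 * (q%:C)%C ^+ 3 * 'Re (expi phi * b^*).
Proof.
move=> q0; set x : K := expi phi * b^*.
have xJ : (expi phi)^-1 * b = x^* by rewrite /x conjM conj_expi conjCK.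
have xR : x + x^* = 2 * 'Re x.
  by rewrite ReJ complexRe.
have q3 : 0 < (q%:C)%C ^+ 3 :> K by rewrite exprn_gt0// ltcR.
rewrite xJ xR -normCK; split.
  move=> h; have h2 : `|d| ^+ 2 = - 2 * (q%:C)%C ^+ 3 * 'Re x by rewrite h; ring.
  split=> //; have : 0 <= `|d| ^+ 2 by rewrite exprn_ge0.
  rewrite h2 -mulrA mulNr oppr_ge0 pmulr_rle0// pmulr_rle0//.
by move=> [_ ->]; ring.
Qed.

Lemma P_groupP (p : V -> V) : P_group R s p <->
  exists (q phi psi u : R) (rho sigma tau b d : K),
    [/\ 0 < q, d * d^* = - ((q%:C)%C ^+ 3) * (expi phi * b^* + (expi phi)^-1 * b) &
     p = palg s (q%:C)%C (expi phi) (expi psi) rho sigma tau b d ('i * (u%:C)%C)].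
Proof.
split.
  move=> [q [phi [psi [u [rho [sigma [tau [b [d [q0 h1 h2 ->]]]]]]]]]].
  exists q, phi, psi, u, rho, sigma, tau, b, d; split=> //; last exact: P_mapE.
  by apply/(group_condition phi b d q0).
move=> [q [phi [psi [u [rho [sigma [tau [b [d [q0 /group_condition h ->]]]]]]]]]].
have [h1 h2] := h q0.
by exists q, phi, psi, u, rho, sigma, tau, b, d; split=> //; rewrite P_mapE.
Qed.

Variable sg : R.
Hypothesis sg1 : sg = 1 \/ sg = -1.
Local Notation delta := (defect s sg).
Local Notation D := [set z : V | 0 < delta z].

Lemma defect_polar z : z 0 3 + (z 0 3)^* - 2 * pol s z z = ((2 * sg * delta z)%:C)%C.
Proof.
have rp : pol s z z = ((complex.Re (pol s z z))%:C)%C.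
  by apply: conj_eq_real; exact: pol_conj.
rewrite ReJ {1}rp /defect creB mulrA -(mulrA 2) sg_sqr// mulr1.
by rewrite -mulrBr -rmorphB rmorphM rmorph_nat.
Qed.

(** The group multiplies [delta] by the positive number [q ^ 4]. *)
Lemma group_in_Aut p : P_group R s p -> biholomorphic_self_map D p.
Proof.
move=> /P_groupP[q [phi [psi [u [rho [sigma [tau [b [d [q0 db ->]]]]]]]]]].
set Q : K := (q%:C)%C; set E : K := expi phi; set W : K := expi psi.
set v := 'i * _.
have Q0 : Q != 0 by rewrite -cmod_eq0 cmod_real normr_eq0 gt_eqF.
have E0 : E != 0 by exact: expi_neq0.
have W0 : W != 0 by exact: expi_neq0.
have vr : v^* = - v by rewrite /v conjM conji conjR mulNr.
have dP z : delta (palg s Q E W rho sigma tau b d v z) = q ^+ 4 * delta z.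
  have := palg_seg s rho sigma tau Q0 E0 W0 (conjR q) (conj_expi phi) (conj_expi psi)
    vr db z z.
  rewrite !defect_polar /Q -rmorphXn -rmorphM => /complexI.
  have n0 : 2 * sg != 0.
    by case: sg1 => ->; rewrite ?mulr1 ?mulrN1 ?oppr_eq0 pnatr_eq0.
  by move=> h; apply: (mulfI n0); rewrite h mulrCA.
have q4 : 0 < q ^+ 4 by rewrite exprn_gt0.
exists (palg_inv s Q E W rho sigma tau b d v); split.
- by move=> z _; exact: differentiable_palg.
- by move=> z _; exact: differentiable_palg_inv.
- split.
  + by move=> z /= Dz; rewrite dP mulr_gt0.
  + move=> z /= Dz; rewrite -(pmulr_rgt0 _ q4) -dP palg_invK//.
  + by move=> z _; exact: palgK.
  + by move=> z _; exact: palg_invK.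
Qed.

(** Extended to entire maps, an automorphism preserves the Segre relation and the
    vertical lines.  A translation of the group brings the image of the origin back to
    the origin, where [linear_part] applies. *)
Theorem Aut_in_group f : biholomorphic_self_map D f ->
  exists2 p, P_group R s p & forall z, D z -> f z = p z.
Proof.
move=> [g [hf hg [fD gD fK gK]]].
have [F hF Ff] := hol_map_extension sg1 hf.
have [G hG Gg] := hol_map_extension sg1 hg.
have FD z : D z -> D (F z) by move=> Dz; rewrite (Ff _ Dz); exact: fD.
have GD z : D z -> D (G z) by move=> Dz; rewrite (Gg _ Dz); exact: gD.
have GF : forall z, G (F z) = z.
  apply: (hol_map_eq (s := s) sg1 (hol_map_comp hG hF) (@hol_map_id R)) => z Dz.
  by rewrite (Gg _ (FD _ Dz)) (Ff _ Dz); exact: (fK z (mem_set Dz)).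
have FG : forall z, F (G z) = z.
  apply: (hol_map_eq (s := s) sg1 (hol_map_comp hF hG) (@hol_map_id R)) => z Dz.
  by rewrite (Ff _ (GD _ Dz)) (Gg _ Dz); exact: (gK z (mem_set Dz)).
have Fseg := segre_preserved sg1 hF (boundary_preserved sg1 hF FD GD GF).
have Gseg := segre_preserved sg1 hG (boundary_preserved sg1 hG GD FD FG).
have Fbase := fibers_preserved Gseg GF.
(* normalize the image of the origin by a translation of the group *)
have b00 : same_base (0 : V) 0 by split.
have seg00 : seg s (0 : V) 0 by rewrite /seg (pol_base0 s _ b00) !mxE conjC0 addr0 mulr0.
have pp := Fseg _ _ seg00.
pose rho := F 0 0 0; pose sigma := F 0 0 1; pose tau := F 0 0 2.
pose u := complex.Im (F 0 0 3).
pose v : K := 'i * (u%:C)%C.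
have vr : v^* = - v by rewrite /v conjM conji conjR mulNr.
have F03 : F 0 0 3 = rho * sigma^* + sigma * rho^* + tau * tau^* +
    pm * (rho * rho^*) ^+ 2 + v.
  have e1 : F 0 0 3 + (F 0 0 3)^* = 2 * pol s (F 0) (F 0) by [].
  have e2 : F 0 0 3 - (F 0 0 3)^* = 2 * v.
    by rewrite [LHS]subcJ /v /u -complexiE; ring.
  have t0 : (2 : K) != 0 by rewrite pnatr_eq0.
  apply: (mulfI t0).
  have -> : 2 * F 0 0 3 = (F 0 0 3 + (F 0 0 3)^*) + (F 0 0 3 - (F 0 0 3)^*) by ring.
  by rewrite e1 e2 /pol -/rho -/sigma -/tau; ring.
pose Tr := palg s 1 1 1 rho sigma tau 0 0 v.
pose Ti := palg_inv s 1 1 1 rho sigma tau 0 0 v.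
have n1 : (1 : K) != 0 by exact: oner_neq0.
have TrK : cancel Tr Ti by move=> z; exact: palgK.
have TiK : cancel Ti Tr by move=> z; exact: palg_invK.
have Trseg z w : seg s (Tr z) (Tr w) <-> seg s z w.
  have one1 : (1 : K)^* = 1^-1 by rewrite conj1 invr1.
  have db0 : (0 : K) * 0^* = - 1 ^+ 3 * (1 * 0^* + 1^-1 * 0).
    by rewrite conjC0 !mulr0 addr0 mulr0.
  rewrite !segE (palg_seg s rho sigma tau n1 n1 n1 (conj1 R) one1 one1 vr db0).
  by rewrite expr1n mul1r.
pose Psi z := Ti (F z).
have Psi_seg z w : seg s z w -> seg s (Psi z) (Psi w).
  by move=> zw; apply/Trseg; rewrite /Psi !TiK; exact: Fseg.
have Psi_base z w : same_base z w -> same_base (Psi z) (Psi w).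
  by move=> zw; apply: palg_inv_base; exact: Fbase.
have Tr0 : Tr 0 = F 0.
  apply: row4P; rewrite /Tr /palg !mk4E !mxE -/rho -/sigma -/tau ?F03; ring.
have Psi0 : Psi 0 = 0 by rewrite /Psi -Tr0 TrK.
have Psi_surj w : exists z, Psi z = w by exists (G (Tr w)); rewrite /Psi FG TrK.
have line : hol_curve (fun t : K => mk4 0 0 0 t).
  have -> : (fun t : K => mk4 0 0 0 t) = (fun t => 0 + t *: (delta_mx 0 3 : V)).
    by apply/funext => t; apply: row4P; rewrite mk4E !mxE /=; ring.
  exact: hol_curve_line.
have Psi_der : derivable (fun t => Psi (mk4 0 0 0 t) 0 3) 0 1.
  have -> : (fun t => Psi (mk4 0 0 0 t) 0 3) = (fun t => F (mk4 0 0 0 t) 0 3 - F 0 0 3).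
    apply/funext => t; have [e0 e1 e2] := Fbase _ _ (same_base0 t).
    rewrite /Psi /Ti mk4E.
    have p1 : pinv1 1 1 rho (F (mk4 0 0 0 t)) = 0 by rewrite /pinv1 e0 subrr mulr0.
    have p3 : pinv3 1 1 1 rho tau 0 (F (mk4 0 0 0 t)) = 0.
      by rewrite /pinv3 p1 e2 subrr mulr0 addr0 mulr0.
    have p2 : pinv2 s 1 1 1 rho sigma tau 0 0 (F (mk4 0 0 0 t)) = 0.
      by rewrite /pinv2 p1 p3 e1 subrr !mulr0 !subr0 addr0 mulr0.
    rewrite /pinv4 p1 p2 p3 !mulr0 !subr0 addr0 expr1n invr1 mul1r F03.
    by [].
  exact: (@derivable_sub R _ (fun=> F 0 0 3) 0 (hF _ line 3 0) (derivable_const _ 0)).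
have [q [phi [psi [b [d [q0 db eP]]]]]] :=
  linear_part Psi_seg Psi_base Psi0 Psi_der Psi_surj.
exists (palg s (q%:C)%C (expi phi) (expi psi) rho sigma tau b d v).
  by apply/P_groupP; exists q, phi, psi, u, rho, sigma, tau, b, d; split.
move=> z Dz; rewrite -(Ff _ Dz) -palg_comp -eP -/Tr /Psi.
by rewrite TiK.
Qed.

Theorem Aut_model : Aut D = sigL D @` P_group R s.
Proof.
apply/seteqP; split=> h [f hf <-].
  have [p hp fp] := Aut_in_group hf; exists p => //.
  apply/funext => -[z Dz]; rewrite /sigL /=; symmetry; apply: fp.
  exact: (set_mem Dz).
by exists f => //; exact: group_in_Aut.
Qed.

End MainTheorem.

Theorem theorem2p1 (R : realType) (s : bool) :
  Aut (Dgt R s) = sigL (Dgt R s) @` P_group R s /\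
  Aut (Dlt R s) = sigL (Dlt R s) @` P_group R s.
Proof.
have rp z : pol s z z = ((complex.Re (pol s z z))%:C)%C.
  by apply: conj_eq_real; exact: pol_conj.
have -> : Dgt R s = [set z | 0 < defect s 1 z].
  apply/seteqP; split=> z; rewrite /Dgt /= model_funE rp -complexRe ltcR;
  by rewrite /defect mul1r creB subr_gt0.
have -> : Dlt R s = [set z | 0 < defect s (-1) z].
  apply/seteqP; split=> z; rewrite /Dlt /= model_funE rp -complexRe ltcR;
  by rewrite /defect mulN1r creB oppr_gt0 subr_lt0.
by split; apply: Aut_model; [left|right].
Qed.
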